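(* Let $n\in\mathbb{N}$ and $\lambda\in[0,\frac{2\pi}{n})$. (i) If $G$ is a polynomial of degree $n$, then $F*_{\lambda}G\in\mathcal{D}_{n}(\lambda)$ for all $F\in\overline{\mathcal{D}}_{n}(\lambda)$ if, and only if, $G\in\mathcal{D}_{n}(\lambda)$. (ii) If $\lambda<\mu<\frac{2\pi}{n}$ and if $f\in\mathcal{P}\overline{\mathcal{D}}_{n}(\lambda)$ is such that $f+\zeta f^{*n}$ is not pre-extremal for any $\zeta\in\mathbb{T}$, then $f\in\mathcal{PD}_{n}(\mu)$. (iii) Let $f(z)=\sum_{k=0}^{n}a_{k}z^{k}$ be of degree $n$ with $|a_{0}|<|a_{n}|$. There is a $\lambda\in[0,\frac{2\pi}{n})$ such that $f$ belongs to $\mathcal{PD}_{n}(\lambda)\setminus\mathcal{PT}_{n}(\lambda)$ if, and only if, $$\operatorname{Re}\frac{f(z)-a_{0}}{a_{n}z^{n}-a_{0}}>\frac12,\qquad z\in\mathbb{C}\setminus\mathbb{D}.$$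
   Context: All polynomials have complex coefficients. $\mathbb{D}$ is the open unit disk, $\overline{\mathbb{D}}$ its closure, $\mathbb{T}$ the unit circle. For $\Omega\subseteq\mathbb{C}$, $\pi_{n}(\Omega)$ is the set of polynomials of degree $n$ all of whose zeros lie in $\Omega$. For $\lambda\in[0,\frac{2\pi}{n})$ put $$Q_{n}(\lambda;z)=\prod_{j=1}^{n}\bigl(1+e^{i(2j-n-1)\lambda/2}z\bigr)=\sum_{k=0}^{n}C_{k}^{(n)}(\lambda)z^{k}.$$ All $C_{k}^{(n)}(\lambda)$ ($0\le k\le n$) are nonzero, and $C_k^{(n)}(0)=\binom nk$. For $F(z)=\sum_{k=0}^{n}C_{k}^{(n)}(\lambda)a_{k}z^{k}$ and $G(z)=\sum_{k=0}^{n}C_{k}^{(n)}(\lambda)b_{k}z^{k}$ define $F*_{\lambda}G(z)=\sum_{k=0}^{n}C_{k}^{(n)}(\lambda)a_{k}b_{k}z^{k}$. $\mathcal{T}_{n}(\lambda)$ is the set of polynomials of degree $n$ all of whose zeros lie on $\mathbb{T}$ and such that each pair of zeros (counted with multiplicity) is separated by an angle $>\lambda$; thus $\mathcal{T}_n(0)$ consists of the polynomials of degree $n$ with only simple zeros, all on $\mathbb{T}$. For $\lambda\in(0,\frac{2\pi}{n})$ and a polynomial $F$ write $F_{+}(z)=F(e^{i\lambda/2}z)$, $F_{-}(z)=F(e^{-i\lambda/2}z)$. $\overline{\mathcal{D}}_{n}(\lambda)$ is the set of polynomials $F$ of degree $n$ with $$\operatorname{Im}\Bigl(e^{-in\lambda/2}\frac{F_{+}(z)}{F_{-}(z)}\Bigr)>0\quad\text{for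 all } z\in\mathbb{C}\setminus\overline{\mathbb{D}},$$ and $\mathcal{D}_{n}(\lambda)$ is the union of $\mathcal{T}_{n}(\lambda)$ with the set of all polynomials $F$ of degree $n$ for which the same inequality holds for all $z\in\mathbb{C}\setminus\mathbb{D}$. For $\lambda=0$: $\overline{\mathcal{D}}_{n}(0)=\pi_{n}(\overline{\mathbb{D}})$ and $\mathcal{D}_{n}(0)=\pi_{n}(\mathbb{D})\cup\mathcal{T}_{n}(0)$. For a class $\mathcal{C}_{n}(\lambda)$ of polynomials of degree $n$ (here $\mathcal C=\overline{\mathcal D},\mathcal D,\mathcal T$), the pre-coefficient class $\mathcal{PC}_{n}(\lambda)$ consists of all $f(z)=\sum_{k=0}^{n}a_{k}z^{k}$ with $\sum_{k=0}^{n}C_{k}^{(n)}(\lambda)a_{k}z^{k}\in\mathcal{C}_{n}(\lambda)$; these are denoted $\mathcal{P}\overline{\mathcal{D}}_{n}(\lambda)$, $\mathcal{PD}_{n}(\lambda)$, $\mathcal{PT}_{n}(\lambda)$. A pre-extremal polynomial is one of the form $a\sum_{k=0}^{n}b^{k}z^{k}$ with $a\in\mathbb{C}\setminus\{0\}$, $b\in\mathbb{T}$. For a polynomial $f$ of degree $\le n$ its $n$-inverse is $f^{*n}(z)=z^{n}\overline{f(1/\overline{z})}$, i.e. $\bigl(\sum_{k=0}^n a_kz^k\bigr)^{*n}=\sum_{k=0}^n\overline{a_{n-k}}z^k$. *)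

(* Defs.v *)
From HB Require Import structures.
From mathcomp Require Import all_boot all_order all_algebra.
From mathcomp Require Import complex.
From mathcomp Require Import all_classical all_reals all_analysis.
Set Implicit Arguments.
Unset Strict Implicit.
Unset Printing Implicit Defensive.
Import Order.TTheory GRing.Theory Num.Theory.
Local Open Scope classical_set_scope.
Local Open Scope ring_scope.

(* MathComp world.  The complex numbers are R[i] for R : realType.  The norm
   `|z| of z : R[i] is itself an element of R[i] (with zero imaginary part),
   whereas complex.Re z and complex.Im z are elements of R. *)

Section Classes.
Variables (R : realType) (n : nat).
Implicit Types (lambda : R) (F G f : {poly R[i]}) (Omega : set R[i]).

Definition expi (t : R) : R[i] := (cos t +i* sin t)%C.

(* The index j runs over 0, ..., n - 1 instead of 1, ..., n. *)
Definition Qpoly lambda : {poly R[i]} :=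
  \prod_(j < n)
    (1 + expi ((2 * j.+1%:R - n%:R - 1) * lambda / 2) *: 'X).

Definition Qcoef lambda (k : nat) : R[i] := (Qpoly lambda)`_k.

Definition weighted lambda f : {poly R[i]} :=
  \poly_(k < n.+1) (Qcoef lambda k * f`_k).

(* With F = sum_k C_k a_k z^k and G = sum_k C_k b_k z^k, one has
   a_k = F_k / C_k and b_k = G_k / C_k, as C_k != 0 for
   0 <= lambda < 2 pi / n and k <= n. *)
Definition lambda_conv lambda F G : {poly R[i]} :=
  \poly_(k < n.+1)
    (Qcoef lambda k * (F`_k / Qcoef lambda k) * (G`_k / Qcoef lambda k)).

Definition zeros_in Omega : set {poly R[i]} :=
  [set F : {poly R[i]} | size F = n.+1 /\ forall z, root F z -> Omega z].

(* The angle in [0, pi] between two points of the unit circle. *)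
Definition angle (z w : R[i]) : R := acos (complex.Re (z * w^*)).

(* zs lists the zeros of F with multiplicity. *)
Definition classT lambda : set {poly R[i]} :=
  [set F : {poly R[i]} | size F = n.+1 /\
    exists zs : seq R[i],
      [/\ F = lead_coef F *: \prod_(z <- zs) ('X - z%:P),
          forall z, z \in zs -> `|z| = 1
        & pairwise (fun z w => lambda < angle z w) zs]].

(* At a zero of F_- the quotient below is 0 by convention, so that the
   inequality fails there. *)
Definition im_pos_on lambda Omega : set {poly R[i]} :=
  [set F : {poly R[i]} | size F = n.+1 /\ forall z, Omega z ->
    0 < complex.Im (expi (- (n%:R * lambda / 2)) *
                    (F.[expi (lambda / 2) * z] / F.[expi (- (lambda / 2)) * z]))].

Definition classDbar lambda : set {poly R[i]} :=
  if lambda == 0 then zeros_in [set z : R[i] | `|z| <= 1]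
  else im_pos_on lambda [set z : R[i] | 1 < `|z|].

Definition classD lambda : set {poly R[i]} :=
  (if lambda == 0 then zeros_in [set z : R[i] | `|z| < 1]
   else im_pos_on lambda [set z : R[i] | 1 <= `|z|]) `|` classT lambda.

Definition precoef (cls : R -> set {poly R[i]}) lambda : set {poly R[i]} :=
  [set f : {poly R[i]} | (size f <= n.+1)%N /\ cls lambda (weighted lambda f)].

Definition pre_extremal f : Prop :=
  exists a b : R[i],
    [/\ a != 0, `|b| = 1 & f = \poly_(k < n.+1) (a * b ^+ k)].

Definition n_inverse f : {poly R[i]} := \poly_(k < n.+1) (f`_(n - k))^*.

End Classes.

(* Main.v *)
Require Import Defs.
From HB Require Import structures.
From mathcomp Require Import all_boot all_order all_algebra.
From mathcomp Require Import complex.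
From mathcomp Require Import all_classical all_reals all_analysis.
From mathcomp Require Import perm ring lra zify.
Set Implicit Arguments.
Unset Strict Implicit.
Unset Printing Implicit Defensive.
Import Order.TTheory GRing.Theory Num.Theory.
Import numFieldNormedType.Exports.
Local Open Scope classical_set_scope.
Local Open Scope ring_scope.

(** Why the theorem is true.

Write n = m + 1.  To a coefficient list f attach its kernel
A_f = sum_(k <= m) C_k^(m)(lam) f_k X^k and the kernel D_f of the shifted
list f_1, ..., f_n.  The q-Pascal rules turn F = weighted n lam f into
F(exp(-i lam/2) u) = A_f(u) + exp(-i n lam/2) u D_f(u) and
F(exp(i lam/2) u) = A_f(u) + exp(i n lam/2) u D_f(u) ([weighted_minus],
[weighted_plus]).  Hence the inequality Im > 0 in the definition of the
classes says exactly |A_f(z)| < |z D_f(z)| ([im_pos_point]), and for lam = 0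
this is Re (z F'/F) > n/2, the location of the zeros ([zeros_in_weighted]).
Put u = 1/conj z and let f* be the n-inverse of f.  By the maximum principle
the inequality on |z| >= 1 becomes |A_f| < |A_f*| on the closed disc
([outer_dominated]).  On the other side, T_n(lam) consists of the
self-inversive f whose kernel has no zero in the closed disc ([classTP]).
So each class is described by zeros of kernels, and f satisfies
|A_f| < |A_f*| as soon as |f_0| < |f_n| and no kernel of a member f* + c f,
|c| = 1, of its pencil vanishes in the closed disc ([ray]).  For the closed
class there is an alternative: f is self-inversive, or |A_f| < |A_f*| holds
in the open disc ([open_alternative]).

The central fact is [product_zfree]: if f is self-inversive with kernel free
of zeros in the open disc and g lies in the pre-coefficient class of T_n(lam),
then the kernel of the coefficientwise product f g has no zero in the closed
disc.  Let z_j be the zeros of weighted n lam g and put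
zeta_j = exp(i lam/2) z_j.  Lagrange interpolation gives
A_g = c sum_j rho_j zeta_j G_j with all rho_j > 0 and
G_j = prod_(k <> j) (X - zeta_k) ([positive_decomposition]); the positivity
uses that the z_j are more than lam apart.  The Hadamard products
A_j = f * G_j satisfy K = u B_j - zeta_j A_j where K does not depend on j and
|B_j| <= |A_j| in the disc ([kernel_split], [inv_le]).  Therefore all the
numbers zeta_j A_j(u) lie in one open half plane, or on one ray when
K(u) = 0, and a positive combination of them cannot vanish.

This needs that f * G has no zero in the disc whenever G is the product
of n - 1 factors of a lam-spaced configuration of n points.  It is proved by
deforming F to X^n - w^n, where it is obvious, and looking at the last moment
at which a zero exists.  At such a contact, moving some of the points along
the circle shows that the contact does not depend on a whole block of points
([tangency], [contact_core]); hence the gaps can be closed one after another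
until the points are lam apart, where f * G is a rotation of A_f
([contact_extremal]).  So A_f has a zero on the circle, but then F has two
zeros exactly lam apart, against the strict spacing ([strict_nonvanish],
[strict_zfree_closed]).  A limit argument gives the closed case
([spaced_deleted_zfree]), and every self-inversive f whose kernel is free of
zeros in the open disc arises from such an F ([zeros_spaced]).  When the
configuration itself is strictly spaced, a contact forces f to be a geometric
progression of unimodular ratio ([strict_contact]): that is the pre-extremal
case.

For (i), apply [product_zfree] to the pencils of f and g, and average over
c = 1 and c = -1 ([product_open_dominated]); conversely, sum_k z^k is the unit
of the product and lies in the closed class.  For (ii), the kernel at mu is
f * G for a configuration with gaps mu > lam ([wider_zfree]).  For (iii), at
mu = 2 pi/n all C_k^(m)(mu) are 1, so A_f = f - f_n X^n and
X D_f = f - f_0, and |A_f| < |z D_f| is the half-plane condition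
([extreme_criterion]); it is inherited from any lam < mu by the argument of
(ii) ([dominated_extreme]) and passes to some lam < mu by compactness
([dominated_near]). *)
(** * Squared moduli and points of the unit circle *)

Section Basics.
Variable R : realType.
Local Notation C := R[i].
Local Notation Re := (@complex.Re R).
Local Notation Im := (@complex.Im R).
Implicit Types (z w u : C) (t : R).

(** The squared modulus as an element of R; the norm of R[i] takes its
values in R[i], which makes it awkward in real inequalities. *)
Definition nsq z : R := Re z ^+ 2 + Im z ^+ 2.

Lemma Re_conjc z : Re z^* = Re z. Proof. by case: z. Qed.
Lemma Im_conjc z : Im z^* = - Im z. Proof. by case: z. Qed.
Lemma Re_add z w : Re (z + w) = Re z + Re w. Proof. by case: z; case: w. Qed.
Lemma Im_add z w : Im (z + w) = Im z + Im w. Proof. by case: z; case: w. Qed.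
Lemma Re_opp z : Re (- z) = - Re z. Proof. by case: z. Qed.
Lemma Im_opp z : Im (- z) = - Im z. Proof. by case: z. Qed.
Lemma Re_mul z w : Re (z * w) = Re z * Re w - Im z * Im w.
Proof. by case: z; case: w. Qed.
Lemma Im_mul z w : Im (z * w) = Re z * Im w + Im z * Re w.
Proof. by case: z; case: w. Qed.
Lemma Re_real t : Re (t%:C)%C = t. Proof. by []. Qed.
Lemma Im_real t : Im (t%:C)%C = 0. Proof. by []. Qed.
Lemma Re_sum I (r : seq I) (P : pred I) (F : I -> C) :
  Re (\sum_(i <- r | P i) F i) = \sum_(i <- r | P i) Re (F i).
Proof. by apply: (big_morph Re Re_add). Qed.
Lemma Im_sum I (r : seq I) (P : pred I) (F : I -> C) :
  Im (\sum_(i <- r | P i) F i) = \sum_(i <- r | P i) Im (F i).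
Proof. by apply: (big_morph Im Im_add). Qed.

Lemma complex_eq z w : Re z = Re w -> Im z = Im w -> z = w.
Proof. by case: z => a b; case: w => c d /= -> ->. Qed.

Lemma sqr_normE z : `|z| ^+ 2 = (nsq z)%:C%C.
Proof. by rewrite add_Re2_Im2. Qed.

Lemma mul_conjE z : z * z^* = (nsq z)%:C%C.
Proof. by rewrite -normCK sqr_normE. Qed.

Lemma nsq_ge0 z : 0 <= nsq z.
Proof. by rewrite addr_ge0 ?sqr_ge0. Qed.

Lemma nsqM z w : nsq (z * w) = nsq z * nsq w.
Proof. case: z => a b; case: w => c d; rewrite /nsq /=; ring. Qed.

Lemma nsq_conj z : nsq z^* = nsq z.
Proof. by rewrite /nsq Re_conjc Im_conjc sqrrN. Qed.

Lemma nsqN z : nsq (- z) = nsq z.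
Proof. by rewrite /nsq Re_opp Im_opp !sqrrN. Qed.

Lemma nsq0 : nsq 0 = 0. Proof. by rewrite /nsq /= expr0n addr0. Qed.
Lemma nsq1 : nsq 1 = 1. Proof. by rewrite /nsq /= expr0n addr0 expr1n. Qed.

Lemma nsqX z k : nsq (z ^+ k) = nsq z ^+ k.
Proof. by elim: k => [|k IH]; rewrite ?nsq1 // !exprS nsqM IH. Qed.

Lemma nsq_real t : nsq (t%:C)%C = t ^+ 2.
Proof. by rewrite /nsq /= expr0n addr0. Qed.

Lemma nsq_eq0 z : (nsq z == 0) = (z == 0).
Proof.
by case: z => a b; rewrite /nsq paddr_eq0 ?sqr_ge0 // !sqrf_eq0 eq_complex.
Qed.

Lemma nsq_gt0 z : (0 < nsq z) = (z != 0).
Proof. by rewrite lt_def nsq_ge0 andbT nsq_eq0. Qed.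

Lemma nsqV z : nsq z^-1 = (nsq z)^-1.
Proof.
have [->|z0] := eqVneq z 0; first by rewrite invr0 nsq0 invr0.
have nz : nsq z != 0 by rewrite nsq_eq0.
by apply: (mulfI nz); rewrite -nsqM !divff ?nsq1.
Qed.

Lemma ler_nsq z w : (`|z| <= `|w|) = (nsq z <= nsq w).
Proof. by rewrite -ler_sqr ?nnegrE // !sqr_normE lecR. Qed.

Lemma ltr_nsq z w : (`|z| < `|w|) = (nsq z < nsq w).
Proof. by rewrite -ltr_sqr ?nnegrE // !sqr_normE ltcR. Qed.

Lemma eqr_nsq z w : (`|z| == `|w|) = (nsq z == nsq w).
Proof. by rewrite !eq_le !ler_nsq. Qed.

Lemma norm1_nsq z : (`|z| == 1) = (nsq z == 1).
Proof. by rewrite -[X in _ == X]normr1 eqr_nsq nsq1. Qed.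

Lemma norm_le1 z : (`|z| <= 1) = (nsq z <= 1).
Proof. by rewrite -[X in _ <= X]normr1 ler_nsq nsq1. Qed.

Lemma norm_lt1 z : (`|z| < 1) = (nsq z < 1).
Proof. by rewrite -[X in _ < X]normr1 ltr_nsq nsq1. Qed.

Lemma norm_ge1 z : (1 <= `|z|) = (1 <= nsq z).
Proof. by rewrite -[X in X <= _]normr1 ler_nsq nsq1. Qed.

Lemma norm_gt1 z : (1 < `|z|) = (1 < nsq z).
Proof. by rewrite -[X in X < _]normr1 ltr_nsq nsq1. Qed.

Lemma nsqD z w : nsq (z + w) = nsq z + nsq w + 2 * Re (z * w^*).
Proof. case: z => a b; case: w => c d; rewrite /nsq /=; ring. Qed.

Lemma Re_mulC z w : Re (z * w^*) = Re (w * z^*).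
Proof. case: z => a b; case: w => c d /=; ring. Qed.

Lemma unit_neq0 z : `|z| = 1 -> z != 0.
Proof. by move=> z1; rewrite -normr_gt0 z1. Qed.

Lemma expiD t s : expi (t + s) = expi t * expi s :> C.
Proof. by apply: complex_eq; rewrite /= ?cosD ?sinD // addrC. Qed.

Lemma expi0 : expi 0 = 1 :> C.
Proof. by apply: complex_eq; rewrite /= ?cos0 ?sin0. Qed.

Lemma nsq_expi t : nsq (expi t) = 1.
Proof. by rewrite /nsq /= cos2Dsin2. Qed.

Lemma norm_expi t : `|expi t| = 1 :> C.
Proof. by apply/eqP; rewrite norm1_nsq nsq_expi. Qed.

Lemma expi_neq0 t : expi t != 0 :> C.
Proof. exact/unit_neq0/norm_expi. Qed.

Lemma conj_expi t : (expi t)^* = expi (- t) :> C.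
Proof. by apply: complex_eq; rewrite /= ?cosN ?sinN. Qed.

Lemma expiNl t : expi (- t) * expi t = 1 :> C.
Proof. by rewrite -expiD addNr expi0. Qed.

Lemma expiNr t : expi t * expi (- t) = 1 :> C.
Proof. by rewrite -expiD addrN expi0. Qed.

Lemma expiX t k : expi t ^+ k = expi (k%:R * t) :> C.
Proof.
elim: k => [|k IH]; first by rewrite mul0r expi0.
by rewrite exprS IH -expiD -natr1 mulrDl mul1r addrC.
Qed.

Lemma expi2pi : expi (2 * pi) = 1 :> C.
Proof.
have -> : 2 * pi = (pi *+ 2 : R) by rewrite mulr2n; ring.
by apply: complex_eq; rewrite /= ?cos2pi ?sin2pi.
Qed.

Lemma expi_prod I (r : seq I) (P : pred I) (F : I -> R) :
  \prod_(i <- r | P i) expi (F i) = expi (\sum_(i <- r | P i) F i) :> C.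
Proof. by rewrite (big_morph _ expiD expi0). Qed.

Lemma expi_surj z : `|z| = 1 -> exists2 t, 0 <= t < 2 * pi & z = expi t.
Proof.
move=> /eqP; rewrite norm1_nsq => /eqP z1.
have [x0|x0] := lerP 0 (Im z).
  have zb : -1 <= Re z <= 1.
    by rewrite -ler_norml -(@ler_pXn2r _ 2) ?nnegrE // expr1n real_normK ?num_real //;
       move: z1; rewrite /nsq => <-; rewrite lerDl sqr_ge0.
  exists (acos (Re z)).
    by rewrite acos_ge0 //= (le_lt_trans (acos_lepi zb)) //; have := pi_gt0 R; lra.
  apply: complex_eq; rewrite /= ?acosK ?in_itv // sin_acos //.
  by move: z1; rewrite /nsq => <-; rewrite addrAC subrr add0r sqrtr_sqr ger0_norm.
have zb : -1 <= Re z <= 1.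
  by rewrite -ler_norml -(@ler_pXn2r _ 2) ?nnegrE // expr1n real_normK ?num_real //;
     move: z1; rewrite /nsq => <-; rewrite lerDl sqr_ge0.
have zb' : -1 <= Re z < 1.
  have /andP[-> /= r1] := zb; rewrite lt_neqAle r1 andbT.
  apply/eqP => e; move: z1; rewrite /nsq e expr1n => /eqP.
  by rewrite -subr_eq0 addrAC subrr add0r sqrf_eq0 lt_eqF.
exists (2 * pi - acos (Re z)).
  have := acos_gt0 zb'; have := acos_lepi zb; have := pi_gt0 R.
  by move=> *; apply/andP; split; lra.
rewrite expiD expi2pi mul1r -conj_expi.
apply: complex_eq; rewrite /= ?acosK ?in_itv // sin_acos //.
by move: z1; rewrite /nsq => <-; rewrite addrAC subrr add0r sqrtr_sqr ltr0_norm // opprK.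
Qed.

End Basics.
(** * Continuous families of complex numbers and polynomials *)

Section Continuity.
Variable R : realType.
Local Notation C := R[i].
Local Notation Re := (@complex.Re R).
Local Notation Im := (@complex.Im R).

(** Continuity is asked of the two coordinates, so that the calculus of
real-valued continuous functions applies directly. *)
Definition ccont (T : topologicalType) (f : T -> C) :=
  continuous (fun t => Re (f t)) /\ continuous (fun t => Im (f t)).

Section ContinuousFunctions.
Variable T : topologicalType.
Implicit Types (f g : T -> C) (p q : T -> {poly C}).

Lemma ccont_ext f g : f =1 g -> ccont f -> ccont g.
Proof. by move=> /funext ->. Qed.

Lemma ccont_cst (c : C) : ccont (fun _ : T => c).
Proof. by split => x; exact: cvg_cst. Qed.

Lemma cont_ext (U : topologicalType) (f g : T -> U) :
  f =1 g -> continuous f -> continuous g.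
Proof. by move=> /funext ->. Qed.

Lemma ccontD f g : ccont f -> ccont g -> ccont (fun t => f t + g t).
Proof.
move=> [f1 f2] [g1 g2]; split.
- apply: (@cont_ext _ (fun t => Re (f t) + Re (g t))) => [t|x]; first by rewrite Re_add.
  by apply: cvgD; [exact: f1|exact: g1].
- apply: (@cont_ext _ (fun t => Im (f t) + Im (g t))) => [t|x]; first by rewrite Im_add.
  by apply: cvgD; [exact: f2|exact: g2].
Qed.

Lemma ccontN f : ccont f -> ccont (fun t => - f t).
Proof.
move=> [f1 f2]; split.
- apply: (@cont_ext _ (fun t => - Re (f t))) => [t|x]; first by rewrite Re_opp.
  by apply: cvgN; exact: f1.
- apply: (@cont_ext _ (fun t => - Im (f t))) => [t|x]; first by rewrite Im_opp.
  by apply: cvgN; exact: f2.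
Qed.

Lemma ccontM f g : ccont f -> ccont g -> ccont (fun t => f t * g t).
Proof.
move=> [f1 f2] [g1 g2]; split.
- apply: (@cont_ext _ (fun t => Re (f t) * Re (g t) - Im (f t) * Im (g t))) => [t|x].
    by rewrite Re_mul.
  by apply: cvgB; apply: cvgM; [exact: f1|exact: g1|exact: f2|exact: g2].
- apply: (@cont_ext _ (fun t => Re (f t) * Im (g t) + Im (f t) * Re (g t))) => [t|x].
    by rewrite Im_mul.
  by apply: cvgD; apply: cvgM; [exact: f1|exact: g2|exact: f2|exact: g1].
Qed.

Lemma ccontB f g : ccont f -> ccont g -> ccont (fun t => f t - g t).
Proof. by move=> cf cg; apply: ccontD cf (ccontN cg). Qed.

Lemma ccont_conj f : ccont f -> ccont (fun t => (f t)^*).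
Proof.
move=> [f1 f2]; split.
- by apply: (@cont_ext _ (fun t => Re (f t))) => [t|//]; rewrite Re_conjc.
- apply: (@cont_ext _ (fun t => - Im (f t))) => [t|x]; first by rewrite Im_conjc.
  by apply: cvgN; exact: f2.
Qed.

Lemma ccontX f k : ccont f -> ccont (fun t => f t ^+ k).
Proof.
move=> cf; elim: k => [|k IH]; first exact: ccont_cst.
by apply: ccont_ext (ccontM cf IH) => t; rewrite exprS.
Qed.

Lemma ccont_sum I (r : seq I) (P : pred I) (F : I -> T -> C) :
  (forall i, P i -> ccont (F i)) -> ccont (fun t => \sum_(i <- r | P i) F i t).
Proof.
move=> cF; elim: r => [|i r IH].
  by apply: ccont_ext (ccont_cst 0) => t; rewrite big_nil.
have [Pi|Pi] := boolP (P i).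
  by apply: ccont_ext (ccontD (cF i Pi) IH) => t; rewrite big_cons Pi.
by apply: ccont_ext IH => t; rewrite big_cons (negbTE Pi).
Qed.

Lemma ccont_real (f : T -> R) : continuous f -> ccont (fun t => (f t)%:C%C).
Proof. by move=> cf; split => x /=; [exact: cf|exact: cvg_cst]. Qed.

Lemma ccont_expi (f : T -> R) : continuous f -> ccont (fun t => expi (f t)).
Proof.
move=> cf; split => x /=; apply: (@continuous_comp _ _ _ f); try exact: cf.
- exact: continuous_cos.
- exact: continuous_sin.
Qed.

Lemma continuous_nsq f : ccont f -> continuous (fun t => nsq (f t)).
Proof.
move=> [f1 f2] x; rewrite /nsq.
by apply: cvgD; [apply: (cvgM (f1 x) (f1 x))|apply: (cvgM (f2 x) (f2 x))].
Qed.

Lemma continuous_Re f : ccont f -> continuous (fun t => Re (f t)).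
Proof. by case. Qed.

Lemma ccontV f : (forall t, f t != 0) -> ccont f -> ccont (fun t => (f t)^-1).
Proof.
move=> f0 cf.
have E t : (f t)^-1 = (((nsq (f t))^-1)%:C)%C * (f t)^*.
  apply: (mulfI (f0 t)); rewrite divff // mulrCA mul_conjE.
  rewrite -rmorphM mulVf ?nsq_eq0 //.
apply: ccont_ext (ccontM (ccont_real _) (ccont_conj cf)) => [t|]; first by rewrite E.
move=> x; apply: cvgV; first by rewrite nsq_eq0.
exact: continuous_nsq.
Qed.

(** Coefficientwise continuity; together with a uniform bound on the
sizes it gives joint continuity of evaluation ([ccont_horner]). *)
Definition pcont (p : T -> {poly C}) := forall k, ccont (fun t => (p t)`_k).

Lemma pcont_cst (p : {poly C}) : pcont (fun _ => p).
Proof. by move=> k; exact: ccont_cst. Qed.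

Lemma pcont_ext p q : p =1 q -> pcont p -> pcont q.
Proof. by move=> /funext ->. Qed.

Lemma pcontD p q : pcont p -> pcont q -> pcont (fun t => p t + q t).
Proof.
by move=> cp cq k; apply: ccont_ext (ccontD (cp k) (cq k)) => t; rewrite coefD.
Qed.

Lemma pcontN p : pcont p -> pcont (fun t => - p t).
Proof. by move=> cp k; apply: ccont_ext (ccontN (cp k)) => t; rewrite coefN. Qed.

Lemma pcontM p q : pcont p -> pcont q -> pcont (fun t => p t * q t).
Proof.
move=> cp cq k.
apply: (@ccont_ext (fun t => \sum_(i < k.+1) (p t)`_i * (q t)`_(k - i))).
  by move=> t; rewrite coefM.
by apply: ccont_sum => i _; apply: ccontM.
Qed.

Lemma pcontZ f p : ccont f -> pcont p -> pcont (fun t => f t *: p t).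
Proof.
by move=> cf cp k; apply: ccont_ext (ccontM cf (cp k)) => t; rewrite coefZ.
Qed.

Lemma pcontC f : ccont f -> pcont (fun t => (f t)%:P).
Proof.
move=> cf k; case: k => [|k].
  by apply: ccont_ext cf => t; rewrite coefC.
by apply: ccont_ext (ccont_cst 0) => t; rewrite coefC.
Qed.

Lemma pcont_XsubC f : ccont f -> pcont (fun t => 'X - (f t)%:P).
Proof. by move=> cf; apply: pcontD (pcont_cst _) (pcontN (pcontC cf)). Qed.

Lemma pcont_prod I (r : seq I) (P : pred I) (F : I -> T -> {poly C}) :
  (forall i, P i -> pcont (F i)) -> pcont (fun t => \prod_(i <- r | P i) F i t).
Proof.
move=> cF; elim: r => [|i r IH].
  by apply: pcont_ext (pcont_cst 1) => t; rewrite big_nil.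
have [Pi|Pi] := boolP (P i).
  by apply: pcont_ext (pcontM (cF i Pi) IH) => t; rewrite big_cons Pi.
by apply: pcont_ext IH => t; rewrite big_cons (negbTE Pi).
Qed.

Lemma pcont_deriv p : pcont p -> pcont (fun t => (p t)^`()).
Proof.
move=> cp k; apply: (@ccont_ext (fun t => (p t)`_k.+1 *+ k.+1)).
  by move=> t; rewrite coef_deriv.
apply: (@ccont_ext (fun t => k.+1%:R * (p t)`_k.+1)).
  by move=> t; rewrite mulr_natl.
exact: ccontM (ccont_cst _) _.
Qed.

Lemma ccont_horner p f m : (forall t, (size (p t) <= m)%N) -> pcont p -> ccont f ->
  ccont (fun t => (p t).[f t]).
Proof.
move=> sp cp cf.
apply: (@ccont_ext (fun t => \sum_(i < m) (p t)`_i * f t ^+ i)).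
  by move=> t; rewrite (horner_coef_wide _ (sp t)).
by apply: ccont_sum => i _; apply: ccontM => //; exact: ccontX.
Qed.

End ContinuousFunctions.

Lemma ccont_comp (T U : topologicalType) (f : U -> C) (g : T -> U) :
  continuous g -> ccont f -> ccont (fun t => f (g t)).
Proof.
move=> cg [f1 f2]; split => x.
- exact: (@continuous_comp _ _ _ g (fun y => Re (f y)) x (cg x) (f1 (g x))).
- exact: (@continuous_comp _ _ _ g (fun y => Im (f y)) x (cg x) (f2 (g x))).
Qed.

Lemma ge0_lim (g : R -> R) (a s0 : R) : 0 < s0 -> continuous g ->
  (forall s, a < s -> s <= a + s0 -> 0 <= g s) -> 0 <= g a.
Proof.
move=> s0_gt0 cg gs; rewrite leNgt; apply/negP => ga.
have /cvgrPdist_lt /(_ (- g a)) := cg a.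
rewrite oppr_gt0 => /(_ ga) /nbhs_ballP [e /= e0 H].
pose d := Num.min (e / 2) s0.
have d0 : 0 < d by rewrite lt_min s0_gt0 divr_gt0.
have /H /= : ball a e (a + d).
  rewrite /ball /= opprD addNKr normrN gtr0_norm // gt_min.
  by rewrite ltr_pdivrMr // mulr2n mulrDr mulr1 ltrDl e0.
have : 0 <= g (a + d).
  by apply: gs; rewrite ?ltrDl // lerD2l ge_min lexx orbT.
move=> gd; rewrite ltr0_norm; first lra.
by rewrite subr_lt0 (lt_le_trans ga).
Qed.

Lemma le_lim (f g : R -> R) (a s0 : R) : 0 < s0 -> continuous f -> continuous g ->
  (forall s, a < s -> s <= a + s0 -> f s <= g s) -> f a <= g a.
Proof.
move=> s0_gt0 cf cg H; rewrite -subr_ge0.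
apply: (@ge0_lim (fun s => g s - f s) a s0) => //.
  by move=> x; apply: cvgB; [exact: cg|exact: cf].
by move=> s s1 s2; rewrite subr_ge0; exact: H.
Qed.

(** The intermediate value theorem, in the form used along rays and
homotopies. *)
Lemma pos_no_zero (g : R -> R) : continuous g -> 0 < g 0 ->
  (forall t, 0 <= t <= 1 -> g t != 0) -> 0 < g 1.
Proof.
move=> cg g0 gn; rewrite ltNge; apply/negP => g1.
have [|||t] := @IVT R g 0 1 0.
- exact: ler01.
- exact: continuous_subspaceT.
- by rewrite ge_min le_max g1 orbT (ltW g0).
by rewrite in_itv /= => /gn/negP h /eqP.
Qed.

End Continuity.

(** * Polynomials without zeros in the disc *)

Section ZeroFreePolynomials.
Variable R : realType.
Local Notation C := R[i].
Local Notation Re := (@complex.Re R).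
Local Notation Im := (@complex.Im R).
Implicit Types (P Q p q : {poly C}) (u v z : C).

Definition zfree_open P := forall u, nsq u < 1 -> P.[u] != 0.
Definition zfree_closed P := forall u, nsq u <= 1 -> P.[u] != 0.

(** The modulus as an element of R. *)
Definition md z : R := Num.sqrt (nsq z).

Lemma md_norm z : `|z| = (md z)%:C%C.
Proof. by rewrite normc_def. Qed.
Lemma md_ge0 z : 0 <= md z. Proof. exact: sqrtr_ge0. Qed.
Lemma md_sq z : md z ^+ 2 = nsq z. Proof. by rewrite sqr_sqrtr ?nsq_ge0. Qed.
Lemma mdM z w : md (z * w) = md z * md w.
Proof. by rewrite /md nsqM sqrtrM ?nsq_ge0. Qed.
Lemma md_addl z w : md (z + w) <= md z + md w.
Proof. by rewrite -lecR rmorphD /= -!md_norm ler_normD. Qed.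
Lemma md_subr z w : md z - md w <= md (z - w).
Proof. by rewrite lerBlDr -[X in md X <= _](subrK w) md_addl. Qed.
Lemma md_sub z w : md (z - w) <= md z + md w.
Proof. by rewrite -lecR rmorphD /= -!md_norm ler_normB. Qed.
Lemma md_le1 z : (md z <= 1) = (nsq z <= 1).
Proof. by rewrite -norm_le1 md_norm -lecR. Qed.
Lemma md_lt1 z : (md z < 1) = (nsq z < 1).
Proof. by rewrite -norm_lt1 md_norm -ltcR. Qed.

Lemma Re_realM (t : R) z : Re ((t%:C)%C * z) = t * Re z.
Proof. by rewrite Re_mul Re_real Im_real mul0r subr0. Qed.

Lemma poly_factor P : exists r : seq C, P = lead_coef P *: \prod_(z <- r) ('X - z%:P).
Proof. by have [r ->] := closed_field_poly_normal P; exists r; rewrite {1}lead_coefZ (monicP (monic_prod_XsubC _ _ _)) mulr1. Qed.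

Lemma size_factor P (r : seq C) : P != 0 ->
  P = lead_coef P *: \prod_(z <- r) ('X - z%:P) -> size P = (size r).+1.
Proof. by move=> P0 ->; rewrite size_scale ?size_prod_XsubC // lead_coef_eq0. Qed.

Lemma zfree_factor P (r : seq C) : P != 0 -> zfree_open P ->
  P = lead_coef P *: \prod_(z <- r) ('X - z%:P) -> forall z, z \in r -> 1 <= nsq z.
Proof.
move=> P0 zf E z zr; rewrite leNgt; apply/negP => /zf/negP; apply.
by rewrite E hornerZ mulf_eq0 -[X in _ || X]rootE root_prod_XsubC zr orbT.
Qed.

(** A quantitative form of Hurwitz's theorem: each factor satisfies
|u - z| >= |z| - |u| >= (|v| + |z|) (1 - |u|)/2 when |z| >= 1 >= |v|.  The
constant does not depend on P, so the inequality survives limits. *)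
Lemma zfree_lower P m u v : (size P <= m.+1)%N -> zfree_open P ->
  nsq u < 1 -> nsq v <= 1 ->
  md P.[v] * ((1 - md u) / 2) ^+ m <= md P.[u].
Proof.
move=> sP zf u1 v1.
have [->|P0] := eqVneq P 0.
  by rewrite !horner0 /md nsq0 sqrtr0 mul0r.
have [r E] := poly_factor P.
have rz := zfree_factor P0 zf E.
have sr : (size r <= m)%N by rewrite -ltnS -(size_factor P0 E).
have mu : md u < 1 by rewrite md_lt1.
have mv : md v <= 1 by rewrite md_le1.
have k0 : 0 <= (1 - md u) / 2 by rewrite divr_ge0 // subr_ge0 ltW.
have k1 : (1 - md u) / 2 <= 1.
  by rewrite ler_pdivrMr // mul1r lerBlDl -lerBlDr; have := md_ge0 u; lra.
have [k kE] : exists k, k = (1 - md u) / 2 by eexists.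
rewrite -kE in k0 k1 *.
apply: (@le_trans _ _ (md P.[v] * k ^+ size r)).
  by rewrite ler_wpM2l ?md_ge0 // ler_wiXn2l.
rewrite E !hornerZ !mdM -mulrA ler_wpM2l ?md_ge0 //.
elim: r rz {E sr} => [|z r IH] rz /=; first by rewrite !big_nil !hornerC expr0 mulr1.
rewrite !big_cons !hornerM !mdM exprS mulrACA ler_pM ?mulr_ge0 ?md_ge0 ?exprn_ge0 //.
  rewrite !hornerXsubC.
  have z1 : 1 <= md z.
    by rewrite leNgt md_lt1 -leNgt rz // mem_head.
  apply: (@le_trans _ _ ((md v + md z) * k)); first by rewrite ler_wpM2r // md_sub.
  apply: (@le_trans _ _ (md z - md u)); last first.
    have := md_subr z u; rewrite (_ : md (u - z) = md (z - u)) //.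
    by rewrite /md -nsqN opprB.
  by rewrite kE; have := md_ge0 u; nra.
by apply: IH => y yr; apply: rz; rewrite in_cons yr orbT.
Qed.

Lemma nsq_zfree_lower P m u v : (size P <= m.+1)%N -> zfree_open P ->
  nsq u < 1 -> nsq v <= 1 ->
  nsq P.[v] * (((1 - md u) / 2) ^+ m) ^+ 2 <= nsq P.[u].
Proof.
move=> sP zf u1 v1; rewrite -!md_sq -exprMn ler_pXn2r ?nnegrE ?md_ge0 //.
  exact: zfree_lower.
rewrite mulr_ge0 ?md_ge0 // exprn_ge0 // divr_ge0 // subr_ge0 ltW //.
by rewrite md_lt1.
Qed.

Lemma hurwitz_lower (P : R -> {poly C}) m a s0 u v :
  0 < s0 -> (forall s, size (P s) <= m.+1)%N -> pcont P ->
  (forall s, a < s -> s <= a + s0 -> zfree_open (P s)) ->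
  nsq u < 1 -> nsq v <= 1 ->
  nsq (P a).[v] * (((1 - md u) / 2) ^+ m) ^+ 2 <= nsq (P a).[u].
Proof.
move=> s0_gt0 sP cP zf u1 v1.
have cu w : ccont (fun s => (P s).[w]).
  by apply: (@ccont_horner _ _ _ _ m.+1) => //; exact: ccont_cst.
apply: (@le_lim _ (fun s => nsq (P s).[v] * (((1 - md u) / 2) ^+ m) ^+ 2)
   (fun s => nsq (P s).[u]) a s0) => //.
- by move=> x; apply: cvgM; [exact: (continuous_nsq (cu v))|exact: cvg_cst].
- exact: continuous_nsq.
- by move=> s s1 s2; apply: nsq_zfree_lower => //; exact: zf.
Qed.

Lemma hurwitz (P : R -> {poly C}) m a s0 :
  0 < s0 -> (forall s, size (P s) <= m.+1)%N -> pcont P ->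
  (forall s, a < s -> s <= a + s0 -> zfree_open (P s)) ->
  (P a).[0] != 0 -> zfree_open (P a).
Proof.
move=> s0_gt0 sP cP zf P0 u u1; rewrite -nsq_gt0.
have n0 : nsq (0 : C) <= 1 by rewrite nsq0.
apply: lt_le_trans (hurwitz_lower s0_gt0 sP cP zf u1 n0).
rewrite mulr_gt0 ?nsq_gt0 // !exprn_gt0 // divr_gt0 // subr_gt0 md_lt1 //.
Qed.

(** In the limit of polynomials without zeros in the open disc, one
zero there forces the limit to vanish on the whole closed disc. *)
Lemma hurwitz_eq0 (P : R -> {poly C}) m a s0 u v :
  0 < s0 -> (forall s, size (P s) <= m.+1)%N -> pcont P ->
  (forall s, a < s -> s <= a + s0 -> zfree_open (P s)) ->
  nsq u < 1 -> (P a).[u] = 0 -> nsq v <= 1 -> (P a).[v] = 0.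
Proof.
move=> s0_gt0 sP cP zf u1 Pu v1; apply/eqP; rewrite -nsq_eq0 eq_le nsq_ge0 andbT.
have K0 : 0 < (((1 - md u) / 2) ^+ m) ^+ 2.
  by rewrite !exprn_gt0 // divr_gt0 // subr_gt0 md_lt1.
by have := hurwitz_lower s0_gt0 sP cP zf u1 v1; rewrite Pu nsq0 pmulr_lle0.
Qed.

(** For a zero z with |z| >= 1 the value Re (1/(1 - z)) is at most
1/2; summing over the zeros bounds the logarithmic derivative at 1. *)
Lemma logderiv_bound P m : (size P <= m.+1)%N -> zfree_open P ->
  2 * Re (P^`().[1] * (P.[1])^*) <= m%:R * nsq P.[1].
Proof.
move=> sP zf.
have [->|P0] := eqVneq P 0.
  by rewrite deriv0 !horner0 mul0r /= nsq0 !mulr0.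
have [r E] := poly_factor P.
have rz := zfree_factor P0 zf E.
have sr : (size r <= m)%N by rewrite -ltnS -(size_factor P0 E).
apply: (@le_trans _ _ ((size r)%:R * nsq P.[1])); last first.
  by rewrite ler_wpM2r ?nsq_ge0 // ler_nat.
have -> : P^`().[1] = lead_coef P * (\prod_(z <- r) ('X - z%:P))^`().[1].
  by rewrite {1}E derivZ hornerZ.
have -> : P.[1] = lead_coef P * (\prod_(z <- r) ('X - z%:P)).[1].
  by rewrite {1}E hornerZ.
set c := lead_coef P.
have H : 2 * Re ((\prod_(z <- r) ('X - z%:P))^`().[1] * ((\prod_(z <- r) ('X - z%:P)).[1])^*)
   <= (size r)%:R * nsq (\prod_(z <- r) ('X - z%:P)).[1].
  elim: r rz {E sr} => [|z r IH] rz /=.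
    by rewrite !big_nil derivC hornerC mul0r /= mulr0 mul0r.
  have {}IH := IH (fun y yr => rz y (@mem_behead _ (z :: r) y yr)).
  rewrite !big_cons derivM derivXsubC mul1r hornerD !hornerM hornerXsubC.
  set A := (\prod_(z <- r) ('X - z%:P))^`().[1] in IH *.
  set B := (\prod_(z <- r) ('X - z%:P)).[1] in IH *.
  have z1 := rz z (mem_head _ _).
  have -> : (B + (1 - z) * A) * ((1 - z) * B)^* =
      (B * B^*) * (1 - z)^* + ((1 - z) * (1 - z)^*) * (A * B^*).
    by rewrite rmorphM /=; ring.
  rewrite !mul_conjE nsqM Re_add [Re (_%:C%C * (1 - z)^*)]Re_realM [Re (_%:C%C * (A * _))]Re_realM Re_conjc -addn1 natrD.
  have : 2 * Re (1 - z) <= nsq (1 - z).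
    rewrite /nsq Re_add Im_add Re_opp Im_opp /=.
    by move: z1; rewrite /nsq; nra.
  move=> /(ler_wpM2l (nsq_ge0 B)) h1.
  move: IH => /(ler_wpM2l (nsq_ge0 (1 - z))) h2.
  by lra.
have -> : c * (\prod_(z <- r) ('X - z%:P))^`().[1] * (c * (\prod_(z <- r) ('X - z%:P)).[1])^*
  = (c * c^*) * ((\prod_(z <- r) ('X - z%:P))^`().[1] * ((\prod_(z <- r) ('X - z%:P)).[1])^*).
  by rewrite rmorphM /=; ring.
rewrite mul_conjE nsqM Re_realM.
by move: H => /(ler_wpM2l (nsq_ge0 c)); lra.
Qed.

Lemma disc_polar u : nsq u <= 1 ->
  exists rho t : R, [/\ 0 <= rho <= 1, 0 <= t <= 2 * pi & u = (rho%:C)%C * expi t].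
Proof.
move=> u1; have [->|u0] := eqVneq u 0.
  exists 0, 0; have := pi_ge0 R; rewrite mul0r => p0.
  by split => //; apply/andP; split; lra.
have m0 : 0 < md u by rewrite /md sqrtr_gt0 nsq_gt0.
have mc : (md u)%:C%C != 0 :> C by rewrite -md_norm normr_eq0.
have /expi_surj[t /andP[t0 t1] E] : `|u / (md u)%:C%C| = 1.
  by rewrite normrM normfV -md_norm normr_id divff // normr_eq0.
exists (md u), t; rewrite md_ge0 md_le1 u1 t0 (ltW t1); split => //.
by rewrite -E mulrCA divff // mulr1.
Qed.

Lemma nsq_polar (rho t : R) : nsq ((rho%:C)%C * expi t) = rho ^+ 2.
Proof. by rewrite nsqM nsq_real nsq_expi mulr1. Qed.

Lemma box_compact k (a b : 'I_k -> R) :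
  compact [set v : 'rV[R]_k | forall i, a i <= v 0 i <= b i].
Proof.
have -> : [set v : 'rV[R]_k | forall i, a i <= v 0 i <= b i] =
   [set v : 'rV[R]_k | forall i, `[a i, b i]%classic (v ord0 i)].
  apply/seteqP; split => v /= H i; have := H i; rewrite in_itv //=.
by apply: (@rV_compact R k (fun i => `[a i, b i]%classic)) => i; exact: segment_compact.
Qed.

Lemma continuous_quot (T : topologicalType) (f g : T -> R) x :
  continuous f -> continuous g -> g x != 0 ->
  {for x, continuous (fun y => f y / g y)}.
Proof.
by move=> cf cg gx; apply: cvgM; [exact: cf|apply: cvgV; [exact: gx|exact: cg]].
Qed.

(** The quotient p/q attains its maximal modulus on the closed disc; the
inequality is cleared of denominators. *)
Lemma max_quot p q : zfree_closed q ->
  exists2 u0, nsq u0 <= 1 &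
   forall u, nsq u <= 1 -> nsq p.[u] * nsq q.[u0] <= nsq p.[u0] * nsq q.[u].
Proof.
move=> zf.
pose A := [set x : 'rV[R]_2 | forall i, 0 <= x 0 i <= (if i == ord0 then 1 else 2 * pi)].
pose pt (v : 'rV[R]_2) : C := ((v 0 0)%:C)%C * expi (v 0 1).
have cpt : ccont pt.
  by apply: ccontM; [apply: ccont_real|apply: ccont_expi]; exact: coord_continuous.
have c_nsq (r : {poly C}) : continuous (fun x => nsq r.[pt x]).
  apply: continuous_nsq.
  by apply: (@ccont_horner R _ (fun _ => r) pt (size r)) => //; exact: pcont_cst.
have ptA x : A x -> nsq (pt x) <= 1.
  move=> /(_ 0) /=; rewrite nsq_polar => /andP[h0 h1].
  by rewrite expr_le1.
have [||v vA vmax] := @EVT_max_rV R 2 (fun x => nsq p.[pt x] / nsq q.[pt x]) A _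
  (@box_compact 2 (fun=> 0) (fun i => if i == ord0 then 1 else 2 * pi)).
- exists (const_mx 0) => i /=; rewrite mxE lexx /=; case: ifP => // _.
  by rewrite mulr_ge0 // pi_ge0.
- apply: continuous_in_subspaceT => v; rewrite inE => vA.
  apply: (@continuous_quot _ (fun x => nsq p.[pt x]) (fun x => nsq q.[pt x]));
    [exact: c_nsq|exact: c_nsq|].
  by rewrite nsq_eq0; apply: zf; exact: ptA.
rewrite inE in vA.
exists (pt v); first exact: ptA.
move=> u u1; have [rho [t [r01 t01 E]]] := disc_polar u1.
pose w : 'rV[R]_2 := \row_i (if i == ord0 then rho else t).
have Ew : pt w = u by rewrite /pt !mxE /= -E.
have wA : w \in A.
  by rewrite inE => i /=; rewrite mxE; case: ifP.
have := vmax w wA; rewrite Ew.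
by rewrite ler_pdivrMr ?nsq_gt0 ?zf // mulrAC ler_pdivlMr ?nsq_gt0 ?zf // ptA.
Qed.

(** If |p/q| had its maximum, with value at least 1, at an interior
point and c = p/q there, then p - (1 + s) c q would have no zero in the open disc
for s > 0, and Hurwitz's theorem would give p = c q up to the circle. *)
Lemma max_principle p q : zfree_closed q ->
  (forall u, nsq u = 1 -> nsq p.[u] < nsq q.[u]) ->
  forall u, nsq u <= 1 -> nsq p.[u] < nsq q.[u].
Proof.
move=> zf pq u u1; rewrite ltNge; apply/negP => qp.
have [u0 u01 M] := max_quot p zf.
have q0 : 0 < nsq q.[u0] by rewrite nsq_gt0 zf.
have qu : 0 < nsq q.[u] by rewrite nsq_gt0 zf.
have p0 : nsq q.[u0] <= nsq p.[u0].
  rewrite -(ler_pM2l qu) (le_trans _ (le_trans (M _ u1) _)) //; last by rewrite mulrC.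
  by rewrite ler_wpM2r ?nsq_ge0.
have u0n : nsq u0 < 1.
  rewrite lt_neqAle u01 andbT; apply/eqP => /pq; lra.
pose c := p.[u0] / q.[u0].
pose P (s : R) := p - ((1 + s)%:C%C * c) *: q.
have cP : pcont P.
  apply: pcontD; first exact: pcont_cst.
  apply: pcontN; apply: pcontZ; last exact: pcont_cst.
  apply: ccontM; last exact: ccont_cst.
  apply: ccont_real => x; apply: cvgD; [exact: cvg_cst|exact: cvg_id].
have sP s : (size (P s) <= (maxn (size p) (size q)).+1)%N.
  rewrite (leq_trans (size_polyD _ _)) // size_polyN geq_max ltnW ?ltnS ?leq_maxl //=.
  by rewrite (leq_trans (size_scale_leq _ _)) // ltnW // ltnS leq_maxr.
have zP s : 0 < s -> s <= 0 + 1 -> zfree_open (P s).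
  move=> s0 _ v v1; apply/eqP => Pv.
  have qv : 0 < nsq q.[v] by rewrite nsq_gt0 zf // ltW.
  have : nsq p.[v] = (1 + s) ^+ 2 * (nsq c * nsq q.[v]).
    move: Pv; rewrite /P hornerD hornerN hornerZ => /eqP; rewrite subr_eq0 => /eqP ->.
    by rewrite (nsqM (_ * c)) (nsqM _ c) nsq_real mulrA.
  have h : nsq p.[v] <= nsq c * nsq q.[v].
    by rewrite nsqM nsqV mulrAC ler_pdivlMr // M // ltW.
  move=> e.
  have cc : 1 <= nsq c by rewrite nsqM nsqV ler_pdivlMr // mul1r.
  have k0 : 0 < nsq c * nsq q.[v] by rewrite mulr_gt0 // (lt_le_trans ltr01).
  move: h; rewrite e -[X in _ <= X]mul1r ler_pM2r //; nra.
have P0 : (P 0).[u0] = 0.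
  by rewrite /P hornerD hornerN hornerZ addr0 mul1r /c divfK ?subrr // -nsq_gt0 q0.
have n1 : nsq (1 : C) <= 1 by rewrite nsq1.
have := hurwitz_eq0 ltr01 sP cP zP u0n P0 n1.
rewrite /P hornerD hornerN hornerZ addr0 mul1r => /eqP; rewrite subr_eq0 => /eqP E.
have := pq 1 (nsq1 R); rewrite E nsqM -subr_gt0 -{1}[nsq q.[1]]mul1r -mulrBl => h.
have : 1 <= nsq c by rewrite nsqM nsqV ler_pdivlMr // mul1r.
by have := nsq_ge0 q.[1]; nra.
Qed.

End ZeroFreePolynomials.

(** * The q-binomial coefficients *)

Section QBinomials.
Variable R : realType.
Local Notation C := R[i].
Local Notation Re := (@complex.Re R).
Local Notation Im := (@complex.Im R).
Implicit Types (lam : R) (f g F G P : {poly C}) (u v w z : C).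

Lemma coef_comp_scale P (a : C) k : (P \Po (a *: 'X))`_k = a ^+ k * P`_k.
Proof.
rewrite comp_polyE coef_sum.
under eq_bigr do rewrite exprZn coefZ coefZ coefXn.
have [kP|kP] := ltnP k (size P).
  rewrite (bigD1 (Ordinal kP)) //= eqxx mulr1 big1 ?addr0 1?mulrC // => i ik.
  by rewrite eq_sym -(inj_eq val_inj) /= in ik *; rewrite (negbTE ik) mulr0 mulr0.
rewrite [P`_k]nth_default // mulr0 big1 // => i _.
by rewrite gtn_eqF ?mulr0 ?mulr0 // (leq_trans (ltn_ord i)).
Qed.

Lemma QpolyS_up m lam : Qpoly m.+1 lam =
  (Qpoly m lam \Po (expi (- (lam / 2)) *: 'X)) * (1 + expi (m%:R * lam / 2) *: 'X).
Proof.
rewrite /Qpoly big_ord_recr rmorph_prod /=; congr (_ * _); last first.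
  by congr (1 + expi _ *: 'X); rewrite -natr1; ring.
apply: eq_bigr => j _; rewrite rmorphD rmorph1 /= comp_polyZ comp_polyX scalerA -expiD.
by congr (1 + expi _ *: 'X); rewrite (_ : m.+1%:R = m%:R + 1) ?natr1 //; field.
Qed.

Lemma QpolyS_down m lam : Qpoly m.+1 lam =
  (Qpoly m lam \Po (expi (lam / 2) *: 'X)) * (1 + expi (- (m%:R * lam / 2)) *: 'X).
Proof.
rewrite /Qpoly big_ord_recl rmorph_prod /= mulrC; congr (_ * _); last first.
  by congr (1 + expi _ *: 'X); rewrite -natr1; field.
apply: eq_bigr => j _; rewrite rmorphD rmorph1 /= comp_polyZ comp_polyX scalerA -expiD.
congr (1 + expi _ *: 'X).
by rewrite /bump /= add1n -!natr1; field.
Qed.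

Lemma Qcoef0 m lam : Qcoef m lam 0 = 1.
Proof.
rewrite /Qcoef -horner_coef0 /Qpoly horner_prod big1 // => j _.
by rewrite hornerD hornerC hornerZ hornerX mulr0 addr0.
Qed.

Lemma Qcoef_up m lam k : Qcoef m.+1 lam k.+1 =
  expi (- (k.+1%:R * lam / 2)) * Qcoef m lam k.+1 +
  expi ((m%:R - k%:R) * lam / 2) * Qcoef m lam k.
Proof.
rewrite /Qcoef QpolyS_up mulrDr mulr1 coefD -scalerAr coefZ coefMX /=.
rewrite !coef_comp_scale !expiX [expi _ * (expi _ * _)]mulrA -expiD.
by congr (expi _ * _ + expi _ * _); field.
Qed.

Lemma Qcoef_down m lam k : Qcoef m.+1 lam k.+1 =
  expi (k.+1%:R * lam / 2) * Qcoef m lam k.+1 +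
  expi (- ((m%:R - k%:R) * lam / 2)) * Qcoef m lam k.
Proof.
rewrite /Qcoef QpolyS_down mulrDr mulr1 coefD -scalerAr coefZ coefMX /=.
rewrite !coef_comp_scale !expiX [expi _ * (expi _ * _)]mulrA -expiD.
by congr (expi _ * _ + expi _ * _); field.
Qed.

Lemma Qcoef_default m lam k : (m < k)%N -> Qcoef m lam k = 0.
Proof.
elim: m k => [|m IH] [|k] // mk.
  by rewrite /Qcoef /Qpoly big_ord0 coef1.
by rewrite Qcoef_up !IH ?mulr0 ?addr0 // ltnW.
Qed.

Lemma size_Qpoly_leq m lam : (size (Qpoly m lam) <= m.+1)%N.
Proof. by apply/leq_sizeP => k mk; exact: Qcoef_default. Qed.

Lemma Qcoef_last m lam : Qcoef m lam m = 1.
Proof.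
elim: m => [|m IH]; first exact: Qcoef0.
by rewrite Qcoef_up Qcoef_default // mulr0 add0r subrr mul0r mul0r expi0 mul1r.
Qed.

(** Dividing the two Pascal rules eliminates the coefficient of degree
m + 1 and gives the quotient of consecutive coefficients. *)
Lemma Qcoef_ratio m lam k :
  ((sin (k.+1%:R * lam / 2))%:C)%C * Qcoef m lam k.+1 =
  ((sin ((m%:R - k%:R) * lam / 2))%:C)%C * Qcoef m lam k.
Proof.
have := Qcoef_up m lam k; rewrite Qcoef_down.
set a := k.+1%:R * lam / 2; set b := (m%:R - k%:R) * lam / 2.
have E t : expi t = (cos t)%:C%C + 'i%C * (sin t)%:C%C :> C.
  by apply: complex_eq => /=; ring.
rewrite !E !cosN !sinN !rmorphN /= => H.
have i0 : 2 * 'i%C != 0 :> C.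
  by rewrite mulf_neq0 ?pnatr_eq0 // eq_complex /= oner_eq0 andbF.
apply: (mulfI i0); rewrite !mulrA.
move: (Qcoef m lam k.+1) (Qcoef m lam k) H => c' c /eqP.
rewrite -subr_eq0 => /eqP H; apply/eqP; rewrite -subr_eq0 -H; apply/eqP; ring.
Qed.

Lemma sin_half_gt0 lam (x : R) N : 0 < lam -> N * lam < 2 * pi -> 0 < x -> x <= N ->
  0 < sin (x * lam / 2).
Proof.
move=> l0 Nl x0 xN; apply: sin_gt0_pi.
rewrite divr_gt0 ?mulr_gt0 //=.
have : x * lam <= N * lam by rewrite ler_wpM2r // ltW.
lra.
Qed.

Lemma Qcoef_lam0 m k : Qcoef m (0 : R) k = 'C(m, k)%:R.
Proof.
elim: m k => [|m IH] [|k]; rewrite ?Qcoef0 ?bin0 //.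
  by rewrite Qcoef_default.
by rewrite Qcoef_up !IH !mulr0 !mul0r oppr0 expi0 !mul1r binS natrD.
Qed.

Lemma Qcoef_gt0 m lam k : 0 <= lam -> m%:R * lam < 2 * pi -> (k <= m)%N ->
  0 < Qcoef m lam k.
Proof.
rewrite le_eqVlt => /orP[/eqP <- _ km|l0 ml].
  by rewrite Qcoef_lam0 ltr0n bin_gt0.
elim: k => [|k IH] km; first by rewrite Qcoef0.
have s1 : 0 < (sin (k.+1%:R * lam / 2))%:C%C :> C.
  by rewrite ltcR (@sin_half_gt0 lam _ m%:R) // ?ltr0n // ler_nat.
have s2 : 0 < (sin ((m%:R - k%:R) * lam / 2))%:C%C :> C.
  rewrite ltcR (@sin_half_gt0 lam _ m%:R) // ?subr_gt0 ?ltr_nat //.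
  by rewrite gerBl.
by rewrite -(pmulr_rgt0 _ s1) Qcoef_ratio pmulr_rgt0 // IH // ltnW.
Qed.

Lemma Qcoef_neq0 m lam k : 0 <= lam -> m%:R * lam < 2 * pi -> (k <= m)%N ->
  Qcoef m lam k != 0.
Proof. by move=> l0 ml km; rewrite gt_eqF // Qcoef_gt0. Qed.

Lemma Qcoef_conj m lam k : 0 <= lam -> m%:R * lam < 2 * pi ->
  (Qcoef m lam k)^* = Qcoef m lam k.
Proof.
move=> l0 ml; have [km|km] := leqP k m.
  by rewrite conj_Creal // gtr0_real // Qcoef_gt0.
by rewrite Qcoef_default // rmorph0.
Qed.

Lemma Qcoef_sym m lam k : 0 <= lam -> m%:R * lam < 2 * pi -> (k <= m)%N ->
  Qcoef m lam (m - k) = Qcoef m lam k.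
Proof.
rewrite le_eqVlt => /orP[/eqP <- _ km|l0 ml].
  by rewrite !Qcoef_lam0 bin_sub.
elim: k => [|k IH] km; first by rewrite subn0 Qcoef0 Qcoef_last.
have s1 : (sin (k.+1%:R * lam / 2))%:C%C != 0 :> C.
  by rewrite gt_eqF // ltcR (@sin_half_gt0 lam _ m%:R) // ?ltr0n // ler_nat.
apply: (mulfI s1); rewrite Qcoef_ratio -IH; last exact: ltnW.
have := Qcoef_ratio m lam (m - k.+1); rewrite -subSn // subSS => H.
rewrite natrB // in H; last exact: ltnW.
rewrite H; congr ((sin _)%:C%C * _).
rewrite natrB // -natr1; ring.
Qed.

Lemma Qcoef_pascal m lam k : expi (- (k.+1%:R * lam / 2)) * Qcoef m.+1 lam k.+1 =
  Qcoef m lam k.+1 + expi (- (m.+1%:R * lam / 2)) * Qcoef m lam k.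
Proof.
rewrite Qcoef_down mulrDr !mulrA -!expiD addNr expi0 mul1r.
by congr (_ + expi _ * _); rewrite -!natr1; field.
Qed.

Lemma Qcoef_pascal' m lam k : expi (k.+1%:R * lam / 2) * Qcoef m.+1 lam k.+1 =
  Qcoef m lam k.+1 + expi (m.+1%:R * lam / 2) * Qcoef m lam k.
Proof.
rewrite Qcoef_up mulrDr !mulrA -!expiD addrN expi0 mul1r.
by congr (_ + expi _ * _); rewrite -!natr1; field.
Qed.

(** At this angle the roots of Qpoly m and one more point form a regular
polygon, and Qpoly m becomes 1 + X + ... + X^m. *)
Lemma Qcoef_extreme m k : (k <= m)%N -> Qcoef m (2 * pi / m.+1%:R : R) k = 1.
Proof.
set lam : R := 2 * pi / m.+1%:R.
have m0 : 0 < m.+1%:R :> R by rewrite ltr0n.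
have l0 : 0 < lam by rewrite divr_gt0 // mulr_gt0 // pi_gt0.
have ml : m%:R * lam < 2 * pi.
  rewrite /lam mulrCA gtr_pMr ?mulr_gt0 ?pi_gt0 //.
  by rewrite ltr_pdivrMr // mul1r ltr_nat.
elim: k => [|k IH] km; first exact: Qcoef0.
have s1 : (sin (k.+1%:R * lam / 2))%:C%C != 0 :> C.
  by rewrite gt_eqF // ltcR (@sin_half_gt0 lam _ m%:R) // ?ltr0n // ler_nat.
apply: (mulfI s1); rewrite Qcoef_ratio IH; last exact: ltnW.
congr ((_)%:C%C * _).
have -> : (m%:R - k%:R) * lam / 2 = pi - k.+1%:R * lam / 2.
  by rewrite /lam -!natr1; field; rewrite natr1 gt_eqF.
by rewrite sinB sinpi cospi mul0r sub0r mulN1r opprK.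
Qed.

End QBinomials.

(** * Hadamard products and n-inverses *)

Section Operators.
Variable R : realType.
Local Notation C := R[i].
Local Notation Re := (@complex.Re R).
Local Notation Im := (@complex.Im R).
Implicit Types (lam : R) (f g F G P : {poly C}) (u v w z : C).

Definition had N f G : {poly C} := \poly_(k < N) (f`_k * G`_k).
(** The value at 1 of the Hadamard product, as a linear functional of G. *)
Definition Lam N f G : C := \sum_(k < N) f`_k * G`_k.
Definition shiftc f : {poly C} := drop_poly 1 f.

Lemma coef_had N f G k : (had N f G)`_k = if (k < N)%N then f`_k * G`_k else 0.
Proof. by rewrite coef_poly. Qed.

Lemma coef_shiftc f k : (shiftc f)`_k = f`_k.+1.
Proof. by rewrite coef_drop_poly addn1. Qed.

Lemma size_had N f G : (size (had N f G) <= N)%N.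
Proof. exact: size_poly. Qed.

Lemma hadE N f G u : (had N f G).[u] = \sum_(k < N) f`_k * G`_k * u ^+ k.
Proof. by rewrite horner_poly. Qed.

Lemma had_at1 N f G : (had N f G).[1] = Lam N f G.
Proof. by rewrite hadE; apply: eq_bigr => k _; rewrite expr1n mulr1. Qed.

Lemma hadC N f G : had N f G = had N G f.
Proof. by apply/polyP => k; rewrite !coef_had mulrC. Qed.

Lemma hadD N f G H : had N f (G + H) = had N f G + had N f H.
Proof.
by apply/polyP => k; rewrite coefD !coef_had coefD; case: ifP; rewrite ?addr0 ?mulrDr.
Qed.

Lemma hadZ N f a G : had N f (a *: G) = a *: had N f G.
Proof.
by apply/polyP => k; rewrite coefZ !coef_had coefZ; case: ifP; rewrite ?mulr0 // mulrCA.
Qed.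

Lemma had0 N f : had N f 0 = 0.
Proof. by apply/polyP => k; rewrite coef_had coef0 mulr0 if_same. Qed.

Lemma had_sum N f I (r : seq I) (P : pred I) (G : I -> {poly C}) :
  had N f (\sum_(i <- r | P i) G i) = \sum_(i <- r | P i) had N f (G i).
Proof. exact: (big_morph _ (hadD N f) (had0 N f)). Qed.

Lemma LamD N f G H : Lam N f (G + H) = Lam N f G + Lam N f H.
Proof. by rewrite -!had_at1 hadD hornerD. Qed.
Lemma LamZ N f a G : Lam N f (a *: G) = a * Lam N f G.
Proof. by rewrite -!had_at1 hadZ hornerZ. Qed.
Lemma Lam_sum N f I (r : seq I) (P : pred I) (G : I -> {poly C}) :
  Lam N f (\sum_(i <- r | P i) G i) = \sum_(i <- r | P i) Lam N f (G i).
Proof. by rewrite -had_at1 had_sum horner_sum; apply: eq_bigr => i _; rewrite had_at1. Qed.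

Lemma had_wide N M f G : (size G <= N)%N -> (N <= M)%N -> had M f G = had N f G.
Proof.
move=> sG NM; apply/polyP => k; rewrite !coef_had.
have [kN|kN] := ltnP k N; first by rewrite (leq_trans kN NM).
by rewrite [G`_k]nth_default ?mulr0 ?if_same // (leq_trans sG).
Qed.

Lemma Lam_wide N M f G : (size G <= N)%N -> (N <= M)%N -> Lam M f G = Lam N f G.
Proof. by move=> sG NM; rewrite -!had_at1 (had_wide _ sG). Qed.

Lemma had_euler N f G : 'X * (had N f G)^`() = had N f ('X * G^`()).
Proof.
apply/polyP => -[|k]; rewrite coefXM coef_had coefXM /=; first by rewrite mulr0 if_same.
by rewrite !coef_deriv coef_had; case: ifP; rewrite ?mul0rn // mulrnAr.
Qed.

Lemma Lam_euler N f G : (had N f G)^`().[1] = Lam N f ('X * G^`()).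
Proof. by rewrite -had_at1 -had_euler hornerM hornerX mul1r. Qed.

(** Multiplying G by a linear factor splits the Hadamard product into two
pieces of lower degree, which is what makes [kernel_split] possible. *)
Lemma had_linfac m f G (c : C) : (size G <= m.+1)%N ->
  had m.+2 f (('X - c%:P) * G) = 'X * had m.+1 (shiftc f) G - c *: had m.+1 f G.
Proof.
move=> sG; apply/polyP => k.
rewrite coefB coefZ !coef_had mulrBl coefB coefXM coefXM mul_polyC coefZ coef_had.
case: k => [|k] /=.
  by rewrite !sub0r mulrN mulrCA.
rewrite coef_shiftc ltnS; have [km|km] := ltnP k m.+1.
  rewrite mulrBr; have [km'|km'] := ltnP k.+1 m.+1; first by rewrite [f`_k.+1 * (c * _)]mulrCA.
  by rewrite [G`_k.+1]nth_default ?mulr0 // (leq_trans sG).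
by rewrite ltnNge (leq_trans km) // mulr0 subr0.
Qed.

Lemma weighted_had m lam f : weighted m lam f = had m.+1 f (Qpoly m lam).
Proof. by apply/polyP => k; rewrite coef_poly coef_had /Qcoef mulrC. Qed.

Lemma size_weighted m lam f : (size (weighted m lam f) <= m.+1)%N.
Proof. exact: size_poly. Qed.

Lemma coef_inv n f k : (n_inverse n f)`_k = if (k < n.+1)%N then (f`_(n - k))^* else 0.
Proof. by rewrite coef_poly. Qed.

Lemma size_inv n f : (size (n_inverse n f) <= n.+1)%N.
Proof. exact: size_poly. Qed.

Lemma invZ n a f : n_inverse n (a *: f) = a^* *: n_inverse n f.
Proof.
apply/polyP => k; rewrite coefZ !coef_inv coefZ.
by case: ifP; rewrite ?rmorphM ?mulr0.
Qed.

Lemma inv0 n : n_inverse n (0 : {poly C}) = 0.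
Proof. by apply/polyP => k; rewrite coef_inv !coef0 rmorph0 if_same. Qed.

Lemma inv_linfac m P (c : C) : (size P <= m.+1)%N ->
  n_inverse m.+1 (('X - c%:P) * P) = (1 - c^* *: 'X) * n_inverse m P.
Proof.
move=> sP; apply/polyP => k.
rewrite coef_inv !mulrBl mul1r -scalerAl !coefB coefXM mul_polyC !coefZ coefXM !coef_inv.
case: k => [|k] /=.
  by rewrite !subn0 mulr0 subr0 [P`_m.+1]nth_default ?mulr0 ?subr0.
rewrite !ltnS !subSS; have [km|km] := leqP k m; last first.
  by rewrite ltnNge (ltnW km) /= mulr0 subr0.
rewrite rmorphB rmorphM /=; have [km'|km'] := ltnP k m.
  by rewrite subn_eq0 leqNgt km' subnS.
have -> : k = m by apply/eqP; rewrite eqn_leq km km'.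
by rewrite subnn /= rmorph0.
Qed.

Lemma invC m (c : C) : n_inverse m c%:P = c^* *: 'X^m.
Proof.
apply/polyP => k; rewrite coef_inv coefZ coefXn coefC ltnS subn_eq0.
have [km|km] := leqP k m; last by rewrite gtn_eqF // mulr0.
have [mk|mk] := leqP m k.
  by rewrite (_ : k == m) ?mulr1 // eqn_leq km mk.
by rewrite ltn_eqF // rmorph0 mulr0.
Qed.

(** On the circle |P*| = |P|; the inequality enters the disc factor by factor,
since |1 - conj(z) u| <= |u - z| for |z| >= 1 >= |u|. *)
Lemma inv_le m P u : (size P <= m.+1)%N -> zfree_open P -> nsq u <= 1 ->
  nsq (n_inverse m P).[u] <= nsq P.[u].
Proof.
move=> sP zf u1.
have [->|P0] := eqVneq P 0.
  by rewrite inv0 !horner0.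
have [r E] := poly_factor P.
have rz := zfree_factor P0 zf E.
have sr : (size r <= m)%N by rewrite -ltnS -(size_factor P0 E).
rewrite E invZ !hornerZ !nsqM nsq_conj ler_wpM2l ?nsq_ge0 // {E sP zf P0 P}.
elim: r m rz sr => [|z r IH] m rz sr /=.
  rewrite !big_nil invC rmorph1 scale1r hornerXn hornerC nsq1 nsqX.
  by rewrite exprn_ile1 ?nsq_ge0.
case: m sr => // m; rewrite ltnS => sr; rewrite !big_cons inv_linfac; last first.
  by rewrite size_prod_XsubC ltnS.
rewrite !hornerM !nsqM ler_pM ?nsq_ge0 ?IH //; last first.
  by move=> y yr; apply: rz; rewrite in_cons yr orbT.
rewrite hornerD hornerN hornerZ !hornerE.
have z1 := rz z (mem_head _ _); rewrite -subr_ge0.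
have -> : nsq (u - z) - nsq (1 - z^* * u) = (nsq z - 1) * (1 - nsq u).
  by case: (u) => a b; case: (z) => c d; rewrite /nsq /=; ring.
by rewrite mulr_ge0 ?subr_ge0.
Qed.

Lemma inv_unit m P u : (size P <= m.+1)%N -> nsq u = 1 ->
  (n_inverse m P).[u] = u ^+ m * (P.[u])^*.
Proof.
move=> sP u1.
have uu : u * u^* = 1 by rewrite mul_conjE u1.
rewrite horner_poly (horner_coef_wide _ sP) rmorph_sum /= mulr_sumr.
rewrite [RHS](reindex_inj rev_ord_inj) /=; apply: eq_bigr => k _.
rewrite subSS rmorphM rmorphXn /= mulrCA; congr (_ * _).
have km : (k <= m)%N by rewrite -ltnS.
rewrite -[X in u ^+ X](subnK km) exprD mulrAC -exprMn uu expr1n mul1r //.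
Qed.

Lemma inv_deriv_unit m P u : (size P <= m.+1)%N -> nsq u = 1 ->
  u * (n_inverse m P)^`().[u] = u ^+ m * (m%:R * P.[u] - u * P^`().[u])^*.
Proof.
move=> sP u1.
have uu : u * u^* = 1 by rewrite mul_conjE u1.
have H (Q : {poly C}) : (size Q <= m.+1)%N ->
    u * Q^`().[u] = \sum_(k < m.+1) k%:R * Q`_k * u ^+ k.
  move=> sQ; have sQ' : (size Q^`() <= m)%N.
    by rewrite (leq_trans (size_poly _ _)) // -subn1 leq_subLR add1n.
  rewrite (horner_coef_wide _ sQ') big_ord_recl !mul0r add0r mulr_sumr.
  by apply: eq_bigr => k _; rewrite lift0 coef_deriv exprS -[Q`_k.+1 *+ _]mulr_natl mulrCA.
rewrite !H ?size_inv // (horner_coef_wide _ sP) mulr_sumr -sumrB rmorph_sum /= mulr_sumr.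
rewrite [RHS](reindex_inj rev_ord_inj) /=; apply: eq_bigr => k _.
have km : (k <= m)%N by rewrite -ltnS.
rewrite coef_inv ltn_ord subSS.
have -> : m%:R * (P`_(m - k) * u ^+ (m - k)) - (m - k)%:R * P`_(m - k) * u ^+ (m - k)
   = k%:R * (P`_(m - k) * u ^+ (m - k)) by rewrite natrB //; ring.
rewrite !rmorphM rmorphXn rmorph_nat /= -mulrA [RHS]mulrCA; congr (_ * _).
rewrite [RHS]mulrCA; congr (_ * _).
have -> : u ^+ m = u ^+ (m - k) * u ^+ k by rewrite -exprD subnK.
by rewrite [RHS]mulrAC -exprMn uu expr1n mul1r.
Qed.

Lemma logderiv_bound_unit P m u : (size P <= m.+1)%N -> zfree_open P -> nsq u = 1 ->
  2 * Re (u * P^`().[u] * (P.[u])^*) <= m%:R * nsq P.[u].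
Proof.
move=> sP zf u1; have u0 : u != 0 by rewrite -nsq_gt0 u1.
have := @logderiv_bound R (P \Po (u *: 'X)) m.
rewrite deriv_comp derivZ derivX hornerM !horner_comp !hornerZ hornerX mulr1 hornerC mulr1.
rewrite [_.[u] * u]mulrC; apply; first by rewrite size_comp_poly2 // size_scale ?size_polyX.
move=> v v1; rewrite horner_comp hornerZ hornerX; apply: zf.
by rewrite nsqM u1 mul1r.
Qed.

Lemma inv_prod_unit I (r : seq I) (P : pred I) (z : I -> C) m :
  (forall i, P i -> nsq (z i) = 1) -> size (seq.filter P r) = m ->
  exists2 c, nsq c = 1 &
    n_inverse m (\prod_(i <- r | P i) ('X - (z i)%:P)) =
      c *: \prod_(i <- r | P i) ('X - (z i)%:P).
Proof.
elim: r m => [|i r IH] m zu /=.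
  by move=> <-; exists 1; rewrite ?nsq1 // !big_nil invC rmorph1 expr0.
rewrite !big_cons; case: ifP => Pi; last exact: IH.
case: m => // m [sm]; have [c c1 E] := IH m zu sm.
exists (- (z i)^* * c); first by rewrite nsqM nsqN nsq_conj zu // c1 mulr1.
have sP : (size (\prod_(j <- r | P j) ('X - (z j)%:P))%R <= m.+1)%N.
  by rewrite -big_filter -(big_map z predT (fun x => 'X - x%:P)) size_prod_XsubC size_map sm.
rewrite inv_linfac // E -scalerAr [- _ * c]mulrC -scalerA; congr (_ *: _).
rewrite scalerAl; congr (_ * _).
have zz : (z i)^* * z i = 1 by rewrite mulrC mul_conjE zu.
by rewrite scaleNr scalerBr opprB -[_ *: (z i)%:P]mul_polyC -polyCM zz.
Qed.

End Operators.

(** * Self-inversive coefficients and spaced configurations *)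

Section Positivity.
Variable R : realType.
Local Notation C := R[i].
Local Notation Re := (@complex.Re R).
Local Notation Im := (@complex.Im R).
Implicit Types (lam : R) (f g F G P A B : {poly C}) (u v w c : C).

(** Self-inversive coefficients: n_inverse N f = c f, with |c| = 1. *)
Definition sinv N f (c : C) :=
  nsq c = 1 /\ forall k, (k <= N)%N -> (f`_(N - k))^* = c * f`_k.

(** For self-inversive f and G, the n-inverse of f * G is up to a unimodular
factor the Hadamard product with the shifted list, so the two pieces of
[had_linfac] have the same modulus on the circle. *)
Lemma inv_had_sinv m f eps G c : sinv m.+1 f eps ->
  n_inverse m G = c *: G ->
  n_inverse m (had m.+1 f G) = (eps * c) *: had m.+1 (shiftc f) G.
Proof.
move=> [_ sf] EG; apply/polyP => k; rewrite coef_inv coefZ !coef_had.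
have [km|km] := ltnP k m.+1; last by rewrite mulr0.
rewrite ltnS leq_subr rmorphM /= coef_shiftc -[(m - k)%N]subSS sf //.
have : (n_inverse m G)`_k = (c *: G)`_k by rewrite EG.
by rewrite coef_inv km coefZ subSS => ->; ring.
Qed.

(** At a boundary zero u of K = X B - zeta A, the derivative u K'(u) is a
nonnegative multiple of zeta A(u): after the values of A* are expressed by A, the
bound on the logarithmic derivative of A is what remains. *)
Lemma pos_pair m A B kappa zeta u : (size A <= m.+1)%N ->
  n_inverse m A = kappa *: B -> nsq kappa = 1 -> zfree_open A ->
  nsq u = 1 -> nsq zeta = 1 -> u * B.[u] = zeta * A.[u] ->
  exists2 t : R, nsq (zeta * A.[u]) <= t &
    u * ('X * B - zeta *: A)^`().[u] * (zeta * A.[u])^* = (t%:C)%C.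
Proof.
move=> sA EB k1 zA u1 z1 e.
have uu : u * u^* = 1 by rewrite mul_conjE u1.
have kk : kappa * kappa^* = 1 by rewrite mul_conjE k1.
have zz : zeta * zeta^* = 1 by rewrite mul_conjE z1.
have h1 := inv_unit sA u1; rewrite EB hornerZ in h1.
have h2 := inv_deriv_unit sA u1; rewrite EB derivZ hornerZ in h2.
exists (nsq (zeta * A.[u]) + m%:R * nsq A.[u] - 2 * Re (u * A^`().[u] * (A.[u])^*)).
  by rewrite -addrA lerDl subr_ge0 logderiv_bound_unit.
rewrite derivB derivM derivX mul1r derivZ hornerD hornerN hornerZ hornerD hornerM hornerX.
rewrite mulrBr mulrDr e !mulrBl !mulrDl mul_conjE.
have -> : u * (u * B^`().[u]) * (zeta * A.[u])^* =
   (m%:R * A.[u] - u * A^`().[u])^* * A.[u].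
  rewrite -e rmorphM /=.
  transitivity ((kappa * kappa^*) * (u * u^*) * ((u * B^`().[u]) * (B.[u])^*)).
    by rewrite kk mul1r; ring.
  transitivity ((u * (kappa * B^`().[u])) * (kappa * B.[u])^*).
    by rewrite uu rmorphM /=; ring.
  have uum : u ^+ m * (u ^+ m)^* = 1 by rewrite rmorphXn /= -exprMn uu expr1n.
  rewrite h2 h1 rmorphM /= conjCK.
  by transitivity (u ^+ m * (u ^+ m)^* * ((m%:R * A.[u] - u * A^`().[u])^* * A.[u]));
    [ring|rewrite uum mul1r].
have -> : u * (zeta * A^`().[u]) * (zeta * A.[u])^* = u * A^`().[u] * (A.[u])^*.
  rewrite rmorphM /=; transitivity ((zeta * zeta^*) * (u * A^`().[u] * (A.[u])^*)); [ring|].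
  by rewrite zz mul1r.
rewrite !rmorphB !rmorphD !rmorphM /= rmorph_nat mulrBl.
have -> : m%:R * (A.[u])^* * A.[u] = (m%:R * nsq A.[u])%:C%C.
  by rewrite -mulrA [_^* * _]mulrC mul_conjE rmorphM /= rmorph_nat.
rewrite -!addrA; congr (_ + (_ + _)).
set X := u * A^`().[u] * (A.[u])^*.
have -> : u^* * (A^`().[u])^* * A.[u] = X^* by rewrite /X !rmorphM /= conjCK.
by case: X => a b; apply: complex_eq => /=; ring.
Qed.

(** Away from the zeros of the kernel K = x - y this places -y in the open
half plane determined by K. *)
Lemma half_plane_pair (x y : C) : nsq x <= nsq y ->
  nsq (x - y) <= 2 * Re (- y * (x - y)^*).
Proof.
case: x => a b; case: y => c d; rewrite /nsq /=; nra.
Qed.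

End Positivity.

Section Configurations.
Variable R : realType.
Local Notation C := R[i].
Local Notation Re := (@complex.Re R).
Local Notation Im := (@complex.Im R).
Variable m : nat.
Local Notation I := 'I_m.+1.
Implicit Types (lam : R) (f g F G P A B : {poly C}) (u v w c : C) (z : I -> C) (i j k : I).

(** The configurations z are indexed by 'I_m.+1, that is, by n = m + 1 points;
P selects the points that are kept. *)
Definition prodX (P : pred I) z : {poly C} := \prod_(i | P i) ('X - (z i)%:P).

(** Two points of the circle are at angular distance at least lam exactly when
Re (z conj w) <= cos lam, for lam <= pi; this avoids choosing arguments. *)
Definition spaced lam z :=
  (forall i, nsq (z i) = 1) /\
  (forall i j, i != j -> Re (z i * (z j)^*) <= cos lam).
Definition strict_spaced lam z :=
  (forall i, nsq (z i) = 1) /\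
  (forall i j, i != j -> Re (z i * (z j)^*) < cos lam).

Lemma strict_spaced_spaced lam z : strict_spaced lam z -> spaced lam z.
Proof. by move=> [h1 h2]; split => // i j ij; exact/ltW/h2. Qed.

(** The nonvanishing property around which the proof turns: one point of
a spaced configuration of n points is deleted, and the Hadamard product of f with
the remaining product of n - 1 factors must have no zero in the open disc. *)
Definition deleted_zfree lam f := forall z i, spaced lam z ->
  zfree_open (had m.+1 f (prodX (fun j => j != i) z)).

Lemma size_prodX (P : pred I) z : size (prodX P z) = #|P|.+1.
Proof.
rewrite /prodX -big_filter -(big_map z predT (fun x => 'X - x%:P)) size_prod_XsubC.
rewrite size_map size_filter -sum1_count sum1dep_card.
by rewrite cardsE.
Qed.

Lemma card_neq i : #|(fun j => j != i) : pred I| = m.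
Proof. by transitivity #|predC1 i|; [exact: eq_card|rewrite cardC1 card_ord]. Qed.

Lemma inv_prodX i z : (forall j, nsq (z j) = 1) ->
  exists2 c, nsq c = 1 &
    n_inverse m (prodX (fun j => j != i) z) = c *: prodX (fun j => j != i) z.
Proof.
move=> zu; apply: inv_prod_unit => //.
have := size_prodX (fun j => j != i) z; rewrite card_neq.
rewrite /prodX -big_filter -(big_map z predT (fun x => 'X - x%:P)) size_prod_XsubC.
by rewrite size_map => -[].
Qed.

Lemma prodX_T i z :
  prodX predT z = ('X - (z i)%:P) * prodX (fun j => j != i) z.
Proof. by rewrite /prodX (bigD1 i). Qed.

(** The left-hand side does not depend on the deleted point i, which
relates all the deleted products to each other. *)
Lemma kernel_split i f z : had m.+2 f (prodX predT z) =
  'X * had m.+1 (shiftc f) (prodX (fun j => j != i) z) -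
  z i *: had m.+1 f (prodX (fun j => j != i) z).
Proof. by rewrite (prodX_T i) had_linfac // size_prodX card_neq. Qed.

(** At a boundary zero of the common kernel, all the numbers
z_i A_i(u) lie on a single closed ray. *)
Lemma pos_all f eps z u : sinv m.+1 f eps -> (forall i, nsq (z i) = 1) ->
  (forall i, zfree_open (had m.+1 f (prodX (fun j => j != i) z))) -> nsq u = 1 ->
  (had m.+2 f (prodX predT z)).[u] = 0 ->
  exists beta : I -> R, forall i, 0 <= beta i /\
    z i * (had m.+1 f (prodX (fun j => j != i) z)).[u] =
      ((beta i)%:C)%C * (u * (had m.+2 f (prodX predT z))^`().[u]).
Proof.
move=> sf zu zf u1 K0; set b := u * _.
suff H i : exists be : R, 0 <= be /\
    z i * (had m.+1 f (prodX (fun j => j != i) z)).[u] = (be%:C)%C * b.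
  by have [be Hb] := choice H; exists be.
have [c c1 Ec] := inv_prodX i zu.
have [e1 _] := sf.
have := @pos_pair R m (had m.+1 f (prodX (fun j => j != i) z))
  (had m.+1 (shiftc f) (prodX (fun j => j != i) z)) (eps * c) (z i) u (size_had _ _ _)
  (inv_had_sinv sf Ec) _ (zf i) u1 (zu i).
rewrite nsqM e1 c1 mul1r => /(_ erefl).
set A := (had m.+1 f _).[u].
move: K0; rewrite (kernel_split i) hornerD hornerN hornerZ hornerM hornerX -/A.
move=> /eqP; rewrite subr_eq0 => /eqP -> /(_ erefl) [t tb].
rewrite -(kernel_split i) -/b => E.
have [b0|b0] := eqVneq b 0.
  exists 0; split => //; rewrite mul0r; apply/eqP; rewrite -nsq_eq0 eq_le nsq_ge0 andbT.
  have : ((t%:C)%C : C) = 0 by rewrite -E b0 mul0r.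
  by move=> [t0]; rewrite -t0.
have nb : nsq b != 0 by rewrite nsq_eq0.
have t0 : 0 <= t := le_trans (nsq_ge0 _) tb.
exists (t / nsq b); split; first by rewrite divr_ge0 ?nsq_ge0.
have bb : b^* != 0 by rewrite conjC_eq0.
apply: (mulIf bb); rewrite -[RHS]mulrA mul_conjE -rmorphM divfK //.
transitivity ((t%:C)%C^* : C); last exact: conjc_real.
by rewrite -E [RHS]rmorphM /= conjCK [RHS]mulrC.
Qed.

(** First-order expansion of a moving product, with exact error: D is
continuous and its value at 0 is the derivative. *)
Lemma prod_first_order (r : seq I) z (a : I -> C) : uniq r ->
  exists D : R -> {poly C}, [/\ pcont D,
   forall t, (size (D t) <= size r)%N,
   forall t, \prod_(i <- r) ('X - (z i - (1 - expi (- t)) * a i)%:P) =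
     \prod_(i <- r) ('X - (z i)%:P) + (1 - expi (- t)) *: D t
   & D 0 = \sum_(k <- r) a k *: \prod_(j <- r | j != k) ('X - (z j)%:P)].
Proof.
elim: r => [|i r IH] /=.
  move=> _; exists (fun=> 0); split => [|t|t|].
  - exact: pcont_cst.
  - by rewrite size_poly0.
  - by rewrite !big_nil scaler0 addr0.
  - by rewrite !big_nil.
move=> /andP[ir ur]; have [D [cD sD ED D0]] := IH ur.
exists (fun t => ('X - (z i - (1 - expi (- t)) * a i)%:P) * D t +
                 a i *: \prod_(j <- r) ('X - (z j)%:P)); split => [|t|t|].
- apply: pcontD; last exact: pcont_cst.
  apply: pcontM => //; apply: pcont_XsubC; apply: ccontB; first exact: ccont_cst.
  apply: ccontM; last exact: ccont_cst.
  apply: ccontB; first exact: ccont_cst.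
  by apply: ccont_expi => x; apply: cvgN; exact: cvg_id.
- rewrite (leq_trans (size_polyD _ _)) // geq_max; apply/andP; split.
    rewrite (leq_trans (size_polyMleq _ _)) // size_XsubC add2n /=.
    by rewrite ltnS.
  by rewrite (leq_trans (size_scale_leq _ _)) // size_prod_XsubC.
- rewrite !big_cons ED.
  set e := 1 - _; set Pr := \prod_(j <- r) _.
  rewrite polyCB polyCM -!mul_polyC; ring.
- rewrite oppr0 expi0 subrr mul0r subr0 D0 !big_cons eqxx /= addrC; congr (_ + _).
    congr (_ *: _); rewrite big_seq [RHS]big_seq_cond; apply: eq_bigl => j.
    by case: (boolP (j \in r)) => //= jr; rewrite (memPn ir).
  rewrite mulr_sumr big_seq [RHS]big_seq; apply: eq_bigr => k kr.
  rewrite big_cons (_ : i != k) -?scalerAr //.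
  by rewrite eq_sym (memPn ir).
Qed.

Lemma deriv_prod_sum (r : seq I) z : uniq r ->
  (\prod_(i <- r) ('X - (z i)%:P))^`() =
  \sum_(k <- r) \prod_(j <- r | j != k) ('X - (z j)%:P).
Proof.
elim: r => [|i r IH] /=; first by rewrite !big_nil derivC.
move=> /andP[ir ur]; rewrite !big_cons derivM derivXsubC mul1r eqxx /=; congr (_ + _).
  rewrite big_seq [RHS]big_seq_cond; apply: eq_bigl => j.
  by case: (boolP (j \in r)) => //= jr; rewrite (memPn ir).
rewrite IH // mulr_sumr big_seq [RHS]big_seq; apply: eq_bigr => k kr.
rewrite big_cons (_ : i != k) //.
by rewrite eq_sym (memPn ir).
Qed.

End Configurations.

(** * First contact of a kernel with zero *)

Section Contact.
Variable R : realType.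
Local Notation C := R[i].
Local Notation Re := (@complex.Re R).
Local Notation Im := (@complex.Im R).
Variable m : nat.
Local Notation I := 'I_m.+1.
Implicit Types (lam t : R) (f g F G P A B : {poly C}) (u v w c : C) (z : I -> C) (i j k l : I).

Lemma Lam_X N f G : Lam N.+1 f ('X * G) = Lam N (shiftc f) G.
Proof.
rewrite /Lam big_ord_recl coefXM mulr0 add0r; apply: eq_bigr => k _.
by rewrite coefXM coef_shiftc.
Qed.

Lemma Lam_linfac N f G c : Lam N f (('X - c%:P) * G) = Lam N f ('X * G) - c * Lam N f G.
Proof. by rewrite mulrBl mul_polyC -[- (c *: G)]scaleNr LamD LamZ mulNr. Qed.

Lemma ccont_Lam (T : topologicalType) N f (G : T -> {poly C}) :
  pcont G -> ccont (fun x => Lam N f (G x)).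
Proof. by move=> cG; apply: ccont_sum => k _; apply: ccontM; [exact: ccont_cst|exact: cG]. Qed.

(** The product from which both the contact point i0 and the point k are
removed: the derivative of a contact with respect to the point k. *)
Definition omit2 i0 k z := prodX (fun j => (j != i0) && (j != k)) z.

Lemma omit2_split i0 k z : k != i0 ->
  prodX (fun j => j != i0) z = ('X - (z k)%:P) * omit2 i0 k z.
Proof. by move=> ki; rewrite /prodX (bigD1 k). Qed.

Lemma omit2_split' i0 k z : k != i0 ->
  prodX (fun j => j != k) z = ('X - (z i0)%:P) * omit2 i0 k z.
Proof.
move=> ki; rewrite /prodX (bigD1 i0) 1?eq_sym //; congr (_ * _).
by apply: eq_bigl => j; rewrite andbC.
Qed.

(** A contact annihilates G and X G, because self-inversiveness sends one
value to the conjugate of the other. *)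
Lemma contact_X f eps i0 z : sinv m.+1 f eps -> (forall i, nsq (z i) = 1) ->
  Lam m.+2 f (prodX (fun j => j != i0) z) = 0 ->
  Lam m.+2 f ('X * prodX (fun j => j != i0) z) = 0.
Proof.
move=> sf zu; have sG : size (prodX (fun j => j != i0) z) = m.+1.
  by rewrite size_prodX card_neq.
rewrite (@Lam_wide _ m.+1) ?sG // => L0.
rewrite Lam_X.
have [c c1 Ec] := inv_prodX i0 zu.
have [e1 _] := sf.
have := @inv_unit R m (had m.+1 f (prodX (fun j => j != i0) z)) 1 (size_had _ _ _) (nsq1 R).
rewrite (inv_had_sinv sf Ec) hornerZ !had_at1 L0 rmorph0 mulr0 => /eqP.
by rewrite mulf_eq0 -nsq_eq0 nsqM e1 c1 mul1r oner_eq0 => /eqP.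
Qed.

Lemma one_sub_expi t : 1 - expi (- t) = ((2 * sin (t / 2))%:C)%C * ('i%C * expi (- (t / 2))) :> C.
Proof.
have e : t = t / 2 + t / 2 by field.
rewrite {1}e; apply: complex_eq; rewrite /= ?cosN ?sinN ?cosD ?sinD.
  have := cos2Dsin2 (t / 2); set c := cos _; set s := sin _ => h.
  by lra.
by ring.
Qed.

Definition moved (U : pred I) z t i := if U i then z i * expi (- t) else z i.

(** While the points of U turn, the kernel has no zero in the open disc, so
the real part of its logarithmic derivative at 1 stays bounded by m/2.  At the contact the kernel
itself vanishes to first order in t, and dividing by t leaves this inequality in
the limit. *)
Lemma tangency lam f i0 z (U : pred I) t0 : deleted_zfree m lam f ->
  0 < t0 -> (forall t, 0 < t -> t <= t0 -> spaced lam (moved U z t)) ->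
  Lam m.+2 f (prodX (fun j => j != i0) z) = 0 ->
  Im ((\sum_(k | k != i0) z k * Lam m.+2 f (omit2 i0 k z)) *
      (\sum_(k | (k != i0) && U k) z k * Lam m.+2 f (omit2 i0 k z))^*) <= 0.
Proof.
move=> wf t0_gt0 sep L0.
pose r := [seq i <- index_enum I | i != i0].
have ur : uniq r by rewrite filter_uniq // index_enum_uniq.
have sr : size r = m.
  have := size_prodX (fun j => j != i0) z; rewrite card_neq.
  rewrite /prodX -big_filter -(big_map z predT (fun x => 'X - x%:P)) size_prod_XsubC.
  by rewrite size_map => -[].
pose a k := if U k then z k else 0.
have [D [cD sD ED D0]] := prod_first_order z a ur.
pose G t := \prod_(i <- r) ('X - (z i - (1 - expi (- t)) * a i)%:P).
have GE t : G t = prodX (fun j => j != i0) (moved U z t).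
  rewrite /G /prodX big_filter; apply: eq_bigr => i _; congr ('X - _%:P).
  by rewrite /moved /a; case: (U i); [ring|rewrite mulr0 subr0].
have G0 : \prod_(i <- r) ('X - (z i)%:P) = prodX (fun j => j != i0) z.
  by rewrite /prodX big_filter.
have cG : pcont G.
  apply: (@pcont_ext _ _ (fun t => \prod_(i <- r) ('X - (z i)%:P) + (1 - expi (- t)) *: D t)).
    by move=> t; rewrite -ED.
  apply: pcontD; first exact: pcont_cst.
  apply: pcontZ => //; apply: ccontB; first exact: ccont_cst.
  by apply: ccont_expi => x; apply: cvgN; exact: cvg_id.
pose d t := Lam m.+2 f (D t).
pose p t := Lam m.+2 f ('X * (G t)^`()).
have cd : ccont d by exact: ccont_Lam.
have cp : ccont p.
  by apply: ccont_Lam; apply: pcontM; [exact: pcont_cst|exact: pcont_deriv].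
pose v t : C := 'i%C * expi (- (t / 2)).
have cv : ccont v.
  apply: ccontM; first exact: ccont_cst.
  apply: ccont_expi => x; apply: cvgN; apply: cvgM; [exact: cvg_id|exact: cvg_cst].
have v1 t : nsq (v t) = 1 by rewrite nsqM nsq_expi mulr1 /nsq /= expr0n add0r expr1n.
have csin : continuous (fun t : R => sin (t / 2)).
  move=> x; apply: (@continuous_comp _ _ _ (fun t : R => t / 2)).
    by apply: cvgM; [exact: cvg_id|exact: cvg_cst].
  exact: continuous_sin.
have key t : 0 < t -> t <= 0 + Num.min t0 1 ->
    2 * Re (p t * (v t * d t)^*) <= m%:R * (2 * sin (t / 2)) * nsq (d t).
  rewrite add0r le_min => tp /andP[tt0 t1].
  have s0 : 0 < 2 * sin (t / 2).
    rewrite mulr_gt0 // sin_gt0_pi // divr_gt0 //=.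
    by have := pi_ge2 R; lra.
  have sG : size (G t) = m.+1 by rewrite GE size_prodX card_neq.
  have := @logderiv_bound R (had m.+1 f (G t)) m (size_had _ _ _).
  rewrite {1}GE => /(_ (wf _ i0 (sep t tp tt0))).
  have -> : (had m.+1 f (G t)).[1] = (1 - expi (- t)) * d t.
    rewrite had_at1 -(@Lam_wide _ m.+1 m.+2) ?sG //.
    by rewrite {1}/G ED G0 LamD L0 add0r LamZ.
  have -> : (had m.+1 f (G t))^`().[1] = p t.
    rewrite Lam_euler -(@Lam_wide _ m.+1 m.+2) //.
    rewrite (leq_trans (size_polyMleq _ _)) // size_polyX add2n /= ltnS.
    by rewrite (leq_trans (size_poly _ _)) // sG.
  rewrite one_sub_expi -/(v t) -[_ * v t * d t]mulrA [nsq (_ * (v t * d t))]nsqM nsq_real.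
  have -> : p t * ((2 * sin (t / 2))%:C%C * (v t * d t))^* =
     (2 * sin (t / 2))%:C%C * (p t * (v t * d t)^*).
    by rewrite rmorphM /= [(_%:C%C)^*]conjc_real; ring.
  rewrite Re_realM nsqM v1 mul1r => h.
  rewrite -(ler_pM2l s0); move: h; set s := 2 * sin _; lra.
have := @le_lim R (fun t => 2 * Re (p t * (v t * d t)^*))
  (fun t => m%:R * (2 * sin (t / 2)) * nsq (d t)) 0 (Num.min t0 1) _ _ _ key.
rewrite /= mul0r sin0 !mulr0 mul0r pmulr_rle0 // lt_min t0_gt0 ltr01.
have c1 : continuous (fun t => 2 * Re (p t * (v t * d t)^*)).
  move=> x; apply: cvgM; first exact: cvg_cst.
  exact: (continuous_Re (ccontM cp (ccont_conj (ccontM cv cd)))).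
have c2 : continuous (fun t => m%:R * (2 * sin (t / 2)) * nsq (d t)).
  move=> x; apply: cvgM; last exact: (continuous_nsq cd).
  apply: cvgM; first exact: cvg_cst.
  by apply: cvgM; [exact: cvg_cst|exact: csin].
move=> /(_ isT c1 c2).
have -> : d 0 = \sum_(k | (k != i0) && U k) z k * Lam m.+2 f (omit2 i0 k z).
  rewrite /d D0 Lam_sum big_filter [RHS]big_mkcondr /=.
  apply: eq_bigr => k ki; rewrite LamZ /a.
  rewrite (_ : \prod_(j <- r | j != k) _ = omit2 i0 k z); last by rewrite big_filter_cond.
  by case: (U k); rewrite ?mul0r.
have -> : p 0 = \sum_(k | k != i0) z k * Lam m.+2 f (omit2 i0 k z).
  have EG0 : G 0 = \prod_(i <- r) ('X - (z i)%:P).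
    by apply: eq_bigr => i _; rewrite oppr0 expi0 subrr mul0r subr0.
  rewrite /p EG0 (deriv_prod_sum z ur) mulr_sumr Lam_sum big_filter; apply: eq_bigr => k ki.
  rewrite (_ : \prod_(j <- r | j != k) _ = omit2 i0 k z); last by rewrite big_filter_cond.
  by move: L0; rewrite (omit2_split z ki) Lam_linfac => /eqP; rewrite subr_eq0 => /eqP.
set V := \sum_(k | k != i0) _; set Y := \sum_(k | _ && _) _.
rewrite /v mul0r oppr0 expi0 mulr1.
have -> : Re (V * ('i%C * Y)^*) = Im (V * Y^*).
  by case: (V) => x y; case: (Y) => x' y' /=; ring.
by [].
Qed.

End Contact.

Section ContactCore.
Variable R : realType.
Local Notation C := R[i].
Local Notation Re := (@complex.Re R).
Local Notation Im := (@complex.Im R).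
Variable m : nat.
Local Notation I := 'I_m.+1.
Implicit Types (lam t : R) (f g F G P A B : {poly C}) (v w c : C) (z : I -> C) (i j k l u : I).

Lemma Im_realM t c : Im ((t%:C)%C * c) = t * Im c.
Proof. by rewrite Im_mul Re_real Im_real mul0r addr0. Qed.

(** The inverse of expi t - 1; for 0 < t < 2 pi its argument decreases with t. *)
Definition cayley (t : R) : C := (((2 * sin (t / 2))^-1)%:C)%C * (- 'i%C * expi (- (t / 2))).

Lemma cayleyE (t : R) : 0 < t < 2 * pi -> (expi t - 1) * cayley t = 1 :> C.
Proof.
move=> /andP[t0 t1].
have s0 : 2 * sin (t / 2) != 0.
  rewrite mulf_neq0 // gt_eqF // sin_gt0_pi // divr_gt0 //=; lra.
have -> : expi t - 1 = ((2 * sin (t / 2))%:C)%C * ('i%C * expi (t / 2)) :> C.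
  have := one_sub_expi (- t); rewrite opprK mulNr sinN mulrN opprK => h.
  by rewrite -opprB h rmorphN mulNr opprK.
transitivity ((((2 * sin (t / 2)) * (2 * sin (t / 2))^-1)%:C)%C * (- ('i%C * 'i%C)) *
   (expi (t / 2) * expi (- (t / 2))) : C).
  by rewrite /cayley rmorphM /=; ring.
rewrite expiNr divff // mulr1 rmorph1 mul1r -expr2 sqr_i opprK //.
Qed.

Lemma Im_cayley (s t : R) : 0 < s -> s < t -> t < 2 * pi ->
  0 < Im (cayley s * (cayley t)^*).
Proof.
move=> s0 st t1.
have hs : 0 < (2 * sin (s / 2))^-1.
  by rewrite invr_gt0 mulr_gt0 // sin_gt0_pi // divr_gt0 //=; lra.
have ht : 0 < (2 * sin (t / 2))^-1.
  by rewrite invr_gt0 mulr_gt0 // sin_gt0_pi // divr_gt0 ?(lt_trans s0 st) //=; lra.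
have -> : Im (cayley s * (cayley t)^*) =
   (2 * sin (s / 2))^-1 * ((2 * sin (t / 2))^-1 * sin (t / 2 - s / 2)).
  rewrite /cayley; move: (_^-1) (_^-1) => a b.
  by rewrite !rmorphM /= sinB !cosN !sinN; ring.
rewrite !mulr_gt0 // sin_gt0_pi //; apply/andP; split; lra.
Qed.

(** By [pos_all] the contributions Y_k = z_k X_k of the single points are
nonnegative multiples of one number times [cayley] of their angles, so
Im (Y_l conj Y_u) >= 0 whenever the angle of l is below that of u.  The tangency
inequality makes the sum of these terms nonpositive; hence each of them is zero, and
one of the two blocks does not contribute. *)
Lemma contact_core lam f eps i0 z (U : pred I) t0 (phi : I -> R) :
  sinv m.+1 f eps -> deleted_zfree m lam f -> spaced lam z -> ~~ U i0 ->
  0 < t0 -> (forall t, 0 < t -> t <= t0 -> spaced lam (moved U z t)) ->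
  Lam m.+2 f (prodX (fun j => j != i0) z) = 0 ->
  (forall i, i != i0 -> z i = z i0 * expi (phi i) /\ 0 < phi i < 2 * pi) ->
  (forall u l, U u -> l != i0 -> ~~ U l -> phi l < phi u) ->
  (forall k, U k -> Lam m.+2 f (omit2 i0 k z) = 0) \/
  (forall k, k != i0 -> ~~ U k -> Lam m.+2 f (omit2 i0 k z) = 0).
Proof.
move=> sf wf [zu zs] Ui0 t0_gt0 mv L0 zphi phiU.
have L1 := contact_X sf zu L0.
pose X k := Lam m.+2 f (omit2 i0 k z).
pose Y k := z k * X k.
have z_neq0 k : z k != 0 by rewrite -nsq_gt0 zu.
have XE k : k != i0 -> Lam m.+2 f ('X * omit2 i0 k z) = Y k.
  move=> ki; move: L0; rewrite (omit2_split z ki) Lam_linfac.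
  by move=> /eqP; rewrite subr_eq0 => /eqP.
have [||beta Hb] := @pos_all R m f eps z 1 sf zu _ (nsq1 R) _.
- by move=> i; apply: wf; split.
- by rewrite had_at1 (prodX_T i0) Lam_linfac L0 L1 mulr0 subr0.
set b := 1 * _ in Hb.
have YE k : k != i0 -> Y k = ((beta k)%:C)%C * (b * (z i0)^* * cayley (phi k)).
  move=> ki; have [_] := Hb k; have [zk pk] := zphi k ki.
  rewrite had_at1 -(@Lam_wide _ m.+1 m.+2) ?size_prodX ?card_neq //.
  rewrite (omit2_split' z ki) Lam_linfac XE // -/(X k) => E.
  have E2 : ((beta k)%:C)%C * b = z i0 * (expi (phi k) - 1) * Y k.
    by rewrite mulrBr mulr1 -zk -E /Y; ring.
  rewrite mulrA mulrA E2.
  transitivity ((z i0 * (z i0)^*) * ((expi (phi k) - 1) * cayley (phi k)) * Y k); last by ring.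
  by rewrite cayleyE // mul_conjE zu !mul1r.
have := @tangency R m lam f i0 z U t0 wf t0_gt0 mv L0.
rewrite -/(X _).
under eq_bigr do rewrite -/(X _) -/(Y _).
under [X in _ * X^*]eq_bigr do rewrite -/(X _) -/(Y _).
rewrite (bigID U) /= mulrDl Im_add mul_conjE Im_real add0r.
rewrite mulr_suml Im_sum.
have term l u : l != i0 -> ~~ U l -> u != i0 -> U u ->
    Im (Y l * (Y u)^*) = beta l * beta u * nsq b * Im (cayley (phi l) * (cayley (phi u))^*).
  move=> li Ul ui Uu; rewrite !YE //.
  have -> : (beta l)%:C%C * (b * (z i0)^* * cayley (phi l)) *
      ((beta u)%:C%C * (b * (z i0)^* * cayley (phi u)))^* =
     ((beta l * beta u)%:C)%C * (b * b^*) * (z i0 * (z i0)^*) *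
       (cayley (phi l) * (cayley (phi u))^*).
    by rewrite !rmorphM /= [(_%:C%C)^*]conjc_real conjCK; ring.
  rewrite !mul_conjE zu -!rmorphM mulr1.
  exact: Im_realM.
have term_ge0 l u : l != i0 -> ~~ U l -> u != i0 -> U u -> 0 <= Im (Y l * (Y u)^*).
  move=> li Ul ui Uu; rewrite term // !mulr_ge0 ?nsq_ge0 ?(Hb _).1 //.
  have [_ /andP[l0 _]] := zphi l li; have [_ /andP[_ u1]] := zphi u ui.
  by rewrite ltW // Im_cayley // phiU.
move=> S0.
case: (boolP [forall k, U k ==> (X k == 0)]) => [/forallP H|/forallPn[u]].
  by left => k Uk; have := H k; rewrite Uk => /eqP.
rewrite negb_imply => /andP[Uu Xu]; right => l li Ul; apply/eqP.
apply: contraT => Xl.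
have ui : u != i0 by apply: contraTneq Uu => ->.
have bneq k : k != i0 -> X k != 0 -> 0 < beta k /\ b != 0.
  move=> ki Xk; have : Y k != 0 by rewrite mulf_neq0.
  rewrite YE // !mulf_eq0 !negb_or => /andP[bk /andP[/andP[b0 _] _]]; split => //.
  by rewrite lt_neqAle (Hb k).1 andbT eq_sym; apply: contraNneq bk => ->.
have [bl b0] := bneq l li Xl; have [bu _] := bneq u ui Xu.
have pos : 0 < Im (Y l * (Y u)^*).
  rewrite term // !mulr_gt0 ?nsq_gt0 //.
  have [_ /andP[l0 _]] := zphi l li; have [_ /andP[_ u1]] := zphi u ui.
  by rewrite Im_cayley // phiU.
suff : 0 < \sum_(i | (i != i0) && ~~ U i) Im (Y i * (\sum_(k | (k != i0) && U k) Y k)^*).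
  by rewrite ltNge S0.
have Ein i : Im (Y i * (\sum_(k | (k != i0) && U k) Y k)^*) =
   \sum_(k | (k != i0) && U k) Im (Y i * (Y k)^*).
  by rewrite rmorph_sum /= mulr_sumr Im_sum.
rewrite (bigD1 l) /= ?li //; apply: ltr_pwDl.
  rewrite Ein (bigD1 u) /= ?ui //; apply: ltr_pwDl => //.
  by apply: sumr_ge0 => k /andP[/andP[ki Uk] _]; exact: term_ge0.
apply: sumr_ge0 => i /andP[/andP[ii Ui] _]; rewrite Ein.
by apply: sumr_ge0 => k /andP[ki Uk]; exact: term_ge0.
Qed.

End ContactCore.

(** * Consequences of a contact *)

Section Span.
Variable R : realType.
Local Notation C := R[i].
Local Notation Re := (@complex.Re R).
Local Notation Im := (@complex.Im R).
Variable m : nat.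
Local Notation I := 'I_m.+1.
Implicit Types (lam t : R) (f g F G P A B r q : {poly C}) (v w c : C) (z : I -> C) (i j k l : I).

Lemma lagrange_decomp (s : seq I) z r : uniq s -> {in s &, injective z} ->
  (size r <= size s)%N ->
  r = \sum_(k <- s) (r.[z k] / \prod_(j <- s | j != k) (z k - z j)) *:
        \prod_(j <- s | j != k) ('X - (z j)%:P).
Proof.
move=> us zi sr; apply/eqP; rewrite -subr_eq0; apply/eqP.
apply: (@roots_geq_poly_eq0 _ _ (map z s)).
- apply/allP => _ /mapP[k ks ->]; rewrite rootE hornerD hornerN horner_sum.
  rewrite (bigD1_seq k) //= hornerZ horner_prod.
  under [X in _ / _ * X]eq_bigr do rewrite hornerXsubC.
  rewrite divfK; last first.
    rewrite prodf_seq_neq0; apply/allP => j js; apply/implyP => jk.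
    by rewrite subr_eq0; apply: contraNneq jk => /zi ->.
  rewrite big_seq_cond big1 ?addr0 ?subrr // => l /andP[ls lk].
  apply/eqP; rewrite hornerZ horner_prod mulf_eq0 prodf_seq_eq0; apply/orP; right.
  by apply/hasP; exists k => //; rewrite eq_sym lk hornerXsubC subrr eqxx.
- by rewrite map_inj_in_uniq.
- rewrite size_map (leq_trans (size_polyD _ _)) // geq_max sr size_polyN.
  rewrite (leq_trans (size_sum _ _ _)) //; apply/bigmax_leqP_seq => k ks _.
  rewrite (leq_trans (size_scale_leq _ _)) // -big_filter -(big_map z predT (fun x => 'X - x%:P)).
  rewrite size_prod_XsubC size_map size_filter.
  rewrite -(count_predC (fun j => j != k) s) -addn1 leq_add2l.
  by rewrite -has_count; apply/hasP; exists k => //=; rewrite negbK.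
Qed.

Lemma Lam_deg1 N f q G : (size q <= 2)%N -> Lam N f G = 0 -> Lam N f ('X * G) = 0 ->
  Lam N f (q * G) = 0.
Proof.
move=> sq L0 L1; have -> : q = (q`_0)%:P + q`_1 *: 'X.
  apply/polyP => -[|[|k]]; rewrite coefD coefC coefZ coefX /= ?mulr0 ?addr0 ?mulr1 ?add0r //.
  by rewrite nth_default // (leq_trans sq).
by rewrite mulrDl mul_polyC -scalerAl LamD !LamZ L0 L1 !mulr0 addr0.
Qed.

(** The products with one factor of U removed span, together with the whole
product and X times it, all polynomials of the right degree: a contact to which the points of U
do not contribute annihilates every multiple of the remaining product of admissible degree. *)
Lemma inactive_span f eps i0 z (U : pred I) r : sinv m.+1 f eps ->
  (forall i, nsq (z i) = 1) -> {in U &, injective z} -> ~~ U i0 ->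
  Lam m.+2 f (prodX (fun j => j != i0) z) = 0 ->
  (forall k, U k -> Lam m.+2 f (omit2 i0 k z) = 0) ->
  (size r <= #|U|.+2)%N ->
  Lam m.+2 f (r * prodX (fun j => (j != i0) && ~~ U j) z) = 0.
Proof.
move=> sf zu zi Ui0 L0 XU sr; have L1 := contact_X sf zu L0.
pose s := [seq j <- index_enum I | U j].
have us : uniq s by rewrite filter_uniq // index_enum_uniq.
have sU j : (j \in s) = U j by rewrite mem_filter mem_index_enum andbT.
have zs : {in s &, injective z} by move=> i j; rewrite !sU; exact: zi.
have Ps (P : pred I) : \prod_(j <- s | P j) ('X - (z j)%:P) = prodX (fun j => U j && P j) z.
  by rewrite /prodX big_filter_cond.
pose PU := prodX U z.
have mon : PU \is monic.
  by apply: monic_prod => j _; exact: monicXsubC.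
have sPU : size PU = #|U|.+1 by rewrite size_prodX.
have ss : size s = #|U|.
  move: sPU; rewrite /PU /prodX -big_filter -(big_map z predT (fun x => 'X - x%:P)).
  by rewrite size_prod_XsubC size_map => -[].
have PUL : PU * prodX (fun j => (j != i0) && ~~ U j) z = prodX (fun j => j != i0) z.
  rewrite /PU /prodX [RHS](bigID U) /=; congr (_ * _).
  apply: eq_bigl => j; case: (boolP (U j)) => Uj; rewrite ?andbF // andbT.
  by apply/esym; apply: contraTneq Uj => ->.
rewrite (divp_eq r PU) mulrDl -mulrA PUL LamD Lam_deg1 //; last first.
  rewrite size_divp ?monic_neq0 // sPU /=.
  by rewrite leq_subLR addn2.
rewrite add0r (@lagrange_decomp s z (r %% PU)) //; last first.
  by rewrite ss -ltnS -sPU ltn_modp monic_neq0.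
rewrite mulr_suml Lam_sum big_seq big1 // => k; rewrite sU => Uk.
rewrite -scalerAl LamZ Ps (_ : _ * _ = omit2 i0 k z) ?XU ?mulr0 //.
rewrite /omit2 /prodX [RHS](bigID U) /=; congr (_ * _); apply: eq_bigl => j.
  case: (boolP (U j)) => Uj; rewrite ?andbF //= andbT.
  by case: (eqVneq j i0) => //= ji; move: Uj; rewrite ji (negbTE Ui0).
case: (boolP (U j)) => Uj; rewrite ?andbF //= !andbT.
case: (eqVneq j k) => [jk|]; last by rewrite andbT.
by move: Uj; rewrite jk Uk.
Qed.

(** This is what allows a block of points to be turned without losing the contact. *)
Lemma inactive_replace f eps i0 z z' (U : pred I) : sinv m.+1 f eps ->
  (forall i, nsq (z i) = 1) -> {in U &, injective z} -> ~~ U i0 ->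
  Lam m.+2 f (prodX (fun j => j != i0) z) = 0 ->
  (forall k, U k -> Lam m.+2 f (omit2 i0 k z) = 0) ->
  (forall i, i != i0 -> ~~ U i -> z' i = z i) ->
  Lam m.+2 f (prodX (fun j => j != i0) z') = 0.
Proof.
move=> sf zu zi Ui0 L0 XU zz.
have := @inactive_span f eps i0 z U (prodX U z') sf zu zi Ui0 L0 XU.
rewrite size_prodX leqW // => /(_ isT) <-; congr (Lam _ _ _).
rewrite /prodX (bigID U) /=; congr (_ * _).
  apply: eq_bigl => j; case: (boolP (U j)) => Uj; rewrite ?andbF // andbT.
  by apply: contraTneq Uj => ->.
by apply: eq_bigr => j /andP[ji Uj]; rewrite zz.
Qed.

Lemma prodX_rot i0 z v : nsq v = 1 ->
  prodX (fun j => j != i0) z \Po (v *: 'X) =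
    v ^+ m *: prodX (fun j => j != i0) (fun j => z j * v^*).
Proof.
move=> v1; have vv : v * v^* = 1 by rewrite mul_conjE v1.
rewrite /prodX rmorph_prod /=.
have -> : v ^+ m = \prod_(j | j != i0) v.
  by rewrite prodr_const card_neq.
under eq_bigr => j _.
  have -> : ('X - (z j)%:P) \Po (v *: 'X) = v *: ('X - (z j * v^*)%:P).
    rewrite comp_polyB comp_polyX comp_polyC scalerBr; congr (_ - _).
    by rewrite -mul_polyC -polyCM mulrCA vv mulr1.
  over.
by rewrite scaler_prod.
Qed.

Lemma had_rot_gen f i0 z v (x : C) : nsq v = 1 ->
  (had m.+1 f (prodX (fun j => j != i0) z)).[v * x] =
    v ^+ m * (had m.+1 f (prodX (fun j => j != i0) (fun j => z j * v^*))).[x].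
Proof.
move=> v1; rewrite -hornerZ -hadZ -prodX_rot // !hadE.
by apply: eq_bigr => k _; rewrite coef_comp_scale exprMn; ring.
Qed.

(** A zero on the circle is a contact at 1 for a rotated configuration. *)
Lemma had_rot f i0 z v : nsq v = 1 ->
  (had m.+1 f (prodX (fun j => j != i0) z)).[v] =
    v ^+ m * Lam m.+2 f (prodX (fun j => j != i0) (fun j => z j * v^*)).
Proof.
move=> v1; rewrite -[v in LHS]mulr1 had_rot_gen // had_at1.
by rewrite (@Lam_wide _ m.+1 m.+2) ?size_prodX ?card_neq.
Qed.

Lemma spaced_rot lam z c : nsq c = 1 -> spaced lam z -> spaced lam (fun j => z j * c).
Proof.
move=> c1 [zu zs]; split => [j|i j ij]; first by rewrite nsqM zu c1 mulr1.
rewrite (_ : z i * c * (z j * c)^* = z i * (z j)^*) ?zs //.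
by rewrite rmorphM mulrACA mul_conjE c1 mulr1.
Qed.

Lemma strict_spaced_rot lam z c : nsq c = 1 -> strict_spaced lam z -> strict_spaced lam (fun j => z j * c).
Proof.
move=> c1 [zu zs]; split => [j|i j ij]; first by rewrite nsqM zu c1 mulr1.
rewrite (_ : z i * c * (z j * c)^* = z i * (z j)^*) ?zs //.
by rewrite rmorphM mulrACA mul_conjE c1 mulr1.
Qed.

Lemma strict_spaced_inj lam z : strict_spaced lam z -> injective z.
Proof.
move=> [zu zs] i j E; apply/eqP; apply: contraT => /zs.
by rewrite E mul_conjE zu /= ltNge cos_le1.
Qed.

Lemma persist (J : finType) (g : J -> R -> R) (c : R) (P : pred J) :
  (forall a, continuous (g a)) -> (forall a, P a -> g a 0 < c) ->
  exists2 t0 : R, 0 < t0 & forall t, 0 < t -> t <= t0 -> forall a, P a -> g a t <= c.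
Proof.
move=> cg g0.
have H a : exists t0 : R, 0 < t0 /\ (P a -> forall t, 0 < t -> t <= t0 -> g a t <= c).
  case: (boolP (P a)) => Pj; last by exists 1; split => //.
  have /cvgrPdist_lt /(_ (c - g a 0)) := cg a 0.
  rewrite subr_gt0 => /(_ (g0 a Pj)) /nbhs_ballP[e /= e0 He].
  exists (e / 2); split; first by rewrite divr_gt0.
  move=> _ t tp te; have : ball (0 : R) e t.
    rewrite /ball /= sub0r normrN gtr0_norm // (le_lt_trans te) //; lra.
  move=> /He /=; rewrite ltr_distlC => /andP[_ h]; lra.
have [t0 Ht] := choice H.
exists (\big[Num.min/1]_a t0 a).
  by elim/big_ind: _ => // [x y x0 y0|a _]; rewrite ?lt_min ?x0 //; exact: (Ht a).1.
move=> t tp tt a Pj; apply: (Ht a).2 => //; apply: (le_trans tt).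
by rewrite (bigD1 a) //= ge_min lexx.
Qed.

Lemma unit_angles z i0 : (forall i, nsq (z i) = 1) -> injective z ->
  exists phi : I -> R, forall i, i != i0 ->
    z i = z i0 * expi (phi i) /\ 0 < phi i < 2 * pi.
Proof.
move=> zu zi.
have H i : exists p : R, i != i0 -> z i = z i0 * expi p /\ 0 < p < 2 * pi.
  have [->|ii] := eqVneq i i0; first by exists 0.
  have : `|z i * (z i0)^*| = 1 by apply/eqP; rewrite norm1_nsq nsqM nsq_conj !zu mulr1.
  move=> /expi_surj[p /andP[p0 p1] E]; exists p => _.
  have Ez : z i = z i0 * expi p by rewrite -E mulrCA mul_conjE zu mulr1.
  split => //; rewrite p1 andbT lt_neqAle p0 andbT.
  by apply: contraNneq ii => e; apply/eqP/zi; rewrite Ez -e expi0 mulr1.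
by have [phi H'] := choice H; exists phi.
Qed.

Lemma ccont_moved (U : pred I) z i : ccont (fun t => moved U z t i).
Proof.
rewrite /moved; case: (U i); last exact: ccont_cst.
apply: ccontM; first exact: ccont_cst.
by apply: ccont_expi => x; apply: cvgN; exact: cvg_id.
Qed.

Lemma moved_unit (U : pred I) z t i : nsq (z i) = 1 -> nsq (moved U z t i) = 1.
Proof. by move=> zi; rewrite /moved; case: (U i) => //; rewrite nsqM zi nsq_expi mulr1. Qed.

Lemma strict_spaced_moved lam (U : pred I) z : strict_spaced lam z ->
  exists2 t0 : R, 0 < t0 & forall t, 0 < t -> t <= t0 -> spaced lam (moved U z t).
Proof.
move=> [zu zs].
have [|[i j] /= ij|t0 t0p H] := @persist (I * I)%type
   (fun p t => Re (moved U z t p.1 * (moved U z t p.2)^*)) (cos lam) (fun p => p.1 != p.2).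
- move=> [i j] /=; apply: continuous_Re; apply: ccontM; first exact: ccont_moved.
  by apply: ccont_conj; exact: ccont_moved.
- have E k : moved U z 0 k = z k.
    by rewrite /moved oppr0 expi0 mulr1 if_same.
  by rewrite !E zs.
exists t0 => // t tp tt; split => [i|i j ij]; first exact: moved_unit.
exact: (H t tp tt (i, j)).
Qed.

(** In a strictly spaced configuration any block of points can be moved, so
by [contact_core] at most one point k0 besides the contact point contributes.  All the other
factors may be replaced by powers of X, and Lam (X^k (X - z_k0)) = 0 is the recursion
f_(k+1) = z_k0 f_k. *)
Lemma strict_contact lam f eps i0 z : sinv m.+1 f eps -> deleted_zfree m lam f -> f`_0 != 0 ->
  strict_spaced lam z ->
  zfree_closed (had m.+1 f (prodX (fun j => j != i0) z)) \/
  exists2 b, nsq b = 1 & forall k : nat, (k <= m)%N -> f`_k.+1 = b * f`_k.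
Proof.
move=> sf wf f0 sz.
case: (pselect (zfree_closed (had m.+1 f (prodX (fun j => j != i0) z)))) => [|nz]; first by left.
right; have [v v1 Kv] : exists2 v, nsq v = 1 & (had m.+1 f (prodX (fun j => j != i0) z)).[v] = 0.
  apply: contrapT => H; apply: nz => v v1; apply/eqP => Kv.
  have := v1; rewrite le_eqVlt => /orP[/eqP e|/(wf z i0 (strict_spaced_spaced sz))/eqP//].
  by apply: H; exists v.
pose z' j := z j * v^*.
have sz' : strict_spaced lam z' by apply: strict_spaced_rot => //; rewrite nsq_conj.
have L0 : Lam m.+2 f (prodX (fun j => j != i0) z') = 0.
  move: Kv; rewrite had_rot // => /eqP; rewrite mulf_eq0 => /orP[|/eqP//].
  by rewrite expf_eq0 -nsq_eq0 v1 oner_eq0 andbF.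
have zi' := strict_spaced_inj sz'; have [zu' zs'] := sz'.
have [phi Hphi] := unit_angles i0 zu' zi'.
have pair k l : k != i0 -> l != i0 -> phi l < phi k ->
    Lam m.+2 f (omit2 i0 k z') = 0 \/ Lam m.+2 f (omit2 i0 l z') = 0.
  (* The block of all points from k on, in the order of their angles. *)
  move=> ki li lk; pose U j := (j != i0) && (phi k <= phi j).
  have [t0 t0p Ht] := strict_spaced_moved U sz'.
  have [||H|H] := @contact_core R m lam f eps i0 z' U t0 phi sf wf (strict_spaced_spaced sz') _ t0p Ht L0 Hphi.
  - by rewrite /U eqxx.
  - move=> i j /andP[_ h] ji; rewrite /U ji -ltNge /= => h'; exact: lt_le_trans h.
  - by left; apply: H; rewrite /U ki lexx.
  - by right; apply: H => //; rewrite /U li -ltNge.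
have phi_inj k l : k != i0 -> l != i0 -> k != l -> phi k != phi l.
  move=> ki li; apply: contraNneq => e; apply/eqP/zi'.
  by rewrite (Hphi k ki).1 (Hphi l li).1 e.
have [k0 ki0 Hk0] : exists2 k0, k0 != i0 & forall k, k != i0 -> k != k0 ->
    Lam m.+2 f (omit2 i0 k z') = 0.
  case: (pselect (exists2 k0, k0 != i0 & Lam m.+2 f (omit2 i0 k0 z') != 0)).
    move=> [k0 ki0 X0]; exists k0 => // k ki kk.
    have := phi_inj k k0 ki ki0 kk; rewrite neq_lt => /orP[h|h].
      by have [e|//] := pair _ _ ki0 ki h; rewrite e eqxx in X0.
    by have [//|e] := pair _ _ ki ki0 h; rewrite e eqxx in X0.
  move=> nX; have [k0 ki0] : exists k0 : I, k0 != i0.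
    case: (posnP m) => [m0|mp].
      suff : f`_0 = 0 by move/eqP; rewrite (negbTE f0).
      move: L0; rewrite /prodX big_pred0; last first.
        move=> j; apply/negbTE; rewrite negbK; apply/eqP/val_inj => /=.
        by have := ltn_ord j; have := ltn_ord i0; lia.
      rewrite /Lam big_ord_recl coef1 mulr1 big1 ?addr0 // => j _.
      by rewrite coef1 lift0 mulr0.
    have : (0 < #|predC1 i0|)%N by rewrite cardC1 card_ord.
    by move=> /card_gt0P[k0]; rewrite !inE => h; exists k0.
  exists k0 => // k ki _; apply/eqP; apply: contraT => Xk; exfalso; apply: nX; by exists k.
exists (z' k0); first exact: zu'.
move=> k km; pose U j := (j != i0) && (j != k0).
(* All factors except the one of k0 are traded for the monomial of degree k. *)
have := @inactive_span f eps i0 z' U 'X^k sf zu' (in2W zi') _ L0.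
have -> : prodX (fun j => (j != i0) && ~~ U j) z' = 'X - (z' k0)%:P.
  rewrite /prodX (big_pred1 k0) // => j /=; rewrite /U negb_and !negbK.
  by case: (eqVneq j i0) => [->|] //=; rewrite eq_sym (negbTE ki0).
have cU : #|U|.+2 = m.+1.
  have := size_prodX (fun j => j != i0) z'; rewrite card_neq (omit2_split z' ki0).
  rewrite size_Mmonic ?polyXsubC_eq0 ?size_XsubC ?size_prodX //.
  by apply: monic_prod => j _; exact: monicXsubC.
rewrite cU size_polyXn ltnS km /U eqxx /= => /(_ isT) H.
have {}H := H (fun k0 h => Hk0 k0 (proj1 (andP h)) (proj2 (andP h))).
move: (H isT); rewrite mulrC Lam_linfac -exprS => /eqP; rewrite subr_eq0.
have LX (j : nat) : (j <= m.+1)%N -> Lam m.+2 f 'X^j = f`_j.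
  move=> jm; rewrite /Lam (bigD1 (Ordinal (jm : (j < m.+2)%N))) //= coefXn eqxx mulr1.
  rewrite big1 ?addr0 // => i ij; rewrite coefXn.
  by rewrite (_ : (i == j :> nat) = false) ?mulr0 //; apply: negbTE; rewrite -(inj_eq val_inj) in ij.
by rewrite !LX // ?ltnS ?(leq_trans km) // => /eqP.
Qed.

End Span.

(** * Closing the gaps of a configuration *)

Section Blocks.
Variable R : realType.
Local Notation C := R[i].
Local Notation Re := (@complex.Re R).
Local Notation Im := (@complex.Im R).
Implicit Types (lam t : R) (f g F G P A B r q : {poly C}) (v w c : C).

Lemma cos_sep lam (x : R) : 0 <= lam -> lam <= x -> x <= 2 * pi - lam -> cos x <= cos lam.
Proof.
move=> l0 lx xl; have lpi : lam <= pi by lra.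
have [xpi|xpi] := lerP x pi.
  by rewrite leNgt ltr_cos ?in_itv /= ?l0 ?lpi ?xpi ?andbT -?leNgt ?(le_trans l0 lx).
have -> : cos x = cos (2 * pi - x).
  rewrite cosB (_ : 2 * pi = pi *+ 2) ?cos2pi ?sin2pi; last by rewrite mulr2n; ring.
  by rewrite mul1r mul0r addr0.
rewrite leNgt ltr_cos ?in_itv /= -?leNgt; try (apply/andP; split); lra.
Qed.

Section Arcs.
Variable m : nat.
Local Notation I := 'I_m.+1.
Implicit Types (z : I -> C) (i j k l : I) (phi : nat -> R).

Definition arcz w phi i : C := w * expi (phi i).

(** Angles listed in increasing order from 0, with all gaps of the closed
circle at least lam. *)
Definition valid lam phi :=
  [/\ phi 0%N = 0, forall i : nat, (i < m)%N -> phi i + lam <= phi i.+1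
    & phi m <= 2 * pi - lam].

Lemma valid_lt lam phi (i j : nat) : 0 <= lam -> valid lam phi ->
  (i < j)%N -> (j <= m)%N -> phi i + lam <= phi j.
Proof.
move=> l0 [_ vg _]; elim: j => // j IH; rewrite ltnS leq_eqVlt => /orP[/eqP ->|ij] jm.
  exact: vg.
apply: le_trans (IH ij (ltnW jm)) _; have := vg j jm; lra.
Qed.

Lemma valid_le lam phi (i j : nat) : 0 <= lam -> valid lam phi ->
  (i <= j)%N -> (j <= m)%N -> phi i <= phi j.
Proof.
move=> l0 v; rewrite leq_eqVlt => /orP[/eqP -> //|ij jm].
have := valid_lt l0 v ij jm; lra.
Qed.

Lemma arcz_Re w phi i j : nsq w = 1 ->
  Re (arcz w phi i * (arcz w phi j)^*) = cos (phi i - phi j).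
Proof.
move=> w1; rewrite /arcz; set a := phi i; set b := phi j.
have -> : w * expi a * (w * expi b)^* = (w * w^*) * (expi a * (expi b)^*).
  by rewrite rmorphM /=; ring.
by rewrite mul_conjE w1 mul1r conj_expi -expiD.
Qed.

Lemma valid_spaced lam phi w : 0 <= lam -> nsq w = 1 -> valid lam phi ->
  spaced lam (arcz w phi).
Proof.
move=> l0 w1 v; split => [i|i j ij]; first by rewrite nsqM nsq_expi w1 mulr1.
rewrite arcz_Re //.
have H (a b : nat) : (a < b)%N -> (b <= m)%N -> cos (phi b - phi a) <= cos lam.
  move=> ab bm; have h := valid_lt l0 v ab bm.
  have h1 := valid_le l0 v bm (leqnn m).
  have h2 := valid_le l0 v (leq0n a) (ltnW (leq_trans ab bm)).
  by have [v0 _ vm] := v; apply: cos_sep => //; lra.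
have : (i : nat) != j by rewrite (inj_eq val_inj).
rewrite neq_ltn => /orP[h|h].
  by rewrite -cosN opprB H // -ltnS.
by rewrite H // -ltnS.
Qed.

(** The points above the gap are turned back until the gap has length lam.  By
[contact_core] either these points do not contribute to the contact and may be turned
back, or the points between the contact point and the gap do not contribute and
may be turned forward. *)
Lemma close_gap lam f eps w phi (g : nat) : 0 < lam -> nsq w = 1 ->
  sinv m.+1 f eps -> deleted_zfree m lam f -> valid lam phi -> (0 < g)%N -> (g < m)%N ->
  Lam m.+2 f (prodX (fun j => j != ord0) (arcz w phi)) = 0 ->
  exists2 phi', valid lam phi' &
  [/\ Lam m.+2 f (prodX (fun j => j != ord0) (arcz w phi')) = 0,
      phi' g.+1 = phi' g + lam
    & forall i : nat, (0 < i)%N -> (i < m)%N -> i != g ->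
        phi' i.+1 - phi' i = phi i.+1 - phi i].
Proof.
move=> l0 w1 sf wf v g0 gm L0.
have l0' := ltW l0.
set s := phi g.+1 - phi g - lam.
have s0 : 0 <= s by have [_ vg _] := v; have := vg g gm; rewrite /s; lra.
have [se|sp] := eqVneq s 0.
  by exists phi => //; split => //; move: se; rewrite /s; lra.
have {}sp : 0 < s by rewrite lt_neqAle eq_sym sp.
pose U (i : I) := (g < i)%N.
have vU t : 0 < t -> t <= s -> valid lam (fun i : nat => if (g < i)%N then phi i - t else phi i).
  move=> t0 ts; have [v0 vg vm] := v; split => //.
  - move=> i im; have := vg i im.
    have [gi|gi] := ltnP g i; first by rewrite ltnW //; lra.
    rewrite ltnS leq_eqVlt ltnNge gi orbF; case: eqP => [e|_] // _.
    by move: ts; rewrite /s e; lra.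
  - by rewrite gm; lra.
have zU t i : moved U (arcz w phi) t i = arcz w (fun i : nat => if (g < i)%N then phi i - t else phi i) i.
  by rewrite /moved /arcz /U; case: ifP => // _; rewrite expiD mulrA.
have sep t : 0 < t -> t <= s -> spaced lam (moved U (arcz w phi) t).
  by move=> t0 ts; rewrite (funext (zU t)); apply: valid_spaced => //; exact: vU.
have sz := valid_spaced l0' w1 v.
have z0 : arcz w phi ord0 = w by rewrite /arcz; have [-> _ _] := v; rewrite expi0 mulr1.
have zphi i : i != ord0 ->
    arcz w phi i = arcz w phi ord0 * expi (phi i) /\ 0 < phi i < 2 * pi.
  move=> i0; rewrite z0; split => //.
  have ip : (0 < i)%N by rewrite lt0n; apply: contraNneq i0 => e; apply/eqP/val_inj.
  have im : (i <= m)%N by rewrite -ltnS.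
  have h1 := valid_lt l0' v ip im; have h2 := valid_le l0' v im (leqnn m).
  have [v0 _ vm] := v; apply/andP; split; lra.
have zinj : injective (arcz w phi).
  move=> i j e; apply/eqP; apply: contraT => ij; have [zu zs] := sz.
  have := zs i j ij; rewrite e mul_conjE zu /=.
  have lpi : lam < 2 * pi.
    have := valid_le l0' v (leq0n m) (leqnn m); have [v0 _ vm] := v.
    have := valid_lt l0' v (leq_trans g0 (ltnW gm) : (0 < m)%N) (leqnn m).
    by rewrite v0; have := pi_gt0 R; lra.
  have lpi' : lam <= pi.
    have := valid_lt l0' v (leq_trans g0 (ltnW gm) : (0 < m)%N) (leqnn m).
    by have [v0 _ vm] := v; rewrite v0; lra.
  rewrite leNgt -[X in _ < X](cos0 R) ltr_cos ?in_itv /= ?lexx ?pi_ge0 ?l0' ?lpi' // l0 //.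
have [zu _] := sz.
have [|u l gu l0i|H|H] := @contact_core R m lam f eps ord0 (arcz w phi) U s (fun i => phi i) sf wf sz _ sp sep L0 zphi.
- by rewrite /U.
- rewrite /U -leqNgt => lg.
  have := valid_lt l0' v (leq_ltn_trans lg gu) (ltnSE (ltn_ord u)); lra.
- exists (fun i : nat => if (g < i)%N then phi i - s else phi i); first exact: vU.
  split => [||i i0 im ig].
  + apply: (@inactive_replace R m f eps ord0 (arcz w phi) _ U) => //.
    * exact: in2W.
    * by move=> i _; rewrite /U /arcz => /negbTE ->.
  + by rewrite ltnSn ltnn /s; lra.
  + have [gi|gi] := ltnP g i; first by rewrite ltnW //; ring.
    by rewrite ltnNge ltn_neqAle ig gi.
- exists (fun i : nat => if (0 < i <= g)%N then phi i + s else phi i).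
    have [v0 vg vm] := v; split => //=.
    + move=> i im; have := vg i im; have [ig|ig] := ltnP i g.
        rewrite (ltnW ig) andbT; case: ifP => _; lra.
      case: ifP => [/andP[_ gi]|_]; last lra.
      have -> : i = g by lia.
      by rewrite /s; lra.
    + by rewrite (_ : (0 < m <= g)%N = false) //; lia.
  split => [||i i0 im ig].
  + apply: (@inactive_replace R m f eps ord0 (arcz w phi) _ (fun i => (i != ord0) && ~~ U i)) => //.
    * exact: in2W.
    * by move=> k /andP[]; exact: H.
    * move=> i i0; rewrite i0 /= negbK /U /arcz => gi.
      by rewrite [(i <= g)%N]leqNgt gi andbF.
  + rewrite (_ : (0 < g.+1 <= g)%N = false); last lia.
    by rewrite (_ : (0 < g <= g)%N = true) /s; [lra|lia].
  + have [h|h] : (i < g)%N \/ (g <= i)%N by lia.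
      rewrite (_ : (0 < i.+1 <= g)%N = true); last lia.
      by rewrite (_ : (0 < i <= g)%N = true); [ring|lia].
    rewrite (_ : (0 < i.+1 <= g)%N = false); last lia.
    by rewrite (_ : (0 < i <= g)%N = false); last lia.
Qed.

Lemma close_gaps lam f eps w phi : 0 < lam -> nsq w = 1 ->
  sinv m.+1 f eps -> deleted_zfree m lam f -> valid lam phi ->
  Lam m.+2 f (prodX (fun j => j != ord0) (arcz w phi)) = 0 ->
  exists2 phi', Lam m.+2 f (prodX (fun j => j != ord0) (arcz w phi')) = 0 &
   forall i : nat, (0 < i)%N -> (i < m)%N -> phi' i.+1 = phi' i + lam.
Proof.
move=> l0 w1 sf wf v L0.
have H (j : nat) : exists2 phi', valid lam phi' &
   Lam m.+2 f (prodX (fun j => j != ord0) (arcz w phi')) = 0 /\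
   forall i : nat, (0 < i)%N -> (i < m)%N -> (i <= j)%N -> phi' i.+1 = phi' i + lam.
  elim: j => [|j [phi' v' [L' g']]]; first by exists phi => //; split => // -[].
  have [jm|jm] := ltnP j.+1 m; last first.
    by exists phi' => //; split => // i i0 im _; apply: g' => //; rewrite -ltnS (leq_trans im).
  have [phi2 v2 [L2 g2 h2]] := close_gap l0 w1 sf wf v' (ltn0Sn j) jm L'.
  exists phi2 => //; split => // i i0 im; rewrite leq_eqVlt => /orP[/eqP -> //|ij].
  have := h2 i i0 im; rewrite (ltn_eqF ij) => /(_ isT); rewrite (g' i i0 im ij); lra.
have [phi' _ [L' g']] := H m; exists phi' => // i i0 im; exact: g' (ltnW im).
Qed.

Lemma prodX_lift z : prodX (fun j => j != ord0) z = \prod_(j < m) ('X - (z (lift ord0 j))%:P).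
Proof. by rewrite /prodX big_mkcond big_ord_recl /= mul1r; apply: eq_bigr. Qed.

End Arcs.

(** Points in arithmetic progression of step lam are, up to rotation, the
roots of Qpoly m lam. *)
Lemma block_Qpoly m lam c : nsq c = 1 -> exists v a, [/\ nsq v = 1, a != 0 &
  \prod_(j < m) ('X - (c * expi (j%:R * lam))%:P) = a *: (Qpoly m lam \Po (v *: 'X))].
Proof.
move=> c1; set v := - (c * expi ((m%:R - 1) * lam / 2))^*.
have v1 : nsq v = 1 by rewrite nsqN nsq_conj nsqM c1 nsq_expi mulr1.
have v0 : v != 0 by rewrite -nsq_gt0 v1.
pose e (j : 'I_m) : C := expi ((2 * j.+1%:R - m%:R - 1) * lam / 2).
have a0 : \prod_(j < m) (e j * v) != 0.
  by apply/prodf_neq0 => j _; rewrite mulf_neq0 // expi_neq0.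
exists v, (\prod_(j < m) (e j * v))^-1; split; rewrite ?invr_eq0 //.
apply: (scalerI a0); rewrite scalerA divff // scale1r.
rewrite [X in _ *: X](reindex_inj rev_ord_inj) /= -scaler_prod /Qpoly rmorph_prod /=.
under [RHS]eq_bigr => j _ do rewrite rmorphD rmorph1 /= comp_polyZ comp_polyX scalerA -/(e j).
have E (j : 'I_m) : (e j * v) *: ('X - (c * expi ((m - j.+1)%:R * lam))%:P) = 1 + (e j * v) *: 'X.
  rewrite scalerBr addrC; congr (_ + _); rewrite -mul_polyC -polyCM -polyCN.
  have -> : - (e j * v * (c * expi ((m - j.+1)%:R * lam))) = c * c^* *
     (e j * (expi (- ((m%:R - 1) * lam / 2)) * expi ((m - j.+1)%:R * lam))).
    by rewrite /v rmorphM /= conj_expi; ring.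
  rewrite mul_conjE c1 mul1r /e -!expiD natrB ?ltn_ord //.
  set x := (X in expi X); have -> : x = 0 by rewrite /x -natr1; field.
  by rewrite expi0.
by under eq_bigr => j _ do rewrite E.
Qed.

(** Once all the gaps are closed, the product over the other points is a
rotation of Qpoly, and the contact says that the kernel of f vanishes. *)
Lemma contact_extremal m lam f eps w (phi : nat -> R) : 0 < lam -> nsq w = 1 ->
  sinv m.+1 f eps -> deleted_zfree m lam f -> valid m lam phi -> f`_0 != 0 ->
  Lam m.+2 f (prodX (fun j : 'I_m.+1 => j != ord0) (arcz w phi)) = 0 ->
  exists2 v, nsq v = 1 & (weighted m lam f).[v] = 0.
Proof.
move=> l0 w1 sf wf v f0 L0.
have [phi' L' g'] := close_gaps l0 w1 sf wf v L0.
have c1 : nsq (w * expi (phi' 1%N)) = 1 by rewrite nsqM w1 nsq_expi mulr1.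
have [u [a [u1 a0 E]]] := block_Qpoly m lam c1.
exists u => //.
have Eg (j : nat) : (j < m)%N -> phi' j.+1 = phi' 1%N + j%:R * lam.
  elim: j => [|j IH] jm; first by rewrite mul0r addr0.
  by rewrite g' // (IH (ltnW jm)) -natr1; ring.
have EP : prodX (fun j : 'I_m.+1 => j != ord0) (arcz w phi') =
    a *: (Qpoly m lam \Po (u *: 'X)).
  rewrite prodX_lift -E; apply: eq_bigr => j _; rewrite /arcz lift0 Eg // expiD.
  by rewrite mulrA.
move: L'; rewrite EP LamZ => /eqP; rewrite mulf_eq0 (negbTE a0) /= => /eqP L'.
rewrite weighted_had hadE -[RHS]L' (@Lam_wide _ m.+1) //; last first.
  by rewrite size_comp_poly2 ?size_Qpoly_leq // size_scale ?size_polyX // -nsq_gt0 u1.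
by apply: eq_bigr => k _; rewrite coef_comp_scale; rewrite /= mulrAC mulrA.
Qed.

End Blocks.

(** * Configurations listed by angle *)

Section Sorting.
Variable R : realType.
Local Notation C := R[i].
Local Notation Re := (@complex.Re R).
Local Notation Im := (@complex.Im R).
Variable m : nat.
Local Notation I := 'I_m.+1.
Implicit Types (lam t s : R) (f g F G P A B r q : {poly C}) (v w c : C) (z : I -> C) (i j k : I) (phi : nat -> R).

Lemma cos_sep_inv lam (x : R) : 0 <= lam -> lam <= pi -> 0 <= x -> x < 2 * pi ->
  cos x <= cos lam -> lam <= x /\ x <= 2 * pi - lam.
Proof.
move=> l0 lpi x0 x2 h; split; rewrite leNgt; apply/negP => hx.
  move: h; rewrite leNgt ltr_cos ?in_itv /= ?l0 ?lpi ?x0 ?hx //.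
  by rewrite (le_trans (ltW hx)).
move: h; have -> : cos x = cos (2 * pi - x).
  rewrite cosB (_ : 2 * pi = pi *+ 2) ?cos2pi ?sin2pi; last by rewrite mulr2n; ring.
  by rewrite mul1r mul0r addr0.
rewrite leNgt ltr_cos ?in_itv /= ?l0 ?lpi //; last by apply/andP; split; lra.
rewrite (_ : 2 * pi - x < lam) //; lra.
Qed.

Lemma sort_config lam z i0 : 0 <= lam -> m.+1%:R * lam < 2 * pi -> spaced lam z ->
  exists phi (sigma : I -> I), [/\ injective sigma, sigma ord0 = i0, valid m lam phi
   & forall j, z (sigma j) = arcz (z i0) phi j].
Proof.
move=> l0 ml [zu zs].
have lam2 : lam <= 2 * pi.
  by apply: le_trans (ltW ml); rewrite ler_peMl // ler1n.
have H i : exists p : R, z i = z i0 * expi p /\ 0 <= p < 2 * pi.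
  have : `|z i * (z i0)^*| = 1 by apply/eqP; rewrite norm1_nsq nsqM nsq_conj !zu mulr1.
  move=> /expi_surj[p p01 E]; exists p; split => //.
  by rewrite -E mulrCA mul_conjE zu mulr1.
have [psi Hpsi] := choice H.
have lpi i j : i != j -> lam <= pi.
  move=> ij; have : (2 <= m.+1)%N.
    by rewrite ltnS lt0n; apply: contraNneq ij => m0; apply/eqP/val_inj => /=; have := ltn_ord i; have := ltn_ord j; lia.
  rewrite -(ler_nat R) => h; have : 2 * lam <= m.+1%:R * lam by rewrite ler_wpM2r.
  lra.
have psep i j : i != j -> lam <= `|psi i - psi j|.
  move=> ij; have := zs i j ij; have [-> /andP[i1 i2]] := Hpsi i.
  have [-> /andP[j1 j2]] := Hpsi j.
  have -> : z i0 * expi (psi i) * (z i0 * expi (psi j))^* =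
     (z i0 * (z i0)^*) * (expi (psi i) * (expi (psi j))^*).
    by rewrite rmorphM /=; ring.
  rewrite mul_conjE zu mul1r conj_expi -expiD /= -cos_norm => h.
  have := @cos_sep_inv lam `|psi i - psi j| l0 (lpi i j ij) (normr_ge0 _) _ h.
  case => //; rewrite ltr_norml; apply/andP; split; lra.
have psep0 i : i != i0 -> lam <= psi i /\ psi i <= 2 * pi - lam.
  move=> ii; have := zs i i0 ii; have [-> /andP[p0 p1]] := Hpsi i.
  rewrite mulrAC mul_conjE zu mul1r /= => h.
  exact: cos_sep_inv (lpi _ _ ii) p0 p1 h.
pose leI : rel I := fun i j => psi i <= psi j.
pose ls : seq I := sort leI [seq i <- index_enum I | i != i0].
have tot : total leI by move=> i j; exact: le_total.
have us : uniq ls by rewrite sort_uniq filter_uniq // index_enum_uniq.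
have ms i : (i \in ls) = (i != i0) by rewrite mem_sort mem_filter mem_index_enum andbT.
have ss : size ls = m.
  rewrite size_sort; have := size_prodX (fun j => j != i0) z; rewrite card_neq.
  rewrite /prodX -big_filter -(big_map z predT (fun x => 'X - x%:P)) size_prod_XsubC.
  by rewrite size_map => -[].
pose sigma (j : I) := nth i0 (i0 :: ls) j.
pose phi (j : nat) := if j is j'.+1 then psi (nth i0 ls j') else 0.
have uis : uniq (i0 :: ls) by rewrite /= us ms eqxx.
have nthi0 (j : nat) : (j < m)%N -> nth i0 ls j != i0.
  by move=> jm; rewrite -ms mem_nth // ss.
have sor : sorted leI ls by exact: sort_sorted.
exists phi, sigma; split => //.
- move=> i j /eqP; rewrite /sigma nth_uniq //= ?ss // => /eqP; exact: val_inj.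
- split => //.
  + case=> [|j] jm /=; first by rewrite add0r (psep0 _ (nthi0 _ jm)).1.
    have h1 : psi (nth i0 ls j) <= psi (nth i0 ls j.+1).
      by move/(sortedP i0): sor => /(_ j); rewrite ss; apply.
    have h2 : nth i0 ls j != nth i0 ls j.+1.
      by rewrite nth_uniq ?ss // ?ltn_eqF // ltnW.
    have := psep _ _ h2; rewrite distrC ger0_norm ?subr_ge0 //; lra.
  + case: (posnP m) => [m0|mp]; first by rewrite (_ : phi m = 0) ?subr_ge0 // m0.
    have phiS (j : nat) : (0 < j)%N -> phi j = psi (nth i0 ls j.-1) by case: j.
    by rewrite (phiS m mp) (psep0 _ (nthi0 _ _)).2 // prednK.
- move=> j; rewrite /arcz /sigma; case: j => -[|j] jm /=; first by rewrite expi0 mulr1.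
  by rewrite (Hpsi _).1.
Qed.

Definition svalid lam phi :=
  [/\ phi 0%N = 0, forall i : nat, (i < m)%N -> phi i + lam < phi i.+1
    & phi m < 2 * pi - lam].

Lemma svalid_valid lam phi : svalid lam phi -> valid m lam phi.
Proof. by move=> [v0 vg vm]; split => [//|i im|]; [exact/ltW/vg|exact/ltW]. Qed.

Lemma valid_svalid lam lam' phi : lam < lam' -> valid m lam' phi -> svalid lam phi.
Proof.
move=> ll [v0 vg vm]; split => [//|i im|]; last by apply: le_lt_trans vm _; lra.
by apply: lt_le_trans (vg i im); lra.
Qed.

Lemma cos_lt_sep lam (x : R) : 0 <= lam -> lam < x -> x < 2 * pi - lam -> cos x < cos lam.
Proof.
move=> l0 lx xl; have [xpi|xpi] := lerP x pi.
  by rewrite ltr_cos ?in_itv /= ?l0 ?xpi ?andbT ?(le_trans l0 (ltW lx)) ?(le_trans (ltW lx)).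
have -> : cos x = cos (2 * pi - x).
  rewrite cosB (_ : 2 * pi = pi *+ 2) ?cos2pi ?sin2pi; last by rewrite mulr2n; ring.
  by rewrite mul1r mul0r addr0.
rewrite ltr_cos ?in_itv /=; try (apply/andP; split); lra.
Qed.

Lemma svalid_strict_spaced lam phi w : 0 <= lam -> nsq w = 1 -> svalid lam phi ->
  strict_spaced lam (arcz w phi : I -> C).
Proof.
move=> l0 w1 sv; have v := svalid_valid sv.
split => [i|i j ij]; first by rewrite nsqM nsq_expi w1 mulr1.
rewrite arcz_Re //.
have H (a b : nat) : (a < b)%N -> (b <= m)%N -> cos (phi b - phi a) < cos lam.
  move=> ab bm; have [v0 vg vm] := sv.
  have h : phi a + lam < phi b.
    by apply: lt_le_trans (vg a (leq_trans ab bm)) _; exact: valid_le l0 v ab bm.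
  have h1 := valid_le l0 v bm (leqnn m).
  have h2 := valid_le l0 v (leq0n a) (ltnW (leq_trans ab bm)).
  by apply: cos_lt_sep => //; lra.
have : (i : nat) != j by rewrite (inj_eq val_inj).
rewrite neq_ltn => /orP[h|h].
  by rewrite -cosN opprB H // -ltnS.
by rewrite H // -ltnS.
Qed.

Lemma prodX_perm z z' (sigma : I -> I) i0 : injective sigma ->
  (forall j, z (sigma j) = z' j) ->
  prodX (fun j => j != sigma i0) z = prodX (fun j => j != i0) z'.
Proof.
move=> si E; rewrite /prodX (reindex_inj si) /=.
by apply: eq_big => j; [rewrite (inj_eq si)|rewrite E].
Qed.

Lemma prodX_permT z z' (sigma : I -> I) : injective sigma ->
  (forall j, z (sigma j) = z' j) -> prodX predT z = prodX predT z'.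
Proof. by move=> si E; rewrite /prodX (reindex_inj si) /=; apply: eq_bigr => j; rewrite E. Qed.

Definition spread phi s (i : nat) : R := (1 - s) * phi i + s * (2 * pi / m.+1%:R * i%:R).

Lemma spread_valid lam phi s : valid m lam phi -> 0 <= s -> s <= 1 ->
  valid m (lam + s * (2 * pi / m.+1%:R - lam)) (spread phi s).
Proof.
move=> [v0 vg vm] s0 s1; rewrite /spread; split.
- by rewrite v0 !mulr0 addr0.
- move=> i im; have := vg i im; rewrite -[i.+1%:R]natr1; move: (2 * pi / _) => q h.
  have : (1 - s) * (phi i + lam) <= (1 - s) * phi i.+1 by rewrite ler_wpM2l // subr_ge0.
  by lra.
- have e : 2 * pi / m.+1%:R * m%:R = 2 * pi - 2 * pi / m.+1%:R :> R.
    by rewrite -[X in _ / X]natr1; field; rewrite natr1 pnatr_eq0.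
  have : (1 - s) * phi m <= (1 - s) * (2 * pi - lam) by rewrite ler_wpM2l // subr_ge0.
  by rewrite e; move: (2 * pi / m.+1%:R) => q; lra.
Qed.

Lemma spread_svalid lam phi s : m.+1%:R * lam < 2 * pi -> svalid lam phi ->
  0 <= s -> s <= 1 -> svalid lam (spread phi s).
Proof.
move=> ml sv s0 s1.
have q0 : lam < 2 * pi / m.+1%:R by rewrite ltr_pdivlMr ?ltr0n // mulrC.
have [->|sp] := eqVneq s 0.
  have E : spread phi 0 = phi by apply/funext => i; rewrite /spread; ring.
  by rewrite E.
apply: valid_svalid (spread_valid (svalid_valid sv) s0 s1).
by rewrite ltrDl mulr_gt0 ?subr_gt0 // lt_neqAle eq_sym sp.
Qed.

Lemma ccont_spread phi w i : ccont (fun s => arcz w (spread phi s) i).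
Proof.
apply: ccontM; first exact: ccont_cst.
apply: ccont_expi => x; rewrite /spread; apply: cvgD; apply: cvgM; try exact: cvg_cst.
- by apply: cvgB; [exact: cvg_cst|exact: cvg_id].
- exact: cvg_id.
Qed.

Definition pre lam F : {poly C} := \poly_(k < m.+2) (F`_k / Qcoef m.+1 lam k).

Lemma coef_pre lam F (k : nat) : (k <= m.+1)%N -> (pre lam F)`_k = F`_k / Qcoef m.+1 lam k.
Proof. by move=> km; rewrite coef_poly ltnS km. Qed.
End Sorting.

(** * Pre-coefficients and the two halves of a polynomial *)

Section Precoef.
Variable R : realType.
Local Notation C := R[i].
Local Notation Re := (@complex.Re R).
Local Notation Im := (@complex.Im R).
Variable m : nat.
Local Notation I := 'I_m.+1.
Implicit Types (lam t s : R) (f g F G P A B r q : {poly C}) (u v w c : C) (z : I -> C) (i j : I) (phi : nat -> R).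

Lemma weighted_pre lam F : 0 <= lam -> m.+1%:R * lam < 2 * pi -> (size F <= m.+2)%N ->
  weighted m.+1 lam (pre m lam F) = F.
Proof.
move=> l0 ml sF; apply/polyP => k; rewrite coef_poly.
have [km|km] := ltnP k m.+2; last by rewrite nth_default // (leq_trans sF).
by rewrite coef_pre // mulrCA divff ?mulr1 // Qcoef_neq0.
Qed.

Lemma pre_sinv lam F c : 0 <= lam -> m.+1%:R * lam < 2 * pi -> nsq c = 1 ->
  n_inverse m.+1 F = c *: F -> sinv m.+1 (pre m lam F) c.
Proof.
move=> l0 ml c1 E; split => // k km.
rewrite !coef_pre ?leq_subr // fmorph_div /= Qcoef_conj // Qcoef_sym // mulrA; congr (_ / _).
have : (n_inverse m.+1 F)`_k = (c *: F)`_k by rewrite E.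
by rewrite coef_inv ltnS km coefZ.
Qed.

(** The q-Pascal rule, read on coefficients. *)
Lemma weighted_minus lam f u :
  (weighted m.+1 lam f).[expi (- (lam / 2)) * u] =
  (weighted m lam f).[u] + expi (- (m.+1%:R * lam / 2)) * (u * (weighted m lam (shiftc f)).[u]).
Proof.
rewrite !horner_poly [LHS]big_ord_recl [in RHS](_ : \sum_(i < m.+1) _ * u ^+ i =
   \sum_(k < m.+2) Qcoef m lam k * f`_k * u ^+ k); last first.
  by rewrite [RHS]big_ord_recr /= Qcoef_default // !mul0r addr0.
rewrite [in RHS]big_ord_recl !Qcoef0 !expr0 -addrA; congr (_ + _).
rewrite !mulr_sumr -big_split; apply: eq_bigr => k _; rewrite ?lift0 /= ?add1n coef_shiftc.
have := Qcoef_pascal m lam k; rewrite exprMn expiX => H.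
transitivity ((expi (- (k.+1%:R * lam / 2)) * Qcoef m.+1 lam k.+1) * (f`_k.+1 * u ^+ k.+1)).
  rewrite (_ : k.+1%:R * - (lam / 2) = - (k.+1%:R * lam / 2)); last by ring.
  by ring.
by rewrite H exprS; ring.
Qed.

Lemma weighted_plus lam f u :
  (weighted m.+1 lam f).[expi (lam / 2) * u] =
  (weighted m lam f).[u] + expi (m.+1%:R * lam / 2) * (u * (weighted m lam (shiftc f)).[u]).
Proof.
rewrite !horner_poly [LHS]big_ord_recl [in RHS](_ : \sum_(i < m.+1) _ * u ^+ i =
   \sum_(k < m.+2) Qcoef m lam k * f`_k * u ^+ k); last first.
  by rewrite [RHS]big_ord_recr /= Qcoef_default // !mul0r addr0.
rewrite [in RHS]big_ord_recl !Qcoef0 !expr0 -addrA; congr (_ + _).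
rewrite !mulr_sumr -big_split; apply: eq_bigr => k _; rewrite ?lift0 /= ?add1n coef_shiftc.
have := Qcoef_pascal' m lam k; rewrite exprMn expiX => H.
transitivity ((expi (k.+1%:R * lam / 2) * Qcoef m.+1 lam k.+1) * (f`_k.+1 * u ^+ k.+1)).
  rewrite (_ : k.+1%:R * (lam / 2) = (k.+1%:R * lam / 2)); last by ring.
  by ring.
by rewrite H exprS; ring.
Qed.

Lemma inv_Qpoly lam : 0 <= lam -> m%:R * lam < 2 * pi ->
  n_inverse m (Qpoly m lam) = 1 *: Qpoly m lam.
Proof.
move=> l0 ml; apply/polyP => k; rewrite coef_inv coefZ mul1r -/(Qcoef m lam k) -/(Qcoef m lam _).
have [km|km] := ltnP k m.+1; last by rewrite Qcoef_default.
by rewrite Qcoef_conj // Qcoef_sym.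
Qed.

Lemma ml_le lam : 0 <= lam -> m.+1%:R * lam < 2 * pi -> m%:R * lam < 2 * pi.
Proof. by move=> l0; apply: le_lt_trans; rewrite ler_wpM2r // ler_nat. Qed.

Lemma inv_weighted lam f eps : 0 <= lam -> m%:R * lam < 2 * pi -> sinv m.+1 f eps ->
  n_inverse m (weighted m lam f) = eps *: weighted m lam (shiftc f).
Proof.
by move=> l0 ml sf; rewrite !weighted_had (inv_had_sinv sf (inv_Qpoly l0 ml)) mulr1.
Qed.

(** At lam = 0 the kernel is the polar derivative F - z F'/n. *)
Lemma weighted0_deriv f u : m.+1%:R * (weighted m (0 : R) f).[u] =
  m.+1%:R * (weighted m.+1 (0 : R) f).[u] - u * (weighted m.+1 (0 : R) f)^`().[u].
Proof.
have -> : u * (weighted m.+1 (0 : R) f)^`().[u] =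
   \sum_(k < m.+2) k%:R * ('C(m.+1, k)%:R * f`_k) * u ^+ k.
  have sQ' : (size (weighted m.+1 (0 : R) f)^`() <= m.+1)%N.
    by rewrite (leq_trans (size_poly _ _)) // -subn1 leq_subLR add1n size_weighted.
  rewrite (horner_coef_wide _ sQ') [RHS]big_ord_recl !mul0r add0r mulr_sumr.
  apply: eq_bigr => k _; rewrite lift0 coef_deriv coef_poly ltnS ltn_ord Qcoef_lam0.
  by rewrite exprS -[_ *+ k.+1]mulr_natl; ring.
rewrite !horner_poly !mulr_sumr -sumrB [RHS]big_ord_recr /= !Qcoef_lam0 binn !mul1r.
rewrite !mulrA subrr addr0; apply: eq_bigr => k _; rewrite !Qcoef_lam0 !mulrA -!mulrBl.
congr (_ * _ * _); have km : (k <= m)%N by rewrite -ltnS.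
have : (m.+1 * 'C(m, k) = (m.+1 - k) * 'C(m.+1, k))%N.
  exact: mul_bin_down m.+1 k.
move=> /(congr1 (fun x => x%:R : C)); rewrite !natrM => ->.
by rewrite natrB ?(leq_trans km) // mulrBl.
Qed.

End Precoef.

(** * Deformation to the regular polygon *)

Section Homotopy.
Variable R : realType.
Local Notation C := R[i].
Local Notation Re := (@complex.Re R).
Local Notation Im := (@complex.Im R).
Variable m : nat.
Local Notation I := 'I_m.+1.
Implicit Types (lam t s : R) (f g F G P A B r q : {poly C}) (u v w c : C) (z : I -> C) (i j : I) (phi : nat -> R).

Lemma root_prodX z u : (prodX predT z).[u] = 0 -> exists i, u = z i.
Proof.
move=> /eqP; rewrite -rootE /prodX -(big_map z predT (fun x => 'X - x%:P)) root_prod_XsubC.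
by move=> /mapP[i _ ->]; exists i.
Qed.

Lemma inv_prodXT z : (forall i, nsq (z i) = 1) ->
  exists2 c, nsq c = 1 & n_inverse m.+1 (prodX predT z) = c *: prodX predT z.
Proof.
move=> zu; apply: inv_prod_unit => //.
have := size_prodX predT z; rewrite /prodX -big_filter -(big_map z predT (fun x => 'X - x%:P)).
by rewrite size_prod_XsubC size_map card_ord => -[].
Qed.

(** If the kernel vanishes at a point u of the circle, so does its other half
by self-inversiveness; then exp(i lam/2) u and exp(-i lam/2) u are both zeros of F, and
for lam = 0 the point u is a double zero.  Strict spacing excludes this. *)
Lemma strict_nonvanish lam z u : 0 <= lam -> m.+1%:R * lam < 2 * pi ->
  strict_spaced lam z -> nsq u = 1 -> (weighted m lam (pre m lam (prodX predT z))).[u] != 0.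
Proof.
move=> l0 ml sz u1; set F := prodX predT z; set f := pre m lam F.
have [zu zs] := sz.
apply/eqP => A0.
have ml' := ml_le l0 ml.
have [c c1 Ec] := inv_prodXT zu.
have sf := pre_sinv l0 ml c1 Ec.
have sF : (size F <= m.+2)%N by rewrite size_prodX card_ord.
have D0 : (weighted m lam (shiftc f)).[u] = 0.
  have := @inv_unit R m (weighted m lam f) u (size_weighted _ _ _) u1.
  rewrite A0 (inv_weighted l0 ml' sf) hornerZ rmorph0 mulr0 => /eqP.
  by rewrite mulf_eq0 -nsq_eq0 c1 oner_eq0 => /eqP.
have Fm : F.[expi (- (lam / 2)) * u] = 0.
  by rewrite -(weighted_pre l0 ml sF) weighted_minus A0 D0 !mulr0 addr0.
have Fp : F.[expi (lam / 2) * u] = 0.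
  by rewrite -(weighted_pre l0 ml sF) weighted_plus A0 D0 !mulr0 addr0.
have [i Ei] := root_prodX Fm; have [j Ej] := root_prodX Fp.
have [ij|ij] := eqVneq i j; last first.
  have := zs i j ij; rewrite -Ei -Ej.
  have -> : expi (- (lam / 2)) * u * (expi (lam / 2) * u)^* =
     (u * u^*) * (expi (- (lam / 2)) * (expi (lam / 2))^*) by rewrite rmorphM /=; ring.
  rewrite mul_conjE u1 mul1r conj_expi -expiD (_ : _ + _ = - lam); last by field.
  by rewrite /= cosN ltxx.
have [l00|l00] := eqVneq lam 0.
  (* a zero of both halves is a double zero of F *)
  have Fu : F.[u] = 0 by move: Fp; rewrite l00 mul0r expi0 mul1r.
  have := weighted0_deriv m f u; rewrite -l00 A0 (weighted_pre l0 ml sF) Fu !mulr0 sub0r.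
  move=> /esym/eqP; rewrite oppr_eq0 mulf_eq0 -[u == 0]nsq_eq0 u1 oner_eq0 /= => /eqP.
  have Eu : u = z i by move: Ei; rewrite l00 mul0r oppr0 expi0 mul1r.
  rewrite /F (prodX_T i) derivM derivXsubC mul1r hornerD hornerM hornerXsubC Eu subrr mul0r addr0.
  move=> /eqP; rewrite /prodX horner_prod; apply/negP/prodf_neq0 => k ki.
  by rewrite hornerXsubC subr_eq0 eq_sym (inj_eq (strict_spaced_inj sz)).
have u0 : u != 0 by rewrite -nsq_gt0 u1.
have := etrans Ei (etrans (congr1 z ij) (esym Ej)) => /(mulIf u0) /(congr1 Im) /=.
have : 0 < sin (1 * lam / 2).
  apply: (@sin_half_gt0 R lam 1 m.+1%:R) => //; last by rewrite ler1n.
  by rewrite lt_neqAle eq_sym l00.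
by rewrite mul1r sinN => h1 h2; exfalso; lra.
Qed.

Lemma prodX_regular phi w : nsq w = 1 ->
  prodX predT (arcz w (spread m phi 1) : I -> C) = 'X^(m.+1) - (w ^+ m.+1)%:P.
Proof.
move=> w1; set z := (X in prodX _ X).
have zE i : z i = w * expi (2 * pi / m.+1%:R * i%:R).
  by rewrite /z /arcz /spread subrr mul0r add0r mul1r.
have n0 : m.+1%:R != 0 :> R by rewrite pnatr_eq0.
have zi : injective z.
  apply: (@strict_spaced_inj R m 0); apply: svalid_strict_spaced => //.
  have := pi_gt0 R => p0; have q0 : 0 < 2 * pi / m.+1%:R :> R.
    by rewrite divr_gt0 ?mulr_gt0 ?ltr0n.
  rewrite /spread; split.
  - by rewrite subrr mul0r !mulr0 addr0.
  - by move=> i im; rewrite subrr !mul0r !add0r !mul1r addr0 ltr_pM2l // ltr_nat.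
  - rewrite subrr mul0r add0r mul1r subr0 -mulrA gtr_pMr ?mulr_gt0 //.
    by rewrite mulrC ltr_pdivrMr ?ltr0n // mul1r ltr_nat.
have sp : size ('X^(m.+1) - (w ^+ m.+1)%:P : {poly C}) = m.+2.
  by rewrite size_XnsubC.
rewrite [RHS](@all_roots_prod_XsubC _ _ (map z (index_enum I))).
- by rewrite lead_coefXnsubC // scale1r big_map.
- by rewrite sp size_map -sum1_size big_const_ord iter_addn_0 mul1n.
- apply/allP => _ /mapP[i _ ->]; rewrite rootE hornerD hornerN hornerC hornerXn zE exprMn expiX.
  have -> : m.+1%:R * (2 * pi / m.+1%:R * i%:R) = i%:R * (2 * pi) :> R by field.
  by rewrite -expiX expi2pi expr1n mulr1 subrr.
- by rewrite uniq_rootsE map_inj_uniq // index_enum_uniq.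
Qed.

Lemma closed_le_fun (T : topologicalType) (g : T -> R) (c : R) : continuous g ->
  closed [set v | g v <= c].
Proof.
move=> cg; apply: (@closed_comp _ _ g [set y | y <= c]); last exact: closed_le.
by move=> x _; exact: cg.
Qed.

End Homotopy.

Section StrictNonvanishing.
Variable R : realType.
Local Notation C := R[i].
Local Notation Re := (@complex.Re R).
Local Notation Im := (@complex.Im R).
Variable m : nat.
Local Notation I := 'I_m.+1.
Implicit Types (lam t s : R) (f g F G P A B r q : {poly C}) (u v w c : C) (z : I -> C) (i j : I) (phi theta : nat -> R).

Lemma prodX_coef0 (P : pred I) z : (forall i, nsq (z i) = 1) -> (prodX P z)`_0 != 0.
Proof.
move=> zu; rewrite -horner_coef0 /prodX horner_prod; apply/prodf_neq0 => i _.
by rewrite hornerXsubC sub0r oppr_eq0 -nsq_gt0 zu.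
Qed.

Lemma pcont_prodX (T : topologicalType) (P : pred I) (z : T -> I -> C) :
  (forall i, ccont (fun x => z x i)) -> pcont (fun x => prodX P (z x)).
Proof. by move=> cz; apply: pcont_prod => i _; exact: pcont_XsubC. Qed.

Lemma pcont_had (T : topologicalType) N (f G : T -> {poly C}) :
  pcont f -> pcont G -> pcont (fun x => had N (f x) (G x)).
Proof.
move=> cf cG k; case: (ltnP k N) => kN.
  apply: (@ccont_ext _ _ (fun x => (f x)`_k * (G x)`_k)); last exact: ccontM.
  by move=> x; rewrite coef_had kN.
apply: (@ccont_ext _ _ (fun x => 0)); last exact: ccont_cst.
by move=> x; rewrite coef_had ltnNge kN.
Qed.

Lemma pcont_pre (T : topologicalType) lam (F : T -> {poly C}) :
  pcont F -> pcont (fun x => pre m lam (F x)).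
Proof.
move=> cF k; case: (ltnP k m.+2) => km.
  apply: (@ccont_ext _ _ (fun x => (F x)`_k * (Qcoef m.+1 lam k)^-1)).
    by move=> x; rewrite coef_pre.
  by apply: ccontM => //; exact: ccont_cst.
apply: (@ccont_ext _ _ (fun x => 0)); last exact: ccont_cst.
by move=> x; rewrite coef_poly ltnNge km.
Qed.

Variables (lam : R) (theta : nat -> R) (w : C).
Hypotheses (lam_gt0 : 0 < lam) (ml : m.+1%:R * lam < 2 * pi).
Hypotheses (sv : svalid m lam theta) (w1 : nsq w = 1).

Let zs s : I -> C := arcz w (spread m theta s).
Let E s : {poly C} := prodX predT (zs s).
Let f s : {poly C} := pre m lam (E s).

Let zsu s i : nsq (zs s i) = 1.
Proof. by rewrite nsqM nsq_expi w1 mulr1. Qed.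

Let f0 s : (f s)`_0 != 0.
Proof. by rewrite coef_pre // Qcoef0 invr1 mulr1 prodX_coef0. Qed.

Let fsinv s : exists eps, sinv m.+1 (f s) eps.
Proof.
have [c c1 Ec] := inv_prodXT (zsu s).
by exists c; apply: pre_sinv => //; exact: ltW.
Qed.

Let cE : pcont E.
Proof. by apply: pcont_prodX => i; exact: ccont_spread. Qed.

Let cf : pcont f.
Proof. exact: pcont_pre. Qed.

(** For X^n - w^n only the coefficients of degree 0 and n survive, so the
Hadamard product with a polynomial of degree n - 1 is constant. *)
Let end_free z i0 : (forall i, nsq (z i) = 1) -> zfree_closed (had m.+1 (f 1) (prodX (fun j => j != i0) z)).
Proof.
move=> zu u _; rewrite hadE big_ord_recl expr0 mulr1 big1 ?addr0.
  by rewrite mulf_neq0 ?prodX_coef0.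
move=> k _; rewrite lift0 coef_pre ?ltnS ?(leq_trans (ltnW (ltn_ord k))) //.
by rewrite /E /zs prodX_regular // coefB coefXn coefC /= subr0 eqSS ltn_eqF // !mul0r.
Qed.

Let bad s := exists z i0 u,
  [/\ spaced lam z, nsq u <= 1 & (had m.+1 (f s) (prodX (fun j => j != i0) z)).[u] = 0].

(** The parameters with a zero are the projection of a compact set of triples
(parameter, radius, angles), the zero having been rotated to the positive axis and the
deleted point renamed to be the first. *)
Let last_bad : bad 0 -> exists s, [/\ 0 <= s <= 1, bad s &
  forall s', 0 <= s' <= 1 -> bad s' -> s' <= s].
Proof.
(* Coordinates of the compact set: the parameter, the radius of the zero, and
   one angle for each point of the configuration. *)
pose iS : 'I_m.+3 := ord0.
pose iR : 'I_m.+3 := lift ord0 ord0.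
pose iT (j : I) : 'I_m.+3 := lift ord0 (lift ord0 j).
pose cfg (x : 'rV[R]_m.+3) (j : I) : C := expi (x 0 (iT j)).
pose val_ (x : 'rV[R]_m.+3) : C :=
  (had m.+1 (f (x 0 iS)) (prodX (fun j => j != ord0) (cfg x))).[((x 0 iR)%:C)%C].
pose A0 := [set x : 'rV[R]_m.+3 | forall k, 0 <= x 0 k <=
  (if (k == iS) || (k == iR) then 1 else 2 * pi)].
pose A1 := [set x : 'rV[R]_m.+3 | nsq (val_ x) <= 0].
pose A2 := \bigcap_(ij in [set ij : I * I | ij.1 != ij.2])
  [set x : 'rV[R]_m.+3 | Re (cfg x ij.1 * (cfg x ij.2)^*) <= cos lam].
have ccfg j : ccont (fun x : 'rV[R]_m.+3 => cfg x j).
  by apply: ccont_expi; exact: coord_continuous.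
have cval : ccont val_.
  apply: (@ccont_horner _ _ (fun x : 'rV[R]_m.+3 =>
     had m.+1 (f (x 0 iS)) (prodX (fun j => j != ord0) (cfg x))) _ m.+1).
  - by move=> x; exact: size_had.
  - apply: pcont_had; last exact: pcont_prodX.
    by move=> k; apply: (ccont_comp _ (cf k)); exact: coord_continuous.
  - by apply: ccont_real; exact: coord_continuous.
have clA1 : closed A1 by apply: closed_le_fun; exact: continuous_nsq.
have clA2 : closed A2.
  apply: closed_bigI => -[i j] _ /=; apply: closed_le_fun.
  exact: (continuous_Re (ccontM (ccfg i) (ccont_conj (ccfg j)))).
have cA : compact (A0 `&` (A1 `&` A2)).
  by apply: compact_closedI; [exact: box_compact|exact: closedI].
have toA s : 0 <= s <= 1 -> bad s -> exists2 x, (A0 `&` (A1 `&` A2)) x & x 0 iS = s.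
  move=> s01 [z [i0 [u [[zu zsep] u1 H]]]].
  have [rho [t [r01 t01 Eu]]] := disc_polar u1.
  pose z1 j := z (tperm ord0 i0 j) * (expi t)^*.
  have Hp j : exists p : R, 0 <= p < 2 * pi /\ z1 j = expi p.
    have : `|z1 j| = 1.
      by apply/eqP; rewrite norm1_nsq nsqM nsq_conj zu nsq_expi mulr1.
    by move=> /expi_surj[p p01 Ep]; exists p.
  have [ph Hph] := choice Hp.
  pose x : 'rV[R]_m.+3 := \row_k (if k == iS then s else if k == iR then rho else
     if unlift ord0 k is Some k' then if unlift ord0 k' is Some j then ph j else 0 else 0).
  have xS : x 0 iS = s by rewrite mxE eqxx.
  have xR : x 0 iR = rho by rewrite mxE.
  have xT j : x 0 (iT j) = ph j by rewrite mxE /= !liftK.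
  have cfgx : cfg x = z1 by apply/funext => j; rewrite /cfg xT (Hph j).2.
  exists x => //; split; last split.
  - move=> k /=; rewrite mxE; case: ifP => [//|_]; case: ifP => [//|_] /=.
    have p2 : 0 <= 2 * pi :> R by rewrite mulr_ge0 // pi_ge0.
    case: unliftP => [k' _|_]; last by rewrite lexx.
    case: unliftP => [j _|_]; last by rewrite lexx.
    by have [/andP[-> /ltW ->] _] := Hph j.
  - rewrite /A1 /= /val_ xS xR cfgx.
    move: H; rewrite Eu mulrC had_rot_gen ?nsq_expi // => /eqP.
    rewrite mulf_eq0 expf_eq0 (negbTE (expi_neq0 _)) andbF /= => /eqP H.
    have := @prodX_perm R m (fun j => z j * (expi t)^*) z1 (tperm ord0 i0) ord0
      (@perm_inj _ _) (fun j => erefl).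
    by rewrite tpermL => <-; rewrite H nsq0.
  - move=> [i j] ij; change (Re (cfg x i * (cfg x j)^*) <= cos lam); rewrite cfgx /z1.
    have -> : z (tperm ord0 i0 i) * (expi t)^* * (z (tperm ord0 i0 j) * (expi t)^*)^* =
      (expi t * (expi t)^*) * (z (tperm ord0 i0 i) * (z (tperm ord0 i0 j))^*).
      by rewrite !rmorphM /= conjCK; ring.
    rewrite mul_conjE nsq_expi mul1r; apply: zsep; rewrite (inj_eq perm_inj); exact: ij.
move=> b0.
have [|||x xA xmax] := @EVT_max_rV R m.+3 (fun x => x 0 iS) (A0 `&` (A1 `&` A2)).
- by have [|x xA _] := toA 0 _ b0; [rewrite lexx ler01|exists x].
- exact: cA.
- by apply: continuous_subspaceT; exact: coord_continuous.
exists (x 0 iS); move: xA; rewrite inE => -[x0 [x1 x2]]; split.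
- exact: (x0 iS).
- exists (cfg x), ord0, ((x 0 iR)%:C)%C; split.
  + split => [j|i j ij]; first exact: nsq_expi.
    exact: (x2 (i, j)).
  + by rewrite nsq_real; have := x0 iR => /= /andP[h0 h1]; rewrite expr_le1.
  + by apply/eqP; rewrite -nsq_eq0 eq_le nsq_ge0 andbT; exact: x1.
- move=> s s01 bs; have [y yA <-] := toA s s01 bs.
  by apply: xmax; rewrite inE.
Qed.

(** Beyond the last bad parameter s there is no zero, so by Hurwitz's
theorem there is none in the open disc at s.  The zero at s is thus a contact on the circle,
which [contact_extremal] and [strict_nonvanish] exclude. *)
Theorem strict_zfree_closed z i0 : spaced lam z ->
  zfree_closed (had m.+1 (pre m lam (prodX predT (arcz w theta : I -> C))) (prodX (fun j => j != i0) z)).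
Proof.
have E0 : prodX predT (arcz w theta : I -> C) = E 0.
  rewrite /E /zs (_ : spread m theta 0 = theta) //.
  by apply/funext => k; rewrite /spread; ring.
rewrite E0 -/(f 0) => sz u u1; apply/eqP => H.
have [s [/andP[s0 s1] bs smax]] := last_bad (ex_intro _ z (ex_intro _ i0 (ex_intro _ u (And3 sz u1 H)))).
have l0 := ltW lam_gt0.
have s_lt1 : s < 1.
  rewrite lt_neqAle s1 andbT; apply/eqP => e; move: bs => [z' [i' [u' [[zu' _] u1' H']]]].
  have := @end_free z' i' zu' u' u1'; rewrite -e H' eqxx //.
have wz : deleted_zfree m lam (f s).
  move=> z' i' sz'.
  apply: (@hurwitz R (fun t => had m.+1 (f t) (prodX (fun j => j != i') z')) m s (1 - s)).
  - by rewrite subr_gt0.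
  - by move=> t; exact: size_had.
  - by apply: pcont_had => //; exact: pcont_cst.
  - move=> t st t1 v v1; apply/eqP => Hv.
    have t01 : 0 <= t <= 1 by apply/andP; split; lra.
    have bt : bad t.
      by exists z', i', v; split; [exact: sz'|exact: ltW|exact: Hv].
    by have := smax t t01 bt; rewrite leNgt st.
  - rewrite horner_coef0 coef_had /= mulf_neq0 ?prodX_coef0 //.
    by have [zu' _] := sz'.
have [eps sf] := fsinv s.
move: bs => [z' [i' [v [sz' v1 Hv]]]].
have v1' : nsq v = 1.
  apply/eqP; rewrite eq_le v1 leNgt; apply/negP => /(wz z' i' sz'); by rewrite Hv eqxx.
have L0 : Lam m.+2 (f s) (prodX (fun j => j != i') (fun j => z' j * v^*)) = 0.
  move: Hv; rewrite had_rot // => /eqP; rewrite mulf_eq0 expf_eq0 -nsq_eq0 v1' oner_eq0 andbF /=.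
  by move/eqP.
have sz2 : spaced lam (fun j => z' j * v^*) by apply: spaced_rot => //; rewrite nsq_conj.
have [phi [sigma [si s_0 vphi Esig]]] := sort_config i' l0 ml sz2.
move: L0; rewrite -{1}s_0 (prodX_perm ord0 si Esig).
have wu : nsq (z' i' * v^*) = 1 by have [-> _] := sz2.
move=> /(contact_extremal lam_gt0 wu sf wz vphi (f0 s))[x x1 Hx].
have sz3 : strict_spaced lam (zs s) by apply: svalid_strict_spaced => //; apply: spread_svalid.
by have := strict_nonvanish l0 ml sz3 x1; rewrite -/(E s) -/(f s) Hx eqxx.
Qed.

End StrictNonvanishing.

(** * The closed case *)

Section WeakNonvanishing.
Variable R : realType.
Local Notation C := R[i].
Local Notation Re := (@complex.Re R).
Local Notation Im := (@complex.Im R).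
Variable m : nat.
Local Notation I := 'I_m.+1.
Implicit Types (lam t s : R) (f g F G P A B r q : {poly C}) (u v w c : C) (z : I -> C) (i j : I) (phi theta : nat -> R).

(** The retraction of the line onto [0, 1]: it extends a homotopy given on [0, 1] to
all parameters. *)
Definition clamp s : R := (1 + `|s| - `|s - 1|) / 2.

Lemma clampE s : 0 <= s -> s <= 1 -> clamp s = s.
Proof.
move=> s0 s1; have s1' : s - 1 <= 0 by lra.
by rewrite /clamp (ger0_norm s0) (ler0_norm s1'); lra.
Qed.

Lemma clamp_ge0 s : 0 <= clamp s.
Proof.
by rewrite /clamp; case: (ger0P s) => ?; case: (ger0P (s - 1)) => ?; lra.
Qed.

Lemma clamp_le1 s : clamp s <= 1.
Proof.
by rewrite /clamp; case: (ger0P s) => ?; case: (ger0P (s - 1)) => ?; lra.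
Qed.

Lemma clamp_continuous : continuous clamp.
Proof.
move=> x; apply: cvgM; last exact: cvg_cst.
apply: cvgB; first by apply: cvgD; [exact: cvg_cst|exact: norm_continuous].
apply: (@continuous_comp _ _ _ (fun s => s - 1)); last exact: norm_continuous.
by apply: cvgB; [exact: cvg_id|exact: cvg_cst].
Qed.

Lemma pcont_Qpoly (T : topologicalType) N (l : T -> R) : continuous l ->
  pcont (fun x => Qpoly N (l x)).
Proof.
move=> cl; apply: pcont_prod => j _; apply: pcontD; first exact: pcont_cst.
apply: pcontZ; last exact: pcont_cst.
apply: ccont_expi => x; apply: cvgM; last exact: cvg_cst.
by apply: cvgM; [exact: cvg_cst|exact: cl].
Qed.

Lemma spread0 phi : spread m phi 0 = phi.
Proof. by apply/funext => k; rewrite /spread; ring. Qed.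

(** Spreading the zeros of F and the configuration slightly makes both
strictly spaced for a slightly larger lam; Hurwitz's theorem recovers the limit. *)
Lemma closed_deleted_zfree lam theta w : 0 <= lam -> m.+1%:R * lam < 2 * pi ->
  valid m lam theta -> nsq w = 1 ->
  deleted_zfree m lam (pre m lam (prodX predT (arcz w theta : I -> C))).
Proof.
move=> l0 ml vt w1 z i0 sz.
have [phi [sigma [si s0 vphi Esig]]] := sort_config i0 l0 ml sz.
rewrite -s0 (prodX_perm ord0 si Esig).
have zi1 : nsq (z i0) = 1 by have [-> _] := sz.
pose q : R := 2 * pi / m.+1%:R.
have nq : m.+1%:R * q = 2 * pi by rewrite /q mulrC divfK // pnatr_eq0.
have q0 : lam < q by rewrite /q ltr_pdivlMr ?ltr0n // mulrC.
(* The spread gaps grow like s (q - lam); taking half of that for the spacing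
   parameter leaves room for the strict inequalities. *)
pose ls s := lam + clamp s * ((q - lam) / 2).
have ls0 s : 0 <= ls s.
  by rewrite addr_ge0 // mulr_ge0 ?clamp_ge0 // divr_ge0 // subr_ge0 ltW.
have ls1 s : m.+1%:R * ls s < 2 * pi.
  rewrite -nq ltr_pM2l ?ltr0n // /ls.
  have := clamp_le1 s; have := clamp_ge0 s; nra.
have cls : continuous ls.
  move=> x; apply: cvgD; first exact: cvg_cst.
  by apply: cvgM; [exact: clamp_continuous|exact: cvg_cst].
have carc (ps : nat -> R) (v : C) : pcont (fun s => prodX predT (arcz v (spread m ps (clamp s)) : I -> C)).
  apply: pcont_prodX => i; apply: (ccont_comp clamp_continuous (ccont_spread ps v i)).
have carc' (ps : nat -> R) (v : C) :
    pcont (fun s => prodX (fun j => j != ord0) (arcz v (spread m ps (clamp s)) : I -> C)).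
  apply: pcont_prodX => i; apply: (ccont_comp clamp_continuous (ccont_spread ps v i)).
pose F s := prodX predT (arcz w (spread m theta (clamp s)) : I -> C).
pose P s := had m.+1 (pre m (ls s) (F s))
  (prodX (fun j => j != ord0) (arcz (z i0) (spread m phi (clamp s)) : I -> C)).
have c0 : clamp 0 = 0 by rewrite clampE.
have P0 : P 0 = had m.+1 (pre m lam (prodX predT (arcz w theta : I -> C)))
   (prodX (fun j => j != ord0) (arcz (z i0) phi : I -> C)).
  by rewrite /P /F /ls c0 !spread0 mul0r addr0.
rewrite -P0; apply: (@hurwitz R P m 0 1) => //.
- by move=> s; exact: size_had.
- apply: pcont_had; last exact: carc'.
  move=> k; case: (ltnP k m.+2) => km.
    apply: (@ccont_ext _ _ (fun s => (F s)`_k * (Qcoef m.+1 (ls s) k)^-1)).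
      by move=> s; rewrite coef_pre.
    apply: ccontM; first exact: carc.
    apply: ccontV; last exact: pcont_Qpoly.
    by move=> s; exact: Qcoef_neq0.
  apply: (@ccont_ext _ _ (fun s => 0)); last exact: ccont_cst.
  by move=> s; rewrite coef_poly ltnNge km.
- move=> s sp; rewrite add0r => s1.
  have cs : clamp s = s by rewrite clampE // ltW.
  have lsp : ls s < lam + s * (q - lam).
    rewrite /ls cs ltrD2l ltr_pM2l //; lra.
  have lsp0 : 0 < ls s.
    by rewrite /ls cs; apply: ltr_wpDl => //; rewrite mulr_gt0 // divr_gt0 ?subr_gt0.
  have v1 := valid_svalid lsp (spread_valid vt (ltW sp) s1).
  have v2 := valid_svalid lsp (spread_valid vphi (ltW sp) s1).
  have sz2 : spaced (ls s) (arcz (z i0) (spread m phi s) : I -> C).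
    by apply: strict_spaced_spaced; apply: svalid_strict_spaced.
  rewrite /P /F cs => u u1.
  by apply: (@strict_zfree_closed R m (ls s) (spread m theta s) w lsp0 (ls1 s) v1 w1 _ _ sz2); exact: ltW.
- rewrite P0 horner_coef0 coef_had /= mulf_neq0 //; last first.
    by apply: prodX_coef0 => i; rewrite nsqM nsq_expi zi1 mulr1.
  rewrite coef_pre // Qcoef0 invr1 mulr1; apply: prodX_coef0 => i.
  by rewrite nsqM nsq_expi w1 mulr1.
Qed.

Lemma spaced_deleted_zfree lam z : 0 <= lam -> m.+1%:R * lam < 2 * pi -> spaced lam z ->
  deleted_zfree m lam (pre m lam (prodX predT z)).
Proof.
move=> l0 ml sz.
have [phi [sigma [si s0 vphi Esig]]] := sort_config ord0 l0 ml sz.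
rewrite (prodX_permT si Esig); apply: closed_deleted_zfree => //.
by have [-> _] := sz.
Qed.

End WeakNonvanishing.

(** * Zeros of self-inversive polynomials with zero-free kernel *)

Section Arguments.
Variable R : realType.
Local Notation C := R[i].
Local Notation Re := (@complex.Re R).
Local Notation Im := (@complex.Im R).

(** The argument, in ]0, pi[, of a point of the open upper half plane. *)
Definition uarg (x : C) : R := acos (Re x / md x).

Lemma md_gt0 (x : C) : 0 < Im x -> 0 < md x.
Proof.
move=> x0; rewrite /md sqrtr_gt0 nsq_gt0; apply: contraTneq x0 => ->.
by rewrite ltxx.
Qed.

Lemma uarg_bound (x : C) : 0 < Im x -> -1 < Re x / md x < 1.
Proof.
move=> x0; have m0 := md_gt0 x0.
rewrite ltr_pdivlMr // mulN1r ltr_pdivrMr // mul1r -ltr_norml.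
rewrite -(@ltr_pXn2r _ 2) ?nnegrE ?md_ge0 // real_normK ?num_real // md_sq /nsq.
by rewrite ltrDl exprn_gt0.
Qed.

Lemma uarg_pos (x : C) : 0 < Im x -> 0 < uarg x < pi.
Proof.
move=> /uarg_bound/andP[h1 h2]; rewrite acos_gt0 ?acos_ltpi //.
  by rewrite h1 ltW.
by rewrite h2 ltW.
Qed.

Lemma uargE (x : C) : 0 < Im x -> x = ((md x)%:C)%C * expi (uarg x).
Proof.
move=> x0; have m0 := md_gt0 x0; have /andP[h1 h2] := uarg_bound x0.
have b : -1 <= Re x / md x <= 1 by rewrite !ltW.
apply: complex_eq.
  by rewrite Re_realM /= /uarg acosK ?in_itv // mulrC divfK // gt_eqF.
rewrite Im_realM /= /uarg sin_acos //.
rewrite -[in LHS](ger0_norm (ltW x0)) -sqrtr_sqr.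
rewrite -[X in X * _](ger0_norm (md_ge0 x)) -sqrtr_sqr -sqrtrM ?sqr_ge0 //; congr (Num.sqrt _).
rewrite mulrBr mulr1 expr_div_n mulrCA divff ?mulr1; last by rewrite expf_eq0 /= gt_eqF.
by rewrite md_sq /nsq addrAC subrr add0r.
Qed.

Lemma uarg_expi (t : R) : 0 < t < pi -> uarg (expi t) = t.
Proof.
move=> /andP[t0 t1]; rewrite /uarg /md nsq_expi sqrtr1 divr1 /=.
by rewrite cosK // in_itv /= !ltW.
Qed.

Lemma uarg_continuous (g : R -> C) : ccont g -> (forall t, 0 < Im (g t)) ->
  continuous (fun t => uarg (g t)).
Proof.
move=> cg g0 x; rewrite /uarg.
apply: (@continuous_comp _ _ _ (fun t => Re (g t) / md (g t))).
  apply: cvgM; first exact: (continuous_Re cg).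
  apply: cvgV; first by rewrite gt_eqF // md_gt0.
  apply: (@continuous_comp _ _ _ (fun t => nsq (g t))); first exact: continuous_nsq.
  exact: sqrt_continuous.
exact/continuous_acos/uarg_bound.
Qed.

(** Total arguments are followed continuously: they start below pi and cannot
cross pi, since the product stays in the open upper half plane. *)
Lemma partial_product N (g : 'I_N -> R -> C) (a : R) i j : i != j ->
  (forall k, ccont (g k)) -> (forall k t, 0 < Im (g k t)) ->
  (forall t, 0 < Im (\prod_k g k t)) ->
  0 < a -> N%:R * a < pi -> (forall k, g k 0 = expi a) ->
  0 < Im (g i 1 * g j 1).
Proof.
move=> ij cg g0 gP a0 Na ga.
pose S t := \sum_k uarg (g k t).
have cS : continuous S.
  have H : ccont (fun t => \sum_k ((uarg (g k t))%:C)%C : C).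
    by apply: ccont_sum => k _; apply: ccont_real; exact: uarg_continuous.
  by apply: cont_ext (continuous_Re H) => t; rewrite Re_sum.
have Pos t : 0 < \prod_k md (g k t) by apply: prodr_gt0 => k _; exact: md_gt0.
have PE t : \prod_k g k t = ((\prod_k md (g k t))%:C)%C * expi (S t).
  rewrite -expi_prod rmorph_prod -big_split; apply: eq_bigr => k _.
  exact: uargE.
have sS t : 0 < sin (S t).
  by have := gP t; rewrite PE Im_realM /= pmulr_rgt0.
have S1 : S 1 < pi.
  rewrite -subr_gt0; apply: (@pos_no_zero R (fun t => pi - S t)).
  - by move=> x; apply: cvgB; [exact: cvg_cst|exact: cS].
  - rewrite subr_gt0 /S; under eq_bigr => k _.
      rewrite ga uarg_expi; last first.
        rewrite a0 /=; apply: le_lt_trans Na; rewrite ler_peMl ?(ltW a0) // ler1n.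
        by case: (N) k => // -[].
      over.
    by rewrite sumr_const card_ord -mulr_natl.
  - move=> t _; rewrite subr_eq0; apply/eqP => e.
    by have := sS t; rewrite -e sinpi ltxx.
have h k : 0 <= uarg (g k 1) by have /andP[/ltW] := uarg_pos (g0 k 1).
have ui : 0 < uarg (g i 1) by have /andP[] := uarg_pos (g0 i 1).
have le : uarg (g i 1) + uarg (g j 1) <= S 1.
  rewrite /S (bigD1 i) //= lerD2l (bigD1 j) 1?eq_sym //= lerDl.
  by apply: sumr_ge0 => k _.
rewrite (uargE (g0 i 1)) (uargE (g0 j 1)).
have -> : ((md (g i 1))%:C)%C * expi (uarg (g i 1)) * (((md (g j 1))%:C)%C * expi (uarg (g j 1))) =
   ((md (g i 1) * md (g j 1))%:C)%C * expi (uarg (g i 1) + uarg (g j 1)) :> C.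
  by rewrite expiD rmorphM /=; ring.
rewrite Im_realM mulr_gt0 ?mulr_gt0 ?md_gt0 //= sin_gt0_pi //.
by rewrite (le_lt_trans le S1) andbT ltr_wpDr.
Qed.

End Arguments.

Section Zeros.
Variable R : realType.
Local Notation C := R[i].
Local Notation Re := (@complex.Re R).
Local Notation Im := (@complex.Im R).
Variable m : nat.
Local Notation I := 'I_m.+1.
Implicit Types (lam t s mu : R) (f g F G P A B r q : {poly C}) (u v w c : C) (z : I -> C) (i j : I) (phi theta : nat -> R).

(** Self-inversive f with kernel free of zeros in the open disc; they will turn out
to be the pre-coefficients of polynomials with closed spacing of the zeros. *)
Definition weakT lam f := [/\ (size f <= m.+2)%N, exists eps, sinv m.+1 f eps, f`_0 != 0
  & zfree_open (weighted m lam f)].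
(** Self-inversive f with kernel free of zeros in the closed disc; by [classTP]
they are the pre-coefficients of T_n(lam). *)
Definition strictT lam f := [/\ (size f <= m.+2)%N, exists eps, sinv m.+1 f eps, f`_0 != 0
  & zfree_closed (weighted m lam f)].

Lemma strictT_weakT lam f : strictT lam f -> weakT lam f.
Proof. by move=> [h1 h2 h3 h4]; split => // u /ltW; exact: h4. Qed.

Lemma inv_horner n P v : (size P <= n.+1)%N -> v != 0 ->
  (n_inverse n P).[(v^*)^-1] * (v^*) ^+ n = (P.[v])^*.
Proof.
move=> sP v0; have v0' : v^* != 0 by rewrite conjC_eq0.
rewrite horner_poly (horner_coef_wide _ sP) rmorph_sum /= mulr_suml.
rewrite [RHS](reindex_inj rev_ord_inj) /=; apply: eq_bigr => k _.
rewrite subSS rmorphM rmorphXn /= -mulrA; congr (_ * _).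
have kn : (k <= n)%N by rewrite -ltnS.
have -> : v^* ^+ n = v^* ^+ (n - k) * v^* ^+ k by rewrite -exprD subnK.
by rewrite mulrCA -exprMn mulVf // expr1n mulr1.
Qed.

Lemma sinv_inv f eps : sinv m.+1 f eps -> (size f <= m.+2)%N ->
  n_inverse m.+1 f = eps *: f.
Proof.
move=> [_ sf] sz; apply/polyP => k; rewrite coef_inv coefZ ltnS.
by have [km|km] := leqP k m.+1; [exact: sf|rewrite nth_default ?mulr0 // (leq_trans sz)].
Qed.

Lemma inv_weighted_n N lam f : 0 <= lam -> N%:R * lam < 2 * pi ->
  n_inverse N (weighted N lam f) = weighted N lam (n_inverse N f).
Proof.
move=> l0 ml; apply/polyP => k; rewrite coef_inv !coef_poly.
have [km|km] := ltnP k N.+1 => //.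
by rewrite ltnS leq_subr rmorphM /= Qcoef_conj // Qcoef_sym.
Qed.

(** Hence the sums of the two halves in [weighted_minus] and [weighted_plus] do not
vanish in the open disc. *)
Lemma halves_lt lam f u : 0 <= lam -> m%:R * lam < 2 * pi -> weakT lam f -> nsq u < 1 ->
  nsq (u * (weighted m lam (shiftc f)).[u]) < nsq (weighted m lam f).[u].
Proof.
move=> l0 ml [sf [eps se] f0 zf] u1.
have A0 : 0 < nsq (weighted m lam f).[u] by rewrite nsq_gt0 zf.
have h := inv_le (size_weighted m lam f) zf (ltW u1).
rewrite (inv_weighted l0 ml se) hornerZ nsqM (proj1 se) mul1r in h.
rewrite nsqM; apply: le_lt_trans (_ : nsq u * nsq (weighted m lam f).[u] < _).
  by rewrite ler_wpM2l ?nsq_ge0.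
by rewrite gtr_pMl.
Qed.

Lemma weighted_zfree lam f : 0 <= lam -> m%:R * lam < 2 * pi -> weakT lam f ->
  zfree_open (weighted m.+1 lam f).
Proof.
move=> l0 ml wf u u1; set v := expi (lam / 2) * u.
have v1 : nsq v < 1 by rewrite nsqM nsq_expi mul1r.
have -> : u = expi (- (lam / 2)) * v by rewrite /v mulrA expiNl mul1r.
have := halves_lt l0 ml wf v1; rewrite weighted_minus.
set a := (weighted m lam f).[v]; set b := v * _ => h.
apply/eqP => e; move: h; have -> : a = - (expi (- (m.+1%:R * lam / 2)) * b).
  by apply/eqP; rewrite -addr_eq0 e.
by rewrite nsqN nsqM nsq_expi mul1r ltxx.
Qed.

(** F has no zero in the open disc since its halves have different moduli there,
and then none outside by self-inversiveness. *)
Lemma unit_zeros lam f : 0 <= lam -> m.+1%:R * lam < 2 * pi -> weakT lam f ->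
  exists a z, [/\ a != 0, forall i, nsq (z i) = 1 & weighted m.+1 lam f = a *: prodX predT z].
Proof.
move=> l0 ml wf; have ml' := ml_le l0 ml; have [sf [eps se] f0 zf] := wf.
set F := weighted m.+1 lam f.
have zF := weighted_zfree l0 ml' wf.
have [e1 sk] := se.
have fn : f`_m.+1 != 0.
  have := sk 0%N isT; rewrite subn0 => h; rewrite -(conjC_eq0 (f`_m.+1)) h.
  by rewrite mulf_neq0 // -nsq_gt0 e1.
have sF : size F = m.+2.
  apply/eqP; rewrite eqn_leq size_weighted ltnNge; apply/negP => /leq_sizeP/(_ m.+1 (leqnn _)).
  by rewrite /F coef_poly ltnSn Qcoef_last mul1r => /eqP; rewrite (negbTE fn).
have F0 : F != 0 by rewrite -size_poly_eq0 sF.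
have iF : n_inverse m.+1 F = eps *: F.
  rewrite /F inv_weighted_n // (sinv_inv se sf); apply/polyP => k.
  by rewrite coefZ !coef_poly coefZ; case: ifP; rewrite ?mulr0 // mulrCA.
have [r E] := poly_factor F.
have sr : size r = m.+1 by apply/eqP; rewrite -eqSS -(size_factor F0 E) sF.
have zr v : v \in r -> nsq v = 1.
  move=> vr; have Fv : F.[v] = 0.
    by apply/eqP; rewrite E hornerZ mulf_eq0 -[X in _ || X]rootE root_prod_XsubC vr orbT.
  apply/eqP; rewrite eq_le (zfree_factor F0 zF E vr) andbT leNgt; apply/negP => v1.
  have v0 : v != 0 by rewrite -nsq_gt0 (lt_trans ltr01).
  have := @inv_horner m.+1 F v _ v0; rewrite sF => /(_ (leqnn _)).
  rewrite Fv rmorph0 iF hornerZ => /eqP; rewrite !mulf_eq0 expf_eq0 conjC_eq0 (negbTE v0) andbF orbF.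
  rewrite -nsq_eq0 e1 oner_eq0 /=; apply/negP/zF.
  by rewrite nsqV nsq_conj invf_lt1 // (lt_trans ltr01).
exists (lead_coef F), (fun i => nth 0 r i); split.
- by rewrite lead_coef_eq0.
- by move=> i; apply: zr; rewrite mem_nth // sr.
- rewrite {1}E; congr (_ *: _); rewrite /prodX (big_nth 0) sr big_mkord.
  by apply: eq_bigr.
Qed.

Lemma prodX_horner z u : (prodX predT z).[u] = \prod_i (u - z i).
Proof. by rewrite /prodX horner_prod; apply: eq_bigr => i _; rewrite hornerXsubC. Qed.

(** A Moebius map of the disc onto the upper half plane; the product of these
maps over the zeros of F is exp(i n lam/2) F(exp(-i lam/2) u)/F(exp(i lam/2) u). *)
Lemma factor_uhp lam (c u : C) : 0 < sin (lam / 2) -> nsq c = 1 -> nsq u < 1 ->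
  0 < Im ((u - expi (lam / 2) * c) / (expi (lam / 2) * u - c)).
Proof.
move=> sl c1 u1; set e := expi (lam / 2).
have d0 : e * u - c != 0.
  rewrite subr_eq0; apply/eqP => /(congr1 (@nsq R)).
  by rewrite nsqM nsq_expi mul1r c1 => h; rewrite h ltxx in u1.
have -> : (u - e * c) / (e * u - c) =
    (((nsq (e * u - c))^-1)%:C)%C * ((u - e * c) * (e * u - c)^*).
  apply: (mulIf d0); rewrite divfK //.
  transitivity (((nsq (e * u - c))^-1%:C)%C * ((e * u - c) * (e * u - c)^*) * (u - e * c)); last by ring.
  by rewrite mul_conjE -rmorphM mulVf ?nsq_eq0 // rmorph1 mul1r.
rewrite Im_realM mulr_gt0 ?invr_gt0 ?nsq_gt0 //.
have -> : Im ((u - e * c) * (e * u - c)^*) = sin (lam / 2) * (nsq c - nsq u).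
  rewrite /e; move: (lam / 2) => l; case: (u) => a b; case: (c) => x y.
  move: (cos2Dsin2 l); rewrite /nsq /=; move: (cos l) (sin l) => p q pq.
  apply: subr0_eq; transitivity ((p ^+ 2 + q ^+ 2 - 1) * (x * b - y * a)); first by ring.
  by rewrite pq subrr mul0r.
by rewrite mulr_gt0 // c1 subr_gt0.
Qed.

(** The factors of [factor_uhp] and their product all map the disc into the upper
half plane, so the product of the two factors belonging to z_i and z_j does, too.  If
these zeros were less than lam apart, then at the point u = 2 cos(lam/2) z_i z_j/(z_i + z_j)
of the open disc that product would be exp(-i lam). *)
Lemma zeros_spaced lam f a z : 0 <= lam -> m.+1%:R * lam < 2 * pi -> weakT lam f ->
  a != 0 -> (forall i, nsq (z i) = 1) -> weighted m.+1 lam f = a *: prodX predT z ->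
  spaced lam z.
Proof.
move=> l0 ml wf a0 zu EF; split => // i j ij; have ml' := ml_le l0 ml.
have Rle1 : Re (z i * (z j)^*) <= 1.
  have := nsq_ge0 (z i - z j); rewrite nsqD nsqN !zu rmorphN mulrN Re_opp; lra.
have [l00|lp] := eqVneq lam 0; first by rewrite l00 cos0.
have {}lp : 0 < lam by rewrite lt_neqAle eq_sym lp.
have m2 : (2 <= m.+1)%N.
  rewrite ltnS lt0n; apply: contraNneq ij => m0; apply/eqP/val_inj => /=.
  by have := ltn_ord i; have := ltn_ord j; lia.
have l2 : 2 * lam < 2 * pi.
  by apply: le_lt_trans ml; rewrite ler_wpM2r // ler_nat.
have sl2 : 0 < sin (lam / 2) by apply: sin_gt0_pi; apply/andP; split; lra.
have cl2 : 0 < cos (lam / 2) by apply: cos_gt0_pihalf; apply/andP; split; lra.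
have sl : 0 < sin lam by apply: sin_gt0_pi; apply/andP; split; lra.
rewrite leNgt; apply/negP => Rgt.
set e := expi (lam / 2) : C.
have ee : e^* * e = 1 by rewrite mulrC mul_conjE nsq_expi.
set S := z i + z j.
have nS : (2 * cos (lam / 2)) ^+ 2 < nsq S.
  rewrite /S nsqD !zu; have : cos lam = 2 * cos (lam / 2) ^+ 2 - 1.
    have e2 : lam = lam / 2 + lam / 2 by field.
    by have := cos2Dsin2 (lam / 2); rewrite [in cos lam]e2 cosD; nra.
  by move: Rgt => /[swap] ->; lra.
have S0 : S != 0 by rewrite -nsq_gt0 (le_lt_trans _ nS) // sqr_ge0.
(* At this point the product of the two factors is expi (- lam); it lies in the
   disc because |z i + z j| > 2 cos (lam / 2). *)
pose u := ((2 * cos (lam / 2))%:C)%C * (z i * z j) / S.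
have u1 : nsq u < 1.
  rewrite /u !nsqM nsqV nsq_real !zu !mulr1 ltr_pdivrMr ?mul1r //.
  by rewrite nsq_gt0.
have uS : u * S = (e + e^*) * (z i * z j).
  rewrite /u divfK //; congr (_ * _); rewrite /e conj_expi.
  by apply: complex_eq; rewrite /= ?cosN ?sinN; ring.
pose g (k : 'I_m.+1) (t : R) : C :=
  ((clamp t)%:C%C * u - e * z k) / (e * ((clamp t)%:C%C * u) - z k).
have tu t : nsq ((clamp t)%:C%C * u) < 1.
  rewrite nsqM nsq_real; have := clamp_ge0 t; have := clamp_le1 t => c1 c0.
  by apply: le_lt_trans u1; rewrite ler_piMl ?nsq_ge0 // expr_le1.
have den t k : e * ((clamp t)%:C%C * u) - z k != 0.
  rewrite subr_eq0; apply/eqP => /(congr1 (@nsq R)).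
  by rewrite nsqM nsq_expi mul1r zu => h; have := tu t; rewrite h ltxx.
have := @partial_product R m.+1 g (lam / 2) i j ij.
have -> : g i 1 * g j 1 = expi (- lam).
  rewrite /g clampE ?lexx ?ler01 // rmorph1 mul1r.
  have dd : (e * u - z i) * (e * u - z j) != 0.
    by rewrite mulf_neq0 //; have := den 1; rewrite clampE ?lexx ?ler01 // rmorph1 mul1r; apply.
  rewrite mulrACA -invfM; apply: (mulIf dd); rewrite divfK //.
  have -> : (e * u - z i) * (e * u - z j) = e * e * (u * u) - e * (u * S) + z i * z j.
    by rewrite /S; ring.
  have -> : (u - e * z i) * (u - e * z j) = u * u - e * (u * S) + e * e * (z i * z j).
    by rewrite /S; ring.
  rewrite uS.
  have -> : e * ((e + e^*) * (z i * z j)) = e * e * (z i * z j) + (e^* * e) * (z i * z j) by ring.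
  rewrite ee mul1r.
  have -> : expi (- lam) = e^* * e^* by rewrite /e conj_expi -expiD; congr expi; field.
  transitivity (u * u - z i * z j); first by ring.
  transitivity ((e^* * e) * (e^* * e) * (u * u) - (e^* * e) * (e^* * e) * (z i * z j)); last by ring.
  by rewrite ee !mul1r.
rewrite [Im (expi _)]sinN => H.
suff : 0 < - sin lam by lra.
apply: H.
- move=> k; apply: ccontM.
    apply: ccontB; last exact: ccont_cst.
    by apply: ccontM; [apply: ccont_real; exact: clamp_continuous|exact: ccont_cst].
  apply: ccontV; first by move=> t; exact: den.
  apply: ccontB; last exact: ccont_cst.
  apply: ccontM; first exact: ccont_cst.
  by apply: ccontM; [apply: ccont_real; exact: clamp_continuous|exact: ccont_cst].
- by move=> k t; apply: factor_uhp.
- move=> t; set v := (clamp t)%:C%C * u.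
  have vl := halves_lt l0 ml' wf (tu t); rewrite -/v in vl.
  have hm := weighted_minus m lam f v; have hp := weighted_plus m lam f v.
  rewrite EF !hornerZ !prodX_horner in hm hp.
  set A := (weighted m lam f).[v] in hm hp vl; set B := v * _ in hm hp vl.
  set al := m.+1%:R * lam / 2 in hm hp.
  have sal : 0 < sin al.
    by apply: sin_gt0_pi; rewrite /al; apply/andP; split; [rewrite divr_gt0 ?mulr_gt0 ?ltr0n|lra].
  have P1 : \prod_k g k t = (\prod_k (v - e * z k)) / (\prod_k (e * v - z k)).
    by rewrite -prodf_div.
  have P2 : \prod_k (v - e * z k) = expi al * \prod_k (expi (- (lam / 2)) * v - z k).
    have -> : expi al = \prod_(k < m.+1) e.
      by rewrite prodr_const card_ord expiX; congr expi; rewrite /al; field.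
    rewrite -big_split; apply: eq_bigr => k _ /=.
    by rewrite mulrBr mulrA /e expiNr mul1r.
  have d0 : \prod_k (e * v - z k) != 0 by apply/prodf_neq0 => k _; exact: den.
  have -> : \prod_k g k t = expi al * (A + expi (- al) * B) / (A + expi al * B).
    rewrite -hm -hp P1 P2 -/e; move: (\prod_k (_ - _)) (\prod_k (_ - _)) d0 => p q q0.
    by rewrite mulrCA -mulf_div divff // mul1r.
  have dp : A + expi al * B != 0 by rewrite -hp mulf_neq0.
  have -> : expi al * (A + expi (- al) * B) = expi al * A + B.
    by rewrite mulrDr mulrA expiNr mul1r.
  have -> : (expi al * A + B) / (A + expi al * B) =
     (((nsq (A + expi al * B))^-1)%:C)%C * ((expi al * A + B) * (A + expi al * B)^*).
    apply: (mulIf dp); rewrite divfK //.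
    transitivity (((nsq (A + expi al * B))^-1%:C)%C * ((A + expi al * B) * (A + expi al * B)^*) * (expi al * A + B)); last by ring.
    by rewrite mul_conjE -rmorphM mulVf ?nsq_eq0 // rmorph1 mul1r.
  rewrite Im_realM mulr_gt0 ?invr_gt0 ?nsq_gt0 //.
  have -> : Im ((expi al * A + B) * (A + expi al * B)^*) = sin al * (nsq A - nsq B).
    case: (A) => x y; case: (B) => x' y'; rewrite /nsq /=; move: (cos2Dsin2 al).
    move: (cos al) (sin al) => p q pq.
    apply: subr0_eq; transitivity ((p ^+ 2 + q ^+ 2 - 1) * (y * x' - x * y')); first by ring.
    by rewrite pq subrr mul0r.
  by rewrite mulr_gt0 // subr_gt0.
- by rewrite divr_gt0.
- lra.
- move=> k; rewrite /g clampE ?lexx ?ler01 // rmorph0 mul0r mulr0 !sub0r.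
  have zk : z k != 0 by rewrite -nsq_gt0 zu.
  by rewrite invrN mulrN mulNr opprK mulfK.
Qed.

End Zeros.

(** * Spacing of zeros and zeros of the kernel *)

Section Kernels.
Variable R : realType.
Local Notation C := R[i].
Local Notation Re := (@complex.Re R).
Local Notation Im := (@complex.Im R).
Variable m : nat.
Local Notation I := 'I_m.+1.
Implicit Types (lam t s mu : R) (f g F G P A B r q : {poly C}) (u v w c : C) (z : I -> C) (i j : I) (phi theta : nat -> R).

Lemma Qpoly_config mu : exists v a, [/\ nsq v = 1, a != 0 &
  prodX (fun j : I => j != ord0) (arcz 1 (fun k => k%:R * mu)) = a *: (Qpoly m mu \Po (v *: 'X))].
Proof.
have [v [a [v1 a0 E]]] := @block_Qpoly R m mu (expi mu) (nsq_expi mu).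
exists v, a; split => //; rewrite prodX_lift -E; apply: eq_bigr => j _.
rewrite /arcz mul1r /= /bump leq0n -expiD; congr ('X - (expi _)%:P).
by rewrite natrD mulrDl mul1r.
Qed.

Lemma equal_valid mu : 0 <= mu -> m.+1%:R * mu <= 2 * pi -> valid m mu (fun k => k%:R * mu).
Proof.
move=> mu0 mm; split => [|i _|]; first by rewrite mul0r.
  by rewrite -[in leRHS]addn1 natrD mulrDl mul1r.
by rewrite lerBrDr -[X in _ + X]mul1r -mulrDl natr1.
Qed.

Lemma horner_had_rot N f a G v u : (had N f (a *: (G \Po (v *: 'X)))).[u] = a * (had N f G).[v * u].
Proof.
rewrite !hadE mulr_sumr; apply: eq_bigr => k _.
by rewrite coefZ coef_comp_scale exprMn; ring.
Qed.

(** The kernel at mu is the Hadamard product for one particular configuration;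
Q is kept abstract to treat the open and the closed disc together. *)
Lemma zfree_Qpoly (Q : {poly C} -> Prop) f mu :
  (Q = @zfree_open R \/ Q = @zfree_closed R) ->
  Q (had m.+1 f (prodX (fun j : I => j != ord0) (arcz 1 (fun k => k%:R * mu)))) ->
  Q (weighted m mu f).
Proof.
have [v [a [v1 a0 ->]]] := Qpoly_config mu; rewrite weighted_had.
have v0 : v != 0 by rewrite -nsq_gt0 v1.
by case=> -> h u u1; have := h (v^-1 * u); rewrite horner_had_rot mulVKf // mulf_eq0 negb_or nsqM nsqV v1 invr1 mul1r => /(_ u1)/andP[].
Qed.

Lemma deleted_zfree_weighted lam f : 0 <= lam -> m.+1%:R * lam <= 2 * pi -> deleted_zfree m lam f ->
  zfree_open (weighted m lam f).
Proof.
move=> l0 ml wz; apply: (zfree_Qpoly (Q := @zfree_open R)); [by left|].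
exact: (wz _ _ (valid_spaced l0 (nsq1 R) (equal_valid l0 ml))).
Qed.

Lemma pre_weighted lam f : 0 <= lam -> m.+1%:R * lam < 2 * pi -> (size f <= m.+2)%N ->
  pre m lam (weighted m.+1 lam f) = f.
Proof.
move=> l0 ml sf; apply/polyP => k; rewrite coef_poly; case: ltnP => km.
  by rewrite coef_poly km mulrAC mulfV ?mul1r // Qcoef_neq0.
by rewrite nth_default // (leq_trans sf).
Qed.

Lemma preZ lam a F : pre m lam (a *: F) = a *: pre m lam F.
Proof.
by apply/polyP => k; rewrite coefZ !coef_poly coefZ; case: ifP; rewrite ?mulr0 // mulrA.
Qed.

Lemma hadZl N f a G : had N (a *: f) G = a *: had N f G.
Proof. by rewrite hadC hadZ hadC. Qed.

Lemma weakT_deleted_zfree lam f : 0 <= lam -> m.+1%:R * lam < 2 * pi -> weakT m lam f -> deleted_zfree m lam f.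
Proof.
move=> l0 ml wf; have [sf _ _ _] := wf.
have [a [z [a0 zu E]]] := unit_zeros l0 ml wf.
have sz := zeros_spaced l0 ml wf a0 zu E.
rewrite -(pre_weighted l0 ml sf) E preZ => y i sy u u1.
by rewrite hadZl hornerZ mulf_neq0 // (spaced_deleted_zfree l0 ml sz).
Qed.

Lemma spaced_weakT lam z : 0 <= lam -> m.+1%:R * lam < 2 * pi -> spaced lam z ->
  weakT m lam (pre m lam (prodX predT z)).
Proof.
move=> l0 ml sz; have zu := proj1 sz; split.
- exact: size_poly.
- have [c c1 Ec] := inv_prodXT zu.
  by exists c; apply: pre_sinv.
- by rewrite coef_pre // mulf_neq0 ?invr_eq0 ?Qcoef_neq0 // prodX_coef0.
- by apply: deleted_zfree_weighted => //; [exact: ltW|exact: spaced_deleted_zfree].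
Qed.

Lemma strict_spaced_strictT lam z : 0 <= lam -> m.+1%:R * lam < 2 * pi -> strict_spaced lam z ->
  strictT m lam (pre m lam (prodX predT z)).
Proof.
move=> l0 ml sz; have [h1 h2 h3 h4] := spaced_weakT l0 ml (strict_spaced_spaced sz).
split => // u; rewrite le_eqVlt => /orP[/eqP u1|]; last exact: h4.
exact: strict_nonvanish.
Qed.

(** Two zeros exactly lam apart (a double zero if lam = 0) would make
both halves of F vanish at the point of the circle between them. *)
Lemma strictT_strict_spaced lam f a z : 0 <= lam -> m.+1%:R * lam < 2 * pi -> strictT m lam f ->
  a != 0 -> (forall i, nsq (z i) = 1) -> weighted m.+1 lam f = a *: prodX predT z ->
  strict_spaced lam z.
Proof.
move=> l0 ml sf a0 zu E; have [_ _ _ zc] := sf.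
have [_ sz] := zeros_spaced l0 ml (strictT_weakT sf) a0 zu E.
have F0 i : (weighted m.+1 lam f).[z i] = 0.
  by rewrite E hornerZ (prodX_T i) hornerM hornerXsubC subrr mul0r mulr0.
have key i j : i != j -> z i <> expi lam * z j.
  move=> ij zij; have [l00|lp] := eqVneq lam 0.
    have zz : z i = z j by rewrite zij l00 expi0 mul1r.
    have := weighted0_deriv m f (z i); rewrite -l00 F0 mulr0 sub0r.
    rewrite E derivZ hornerZ (prodX_T i) derivM derivXsubC mul1r hornerD hornerM hornerXsubC subrr mul0r addr0.
    rewrite /prodX (bigD1 j) 1?eq_sym //= hornerM hornerXsubC zz subrr mul0r !mulr0 oppr0.
    move/eqP; rewrite mulf_eq0 pnatr_eq0 /=; apply/negP/zc.
    by rewrite zu.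
  have {}lp : 0 < lam by rewrite lt_neqAle eq_sym lp.
  set u := expi (lam / 2) * z j.
  have u1 : nsq u <= 1 by rewrite nsqM nsq_expi zu mulr1.
  have hm := weighted_minus m lam f u; have hp := weighted_plus m lam f u.
  have e1 : expi (- (lam / 2)) * u = z j by rewrite /u mulrA expiNl mul1r.
  have e2 : expi (lam / 2) * u = z i.
    by rewrite /u mulrA -expiD zij; congr (expi _ * _); field.
  rewrite e1 F0 in hm; rewrite e2 F0 in hp.
  set B := u * _ in hm hp; set al := m.+1%:R * lam / 2 in hm hp.
  have sal : 0 < sin al.
    by apply: sin_gt0_pi; rewrite /al; apply/andP; split; [rewrite divr_gt0 ?mulr_gt0 ?ltr0n|lra].
  have B0 : B = 0.
    have : (expi al - expi (- al)) * B = 0.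
      transitivity (((weighted m lam f).[u] + expi al * B) - ((weighted m lam f).[u] + expi (- al) * B)).
        by ring.
      by rewrite -hp -hm subrr.
    move/eqP; rewrite mulf_eq0 => /orP[/eqP/(congr1 Im)|/eqP //].
    by rewrite Im_add Im_opp /= sinN opprK => /eqP; rewrite -mulr2n mulrn_eq0 /= gt_eqF.
  by move: hm; rewrite B0 mulr0 addr0 => /esym/eqP; apply/negP/zc.
split => // i j ij; rewrite lt_neqAle sz // andbT; apply/eqP => cl.
set w := z i * (z j)^*.
have w1 : nsq w = 1 by rewrite nsqM nsq_conj !zu mulr1.
have zw : z i = w * z j by rewrite /w -mulrA (mulrC _ (z j)) mul_conjE zu mulr1.
have : (Im w - sin lam) * (Im w + sin lam) = 0.
  by move: w1 (cos2Dsin2 lam); rewrite /nsq cl; nra.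
move/eqP; rewrite mulf_eq0 => /orP[/eqP|/eqP] h.
  apply: (key _ _ ij); rewrite zw; congr (_ * _); apply: complex_eq => //=; lra.
apply: (key j i); first by rewrite eq_sym.
have -> : expi lam = w^*.
  by apply: complex_eq; rewrite ?Re_conjc ?Im_conjc /=; [rewrite cl|lra].
by rewrite zw mulrA (mulrC _ w) mul_conjE w1 mul1r.
Qed.

End Kernels.

(** * Positive decomposition of a kernel *)

Section ResiduePositivity.
Variable R : realType.
Local Notation C := R[i].
Local Notation Re := (@complex.Re R).
Local Notation Im := (@complex.Im R).
Variable m : nat.
Local Notation I := 'I_m.+1.
Implicit Types (lam t s mu : R) (f g F G P A B r q : {poly C}) (u v w c : C) (z : I -> C) (i j k : I) (phi theta : nat -> R).

(** The quotient is real because x and y are unimodular, and its sign is that of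
cos(lam/2) (1 - Re p) + sin(lam/2) Im p with p = x conj y. *)
Lemma pair_ratio lam (x y : C) : 0 <= lam -> lam <= pi -> nsq x = 1 -> nsq y = 1 ->
  Re (x * y^*) < cos lam ->
  exists2 rho : R, 0 < rho &
    expi (lam / 2) * x - expi (- (lam / 2)) * y = (rho%:C)%C * (x - y).
Proof.
move=> l0 lpi x1 y1 xy; set p := x * y^*.
have p1 : nsq p = 1 by rewrite nsqM nsq_conj x1 y1 mulr1.
have s0 : 0 <= sin (lam / 2) by apply: sin_ge0_pi; apply/andP; split; lra.
have c0 : 0 <= cos (lam / 2) by apply: cos_ge0_pihalf; apply/andP; split; lra.
have cs := cos2Dsin2 (lam / 2).
have cl : cos lam = 1 - 2 * sin (lam / 2) ^+ 2.
  have e2 : lam = lam / 2 + lam / 2 by field.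
  by rewrite [in LHS]e2 cosD; nra.
have d0 : 0 < nsq (x - y).
  rewrite nsq_gt0 subr_eq0; apply: contraTneq xy => ->.
  by rewrite mul_conjE y1 Re_real -leNgt cos_le1.
pose V := cos (lam / 2) * (1 - Re p) + sin (lam / 2) * Im p.
have V0 : 0 < V.
  rewrite /V; move: p1 xy; rewrite -/p cl /nsq; move: (Re p) (Im p) => a b.
  move: (sin (lam / 2)) (cos (lam / 2)) cs s0 c0 => s c cs s0 c0 ab as2.
  rewrite ltNge; apply/negP => h.
  have h1 : c * (1 - a) <= - (s * b) by lra.
  have h2 : (c * (1 - a)) ^+ 2 <= (s * b) ^+ 2.
    rewrite -[leRHS]sqrrN ler_pXn2r ?nnegrE //; first by rewrite mulr_ge0 //; nra.
    by apply: le_trans h1; rewrite mulr_ge0 //; nra.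
  have h3 : (1 - a) * (2 * s ^+ 2 - (1 - a)) >= 0 by nra.
  have : 0 < 1 - a by nra.
  nra.
exists (2 * V / nsq (x - y)); first by rewrite divr_gt0 // mulr_gt0.
have dn : (x - y)^* != 0 by rewrite conjC_eq0 -nsq_gt0.
apply: (mulIf dn); rewrite -[RHS]mulrA mul_conjE -rmorphM /= divfK ?gt_eqF //.
have xx : x * x^* = 1 by rewrite mul_conjE x1.
have yy : y * y^* = 1 by rewrite mul_conjE y1.
have pc : y * x^* = p^* by rewrite /p rmorphM /= conjCK mulrC.
transitivity (expi (lam / 2) * (x * x^*) - expi (lam / 2) * p - expi (- (lam / 2)) * (y * x^*) + expi (- (lam / 2)) * (y * y^*)).
  by rewrite rmorphB /p; ring.
rewrite xx yy pc /V; case: (p) => a b.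
by apply: complex_eq; rewrite /= ?cosN ?sinN; ring.
Qed.

(** Lagrange interpolation of the kernel at the points zeta_j: there
F(exp(-i lam/2) zeta_j) = 0, so for lam > 0 the kernel is a multiple of F(exp(i lam) z_j),
and the quotient by the Lagrange denominator is a product of the ratios of [pair_ratio]. *)
Lemma positive_decomposition lam z : 0 <= lam -> m.+1%:R * lam < 2 * pi -> strict_spaced lam z ->
  exists c, exists rho : I -> R, [/\ c != 0, forall i, 0 < rho i &
   weighted m lam (pre m lam (prodX predT z)) =
     c *: \sum_i (((rho i)%:C)%C * (expi (lam / 2) * z i)) *:
       prodX (fun j => j != i) (fun j => expi (lam / 2) * z j)].
Proof.
move=> l0 ml sz; have [zu zs] := sz.
set W := weighted m lam _; pose ze i := expi (lam / 2) * z i.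
have szE : strict_spaced lam ze.
  have := strict_spaced_rot (nsq_expi (lam / 2)) sz.
  by rewrite (_ : (fun j => _) = ze) //; apply: funext => j; rewrite mulrC.
have inj := strict_spaced_inj szE.
have sI : size (index_enum I) = m.+1 by rewrite -sum1_size -[RHS](card_ord m.+1) -sum1_card; apply: eq_bigl.
have EW : W = \sum_k (W.[ze k] / \prod_(j | j != k) (ze k - ze j)) *: prodX (fun j => j != k) ze.
  apply: (@lagrange_decomp R m (index_enum I) ze W (index_enum_uniq _)).
    by move=> i j _ _; exact: inj.
  by rewrite sI; exact: size_weighted.
suff [c [rho [c0 r0 H]]] : exists c, exists rho : I -> R, [/\ c != 0, forall i, 0 < rho i &
    forall i, W.[ze i] / \prod_(j | j != i) (ze i - ze j) = c * (((rho i)%:C)%C * ze i)].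
  exists c, rho; split => //; rewrite EW scaler_sumr; apply: eq_bigr => i _.
  by rewrite H scalerA.
set F := prodX predT z.
have EF : weighted m.+1 lam (pre m lam F) = F.
  by rewrite weighted_pre // size_prodX card_ord.
have dz i : \prod_(j | j != i) (ze i - ze j) != 0.
  by apply/prodf_neq0 => j ji; rewrite subr_eq0; apply: contra ji => /eqP/inj ->.
have [l00|lp] := eqVneq lam 0.
  exists (- (m.+1%:R)^-1), (fun=> 1); split => //.
  move=> i; apply: (mulIf (dz i)); rewrite divfK //.
  have m0 : m.+1%:R != 0 :> C by rewrite pnatr_eq0.
  have zeE j : ze j = z j by rewrite /ze l00 mul0r expi0 mul1r.
  apply: (mulfI m0); have := weighted0_deriv m (pre m lam F) (z i).
  rewrite -l00 EF -/W zeE => ->.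
  rewrite /F (prodX_T i) derivM derivXsubC mul1r hornerD !hornerM hornerXsubC subrr !mul0r mulr0 addr0 sub0r.
  rewrite rmorph1 mul1r !mulNr mulrN !mulrA mulfV // mul1r; congr (- (_ * _)).
  rewrite /prodX horner_prod; apply: eq_bigr => j _.
  by rewrite hornerXsubC !zeE.
have {}lp : 0 < lam by rewrite lt_neqAle eq_sym lp.
set al := m.+1%:R * lam / 2.
have sal : 0 < sin al.
  by apply: sin_gt0_pi; rewrite /al; apply/andP; split; [rewrite divr_gt0 ?mulr_gt0 ?ltr0n|lra].
have lm : lam < 2 * pi.
  by apply: le_lt_trans ml; rewrite ler_peMl // ler1n.
have sl : 0 < sin (lam / 2) by apply: sin_gt0_pi; apply/andP; split; lra.
have Dx (x : R) : 0 < sin x -> expi x - expi (- x) != 0 :> C.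
  move=> sx; apply/eqP => /(congr1 Im)/eqP.
  by rewrite Im_add Im_opp /= sinN opprK -mulr2n mulrn_eq0 /= gt_eqF.
have rr i j : exists rho : R, j != i -> 0 < rho /\
    expi (lam / 2) * z i - expi (- (lam / 2)) * z j = (rho%:C)%C * (z i - z j).
  have [ji|ji] := eqVneq j i; first by exists 0.
  have m2 : (2 <= m.+1)%N.
    rewrite ltnS lt0n; apply: contraNneq ji => m0; apply/eqP/val_inj => /=.
    by have := ltn_ord i; have := ltn_ord j; lia.
  have l2 : 2 * lam < 2 * pi by apply: le_lt_trans ml; rewrite ler_wpM2r // ler_nat.
  have ij : i != j by rewrite eq_sym.
  have lpi : lam <= pi by lra.
  have [rho r0 E] := pair_ratio l0 lpi (zu i) (zu j) (zs i j ij).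
  by exists rho.
have rr' i : exists r : I -> R, forall j, j != i -> 0 < r j /\
    expi (lam / 2) * z i - expi (- (lam / 2)) * z j = ((r j)%:C)%C * (z i - z j).
  by have [r Hr] := choice (rr i); exists r.
have [r Hr] := choice rr'.
pose c : C := - expi (- al) * (expi (lam / 2) - expi (- (lam / 2))) / (expi al - expi (- al)).
exists c, (fun i => \prod_(j | j != i) r i j); split.
- by rewrite !mulf_neq0 ?invr_eq0 ?oppr_eq0 ?expi_neq0 ?Dx.
- by move=> i; apply: prodr_gt0 => j /Hr[].
move=> i; apply: (mulIf (dz i)); rewrite divfK //.
apply: (mulfI (Dx _ sal)).
have hm := weighted_minus m lam (pre m lam F) (ze i).
have hp := weighted_plus m lam (pre m lam F) (ze i).
rewrite EF -/W -/al /ze mulrA expiNl mul1r in hm; rewrite EF -/W -/al in hp.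
have F0 : F.[z i] = 0.
  by rewrite /F (prodX_T i) hornerM hornerXsubC subrr mul0r.
rewrite F0 -/(ze i) in hm.
have -> : (expi al - expi (- al)) * W.[ze i] = - expi (- al) * F.[expi (lam / 2) * ze i].
  rewrite hp; set B := _ * (weighted _ _ _).[_] in hm *.
  have hm' : expi al * (W.[ze i] + expi (- al) * B) = 0 by rewrite -hm mulr0.
  rewrite mulrDr mulrA expiNr mul1r in hm'.
  have -> : (expi al - expi (- al)) * W.[ze i] = (expi al * W.[ze i] + B) - (expi (- al) * W.[ze i] + B) by ring.
  rewrite hm' sub0r mulNr; congr (- _); rewrite mulrDr mulrA expiNl mul1r //.
have dal := Dx _ sal.
have -> : F.[expi (lam / 2) * ze i] = (expi (lam / 2) - expi (- (lam / 2))) * ze i *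
   \prod_(j | j != i) (expi (lam / 2) * ze i - z j).
  rewrite /F (prodX_T i) hornerM hornerXsubC /prodX horner_prod; congr (_ * _).
    by rewrite mulrBl; congr (_ - _); rewrite /ze mulrA expiNl mul1r.
  by apply: eq_bigr => j _; rewrite hornerXsubC.
have -> : \prod_(j | j != i) (expi (lam / 2) * ze i - z j) =
   ((\prod_(j | j != i) r i j)%:C)%C * \prod_(j | j != i) (ze i - ze j).
  rewrite rmorph_prod -big_split; apply: eq_bigr => j /Hr[_ E] /=.
  have -> : ze i - ze j = expi (lam / 2) * (z i - z j) by rewrite mulrBr.
  by rewrite [RHS]mulrCA -E mulrBr (mulrA _ _ (z j)) expiNr mul1r.
rewrite /c; set q := \prod_(j | _) (ze i - ze j); set p := (_%:C)%C; move: dal.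
set d := expi al - _ => d0; set b := expi (lam / 2) - _.
transitivity (d / d * (- expi (- al) * (b * ze i * (p * q)))); last by ring.
by rewrite divff // mul1r.
Qed.

End ResiduePositivity.

(** * Kernels of products and wider spacing *)

Section KernelProducts.
Variable R : realType.
Local Notation C := R[i].
Local Notation Re := (@complex.Re R).
Local Notation Im := (@complex.Im R).
Variable m : nat.
Local Notation I := 'I_m.+1.
Implicit Types (lam t s mu : R) (f g F G P A B r q : {poly C}) (u v w c : C) (z : I -> C) (i j k : I) (phi theta : nat -> R).

Lemma geometric_coef f b : (forall k : nat, (k <= m)%N -> f`_k.+1 = b * f`_k) ->
  forall k : nat, (k <= m.+1)%N -> f`_k = f`_0 * b ^+ k.
Proof.
move=> H; elim=> [|k IH] km; first by rewrite mulr1.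
by rewrite H // IH ?(ltnW km) // exprS mulrCA.
Qed.

(** The positive decomposition of the kernel of g turns the kernel of f g into a
positive combination of numbers in one half plane, or on one ray at a zero of the common
kernel K.  If f is a geometric progression, the kernel of f g is a rotation of that of g. *)
Lemma product_zfree lam f g : 0 <= lam -> m.+1%:R * lam < 2 * pi ->
  weakT m lam f -> strictT m lam g -> zfree_closed (weighted m lam (had m.+2 f g)).
Proof.
move=> l0 ml wf sg; have [sf [eps se] f0 zf] := wf; have [szg _ _ zg] := sg.
have [a [z [a0 zu E]]] := unit_zeros l0 ml (strictT_weakT sg).
have sz := strictT_strict_spaced l0 ml sg a0 zu E.
pose ze i := expi (lam / 2) * z i.
have szE : strict_spaced lam ze.
  have := strict_spaced_rot (nsq_expi (lam / 2)) sz.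
  by rewrite (_ : (fun j => _) = ze) //; apply: funext => j; rewrite mulrC.
have zeu := proj1 szE.
have wz := weakT_deleted_zfree l0 ml wf.
have EW : weighted m lam (had m.+2 f g) = had m.+1 f (weighted m lam g).
  apply/polyP => k; rewrite coef_had !coef_poly; case: ltnP => // km.
  by rewrite (ltn_trans km (ltnSn _)) mulrCA.
have [geo|nogeo] := pselect (exists2 b : C, nsq b = 1 & forall k : nat, (k <= m)%N -> f`_k.+1 = b * f`_k).
  have [b b1 H] := geo; move=> u u1.
  have -> : (weighted m lam (had m.+2 f g)).[u] = f`_0 * (weighted m lam g).[b * u].
    rewrite EW hadE weighted_had hadE mulr_sumr; apply: eq_bigr => k _.
    have km : (k < m.+1)%N := ltn_ord k.
    rewrite coef_had km (geometric_coef H (ltnW km)) exprMn; ring.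
  by rewrite mulf_neq0 // zg // nsqM b1 mul1r.
have [c [rho [c0 r0 H]]] := positive_decomposition l0 ml sz.
have Az j : zfree_closed (had m.+1 f (prodX (fun i => i != j) ze)).
  by have [//|] := strict_contact j se wz f0 szE.
pose A j u := ze j * (had m.+1 f (prodX (fun i => i != j) ze)).[u].
have EA u : (weighted m lam (had m.+2 f g)).[u] =
   a * c * \sum_j ((rho j)%:C)%C * A j u.
  have gE : weighted m lam g = a *: weighted m lam (pre m lam (prodX predT z)).
    rewrite -{1}(pre_weighted l0 ml szg) E preZ; apply/polyP => k.
    rewrite coefZ !coef_poly; case: ltnP => km; rewrite ?mulr0 // coefZ mulrCA; congr (_ * (_ * _)).
    by rewrite coef_poly.
  rewrite EW gE H scalerA hadZ hornerZ had_sum horner_sum; congr (_ * _).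
  by apply: eq_bigr => j _; rewrite hadZ hornerZ -mulrA.
set K := had m.+2 f (prodX predT ze).
pose B j u := u * (had m.+1 (shiftc f) (prodX (fun i => i != j) ze)).[u].
have EK j u : K.[u] = B j u - A j u.
  by rewrite /K (kernel_split j) hornerD hornerN hornerM hornerX hornerZ.
have BA j u : nsq u <= 1 -> nsq (B j u) <= nsq u * nsq (A j u).
  have -> : nsq (A j u) = nsq (had m.+1 f (prodX (fun i => i != j) ze)).[u].
    by rewrite /A nsqM zeu mul1r.
  move=> u1; rewrite /B nsqM ler_wpM2l ?nsq_ge0 //.
  have [d d1 Ed] := inv_prodX j zeu.
  have zo : zfree_open (had m.+1 f (prodX (fun i => i != j) ze)).
    by move=> v v1; apply: Az; exact: ltW.
  have := inv_le (size_had _ _ _) zo u1.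
  by rewrite (inv_had_sinv se Ed) hornerZ nsqM nsqM d1 (proj1 se) !mul1r.
have A0 j u : nsq u <= 1 -> 0 < nsq (A j u).
  by move=> u1; rewrite /A nsqM zeu mul1r nsq_gt0 Az.
move=> u u1; rewrite EA !mulf_neq0 //; apply/eqP => S0.
have [K0|K0] := eqVneq K.[u] 0.
  have uu : nsq u = 1.
    apply/eqP; rewrite eq_le u1 leNgt; apply/negP => u2.
    have := BA ord0 u u1; have -> : B ord0 u = A ord0 u.
      by apply/eqP; rewrite -subr_eq0 -EK K0.
    by rewrite leNgt gtr_pMl ?u2 // A0.
  have zo j : zfree_open (had m.+1 f (prodX (fun i => i != j) ze)).
    by move=> v v1; apply: Az; exact: ltW.
  have [be Hb] := pos_all se zeu zo uu K0.
  move: S0; have -> : \sum_j (rho j)%:C%C * A j u =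
     ((\sum_j rho j * be j)%:C)%C * (u * K^`().[u]).
    rewrite rmorph_sum mulr_suml; apply: eq_bigr => j _ /=.
    by rewrite /A (proj2 (Hb j)) rmorphM /= -mulrA.
  have := A0 ord0 u u1; rewrite nsq_gt0 /A (proj2 (Hb ord0)) mulf_eq0 negb_or => /andP[b0 k0].
  have bp : 0 < be ord0.
    rewrite lt_neqAle (proj1 (Hb ord0)) andbT eq_sym.
    by apply: contra b0 => /eqP ->.
  move/eqP; rewrite mulf_eq0 (negbTE k0) orbF -nsq_eq0 nsq_real expf_eq0 /=.
  apply/negP; rewrite gt_eqF // (bigD1 ord0) //= ltr_pwDl ?mulr_gt0 //.
  by apply: sumr_ge0 => j _; rewrite mulr_ge0 ?(ltW (r0 j)) //; exact: (proj1 (Hb j)).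
have kp : 0 < nsq K.[u] by rewrite nsq_gt0.
have pj j : 0 < Re (- A j u * (K.[u])^*).
  have := @half_plane_pair R (B j u) (A j u); rewrite -EK => h.
  have : nsq (B j u) <= nsq (A j u).
    by apply: le_trans (BA j u u1) _; rewrite ler_piMl ?nsq_ge0.
  by move=> /h; lra.
have : Re (- (\sum_j (rho j)%:C%C * A j u) * (K.[u])^*) = \sum_j rho j * Re (- A j u * (K.[u])^*).
  rewrite -sumrN mulr_suml Re_sum; apply: eq_bigr => j _.
  by rewrite -mulrN -mulrA Re_realM.
rewrite S0 oppr0 mul0r => /esym/eqP; apply/negP; rewrite gt_eqF //.
rewrite (bigD1 ord0) //= ltr_pwDl ?mulr_gt0 //.
by apply: sumr_ge0 => j _; rewrite ltW // mulr_gt0.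
Qed.

(** The kernel at mu belongs to a configuration with gaps mu, which is strictly
lam-spaced. *)
Lemma wider_zfree lam mu f : 0 <= lam -> m.+1%:R * lam < 2 * pi -> weakT m lam f ->
  lam < mu -> m.+1%:R * mu <= 2 * pi ->
  zfree_closed (weighted m mu f) \/
  exists2 b, nsq b = 1 & forall k : nat, (k <= m)%N -> f`_k.+1 = b * f`_k.
Proof.
move=> l0 ml wf lm mm; have [sf [eps se] f0 zf] := wf.
have mu0 : 0 <= mu by apply: ltW; apply: le_lt_trans lm.
have sz := svalid_strict_spaced l0 (nsq1 R) (valid_svalid lm (equal_valid mu0 mm)).
have [h|] := strict_contact ord0 se (weakT_deleted_zfree l0 ml wf) f0 sz; last by right.
by left; apply: (zfree_Qpoly (Q := @zfree_closed R)); [right|].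
Qed.

End KernelProducts.

(** * The classes as domination of kernels *)

Section Domination.
Variable R : realType.
Local Notation C := R[i].
Local Notation Re := (@complex.Re R).
Local Notation Im := (@complex.Im R).
Variable m : nat.
Local Notation I := 'I_m.+1.
Local Notation star := (n_inverse m.+1).
Implicit Types (lam t s mu : R) (f g F G P A B r q : {poly C}) (u v w c : C) (z : C) (k : nat).

Lemma inv_weighted_shiftc lam f : 0 <= lam -> m%:R * lam < 2 * pi ->
  n_inverse m (weighted m lam (shiftc f)) = weighted m lam (star f).
Proof.
move=> l0 ml; apply/polyP => k; rewrite coef_inv [in RHS]coef_poly; case: ltnP => // km.
rewrite coef_poly coef_inv.
have km' : (k < m.+2)%N by rewrite ltnW.
by rewrite ltnS leq_subr km' coef_shiftc rmorphM /= Qcoef_conj // Qcoef_sym // subSn.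
Qed.

Lemma inv_weighted_star lam f : 0 <= lam -> m%:R * lam < 2 * pi ->
  n_inverse m (weighted m lam f) = weighted m lam (shiftc (star f)).
Proof.
move=> l0 ml; apply/polyP => k; rewrite coef_inv [in RHS]coef_poly; case: ltnP => // km.
rewrite coef_poly.
by rewrite ltnS leq_subr coef_shiftc coef_inv ltnS km subSS rmorphM /= Qcoef_conj // Qcoef_sym.
Qed.

Lemma weighted_at0 lam f : (weighted m lam f).[0] = f`_0.
Proof. by rewrite horner_coef0 coef_poly Qcoef0 mul1r. Qed.

Lemma star_coef0 f : (star f)`_0 = (f`_m.+1)^*.
Proof. by rewrite coef_inv subn0. Qed.

(** The n-inverses of the two halves of F are the halves of F*, in exchanged
order. *)
Lemma flip_ineq lam f z : 0 <= lam -> m%:R * lam < 2 * pi -> z != 0 ->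
  (nsq (weighted m lam f).[z] < nsq (z * (weighted m lam (shiftc f)).[z])) =
  (nsq ((z^*)^-1 * (weighted m lam (shiftc (star f))).[(z^*)^-1]) <
   nsq (weighted m lam (star f)).[(z^*)^-1]).
Proof.
move=> l0 ml z0; set u := (z^*)^-1.
have hA := inv_horner (size_weighted m lam f) z0.
have hD := inv_horner (size_weighted m lam (shiftc f)) z0.
rewrite (inv_weighted_star f l0 ml) -/u in hA.
rewrite (inv_weighted_shiftc f l0 ml) -/u in hD.
have z1 : 0 < nsq z by rewrite nsq_gt0.
rewrite -(nsq_conj (weighted m lam f).[z]) -hA nsqM nsqM.
rewrite -(nsq_conj (weighted m lam (shiftc f)).[z]) -hD nsqM mulrA nsqX nsq_conj.
rewrite ltr_pM2r ?exprn_gt0 //.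
by rewrite [in RHS]nsqM /u nsqV nsq_conj -[in RHS](ltr_pM2l z1) mulVKf // gt_eqF.
Qed.

(** The pre-coefficient form of the open part of D_n(lam), see [classD_open]. *)
Definition dominated lam f := forall u, nsq u <= 1 ->
  nsq (weighted m lam f).[u] < nsq (weighted m lam (star f)).[u].

Lemma outer_flip lam f (Om : set C) : 0 <= lam -> m%:R * lam < 2 * pi -> f`_m.+1 != 0 ->
  (forall z, Om z -> z != 0) ->
  (forall z, Om z -> nsq (weighted m lam f).[z] < nsq (z * (weighted m lam (shiftc f)).[z])) <->
  (forall u, u = 0 \/ Om (u^*)^-1 ->
    nsq (u * (weighted m lam (shiftc (star f))).[u]) < nsq (weighted m lam (star f)).[u]).
Proof.
have inv2 z : (((z^*)^-1)^*)^-1 = z by rewrite fmorphV /= conjCK invrK.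
move=> l0 ml fn Om0; split=> H => [u [->|Ou]|z Oz].
- by rewrite mul0r nsq0 nsq_gt0 weighted_at0 star_coef0 conjC_eq0.
- by have := H _ Ou; rewrite (flip_ineq f l0 ml (Om0 _ Ou)) inv2.
- by rewrite (flip_ineq f l0 ml (Om0 _ Oz)); apply: H; right; rewrite inv2.
Qed.

Lemma outer_flip_closed lam f : 0 <= lam -> m%:R * lam < 2 * pi -> f`_m.+1 != 0 ->
  (forall z, 1 <= nsq z -> nsq (weighted m lam f).[z] < nsq (z * (weighted m lam (shiftc f)).[z])) <->
  (forall u, nsq u <= 1 -> nsq (u * (weighted m lam (shiftc (star f))).[u]) < nsq (weighted m lam (star f)).[u]).
Proof.
move=> l0 ml fn; rewrite (@outer_flip lam f [set z | 1 <= nsq z]) //; last first.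
  by move=> z z1; rewrite -nsq_gt0 (lt_le_trans ltr01).
split=> H u u1; apply: H; last first.
  case: u1 => [->|]; rewrite ?nsq0 //= nsqV nsq_conj; have [->|u0] := eqVneq u 0.
    by rewrite nsq0.
  by rewrite invf_ge1 // nsq_gt0.
have [->|u0] := eqVneq u 0; [by left|right].
by rewrite /= nsqV nsq_conj invf_ge1 // nsq_gt0.
Qed.

Lemma outer_flip_open lam f : 0 <= lam -> m%:R * lam < 2 * pi -> f`_m.+1 != 0 ->
  (forall z, 1 < nsq z -> nsq (weighted m lam f).[z] < nsq (z * (weighted m lam (shiftc f)).[z])) <->
  (forall u, nsq u < 1 -> nsq (u * (weighted m lam (shiftc (star f))).[u]) < nsq (weighted m lam (star f)).[u]).
Proof.
move=> l0 ml fn; rewrite (@outer_flip lam f [set z | 1 < nsq z]) //; last first.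
  by move=> z z1; rewrite -nsq_gt0 (lt_trans ltr01).
split=> H u u1; apply: H; last first.
  case: u1 => [->|]; rewrite ?nsq0 //= nsqV nsq_conj; have [->|u0] := eqVneq u 0.
    by rewrite nsq0.
  by rewrite invf_gt1 // nsq_gt0.
have [->|u0] := eqVneq u 0; [by left|right].
by rewrite /= nsqV nsq_conj invf_gt1 // nsq_gt0.
Qed.

Lemma halves_circle lam f u : 0 <= lam -> m%:R * lam < 2 * pi -> nsq u = 1 ->
  nsq (u * (weighted m lam (shiftc (star f))).[u]) = nsq (weighted m lam f).[u].
Proof.
move=> l0 ml u1; rewrite nsqM u1 mul1r -inv_weighted_star //.
by rewrite inv_unit ?size_weighted // nsqM nsqX u1 expr1n mul1r nsq_conj.
Qed.

Lemma zfree_closed_gt (a : C -> R) P :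
  (forall u, 0 <= a u) -> (forall u, nsq u <= 1 -> a u < nsq P.[u]) -> zfree_closed P.
Proof. by move=> a0 H u u1; rewrite -nsq_gt0 (le_lt_trans (a0 u)) ?H. Qed.

Lemma inner_dominated lam f : 0 <= lam -> m%:R * lam < 2 * pi ->
  (forall u, nsq u <= 1 -> nsq (u * (weighted m lam (shiftc (star f))).[u]) < nsq (weighted m lam (star f)).[u])
  <-> dominated lam f.
Proof.
move=> l0 ml; split=> H.
  apply: max_principle.
    by apply: zfree_closed_gt H => u; exact: nsq_ge0.
  by move=> u u1; rewrite -halves_circle // H // u1.
have zc : zfree_closed (weighted m lam (star f)).
  by apply: zfree_closed_gt H => u; exact: nsq_ge0.
move=> u u1; have := @max_principle R ('X * weighted m lam (shiftc (star f))) _ zc _ u u1.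
rewrite hornerM hornerX; apply=> v v1.
by rewrite hornerM hornerX halves_circle // H // v1.
Qed.

Lemma dominated_lead lam f : dominated lam f -> f`_m.+1 != 0.
Proof.
move=> /(_ 0); rewrite nsq0 ler01 => /(_ isT).
rewrite !weighted_at0 star_coef0 nsq_conj => h.
by rewrite -nsq_gt0 (le_lt_trans _ h) // nsq_ge0.
Qed.

(** On the circle the half u D_f* has the modulus of A_f, so by the maximum
principle it may be replaced by A_f in the closed disc. *)
Lemma outer_dominated lam f : 0 <= lam -> m%:R * lam < 2 * pi ->
  (f`_m.+1 != 0 /\ forall z, 1 <= nsq z ->
     nsq (weighted m lam f).[z] < nsq (z * (weighted m lam (shiftc f)).[z])) <->
  dominated lam f.
Proof.
move=> l0 ml; split.
  by case=> fn /(outer_flip_closed l0 ml fn)/(inner_dominated f l0 ml).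
move=> H; have fn := dominated_lead H; split => //.
by apply/(outer_flip_closed l0 ml fn)/(inner_dominated f l0 ml).
Qed.

Lemma size_weighted_full lam f : (size (weighted m.+1 lam f) == m.+2) = (f`_m.+1 != 0).
Proof.
apply/idP/idP => [/eqP s|fn].
  have : lead_coef (weighted m.+1 lam f) != 0 by rewrite lead_coef_eq0 -size_poly_eq0 s.
  by rewrite lead_coefE s coef_poly ltnSn Qcoef_last mul1r.
rewrite eqn_leq size_weighted ltnNge; apply/negP => /leq_sizeP/(_ m.+1 (leqnn _)).
by rewrite coef_poly ltnSn Qcoef_last mul1r => /eqP; rewrite (negbTE fn).
Qed.

(** The imaginary part is sin(al) (|b|^2 - |a|^2) divided by the squared modulus
of the denominator. *)
Lemma im_pos_point (al : R) (a b : C) : 0 < sin al ->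
  (0 < Im (expi (- al) * ((a + expi al * b) / (a + expi (- al) * b)))) = (nsq a < nsq b).
Proof.
move=> sal; set d := a + expi (- al) * b.
have [d0|d0] := eqVneq d 0.
  rewrite d0 invr0 !mulr0 ltxx; have -> : a = - (expi (- al) * b).
    by apply/eqP; rewrite -addr_eq0 -/d d0.
  by rewrite nsqN nsqM nsq_expi mul1r ltxx.
have -> : expi (- al) * ((a + expi al * b) / d) =
    (((nsq d)^-1)%:C)%C * (expi (- al) * (a + expi al * b) * d^*).
  apply: (mulIf d0); rewrite mulrA divfK //.
  transitivity (((nsq d)^-1%:C)%C * (d * d^*) * (expi (- al) * (a + expi al * b))); last by ring.
  by rewrite mul_conjE -rmorphM mulVf ?nsq_eq0 // rmorph1 mul1r.
rewrite Im_realM pmulr_rgt0 ?invr_gt0 ?nsq_gt0 // mulrDr mulrA expiNl mul1r.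
have -> : Im ((expi (- al) * a + b) * d^*) = sin al * (nsq b - nsq a).
  rewrite /d; case: (a) => x y; case: (b) => x' y'.
  move: (cos2Dsin2 al); rewrite /nsq /= !cosN !sinN; move: (cos al) (sin al) => p q pq.
  apply: subr0_eq; transitivity ((p ^+ 2 + q ^+ 2 - 1) * (y * x' - x * y')); first by ring.
  by rewrite pq subrr mul0r.
by rewrite pmulr_rgt0 // subr_gt0.
Qed.

Lemma sin_alpha lam : 0 < lam -> m.+1%:R * lam < 2 * pi -> 0 < sin (m.+1%:R * lam / 2).
Proof.
move=> lp ml; apply: sin_gt0_pi; apply/andP; split; last lra.
by rewrite divr_gt0 // mulr_gt0 // ltr0n.
Qed.

Lemma im_pos_weighted lam f (Om : set C) : 0 < lam -> m.+1%:R * lam < 2 * pi ->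
  im_pos_on m.+1 lam Om (weighted m.+1 lam f) <->
  f`_m.+1 != 0 /\ forall z, Om z ->
     nsq (weighted m lam f).[z] < nsq (z * (weighted m lam (shiftc f)).[z]).
Proof.
move=> lp ml; have sal := sin_alpha lp ml; rewrite /im_pos_on /=.
split=> -[h1 h2]; split.
- by move: h1 => /eqP; rewrite size_weighted_full.
- by move=> z Oz; have := h2 z Oz; rewrite weighted_plus weighted_minus im_pos_point.
- by apply/eqP; rewrite size_weighted_full.
- by move=> z Oz; rewrite weighted_plus weighted_minus im_pos_point //; exact: h2.
Qed.

End Domination.

(** * Translation of the three classes *)

Section ClassTranslation.
Variable R : realType.
Local Notation C := R[i].
Local Notation Re := (@complex.Re R).
Local Notation Im := (@complex.Im R).
Variable m : nat.
Local Notation I := 'I_m.+1.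
Local Notation star := (n_inverse m.+1).
Implicit Types (lam t s mu : R) (f g F G P A B q : {poly C}) (u v w c : C) (z : C) (k : nat).

Lemma logderiv_cons P x z :
  2 * Re (z * (('X - x%:P) * P)^`().[z] * ((('X - x%:P) * P).[z])^*) =
  nsq P.[z] * (2 * Re (z * (z - x)^*)) +
  nsq (z - x) * (2 * Re (z * P^`().[z] * (P.[z])^*)).
Proof.
rewrite derivM derivXsubC mul1r hornerD !hornerM hornerXsubC.
have -> : z * (P.[z] + (z - x) * P^`().[z]) * ((z - x) * P.[z])^* =
   ((nsq P.[z])%:C)%C * (z * (z - x)^*) + ((nsq (z - x))%:C)%C * (z * P^`().[z] * (P.[z])^*).
  by rewrite rmorphM /= -!mul_conjE; ring.
by rewrite Re_add !Re_realM; ring.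
Qed.

(** Re (z/(z - x)) > 1/2 for |x| < |z|: the contribution of one zero to the
logarithmic derivative. *)
Lemma half_plane_shift x z : nsq x < nsq z -> nsq (z - x) < 2 * Re (z * (z - x)^*).
Proof.
have : nsq x = nsq (z - (z - x)) by congr nsq; ring.
rewrite nsqD nsqN rmorphN mulrN Re_opp => e; lra.
Qed.

Lemma logderiv_list_le (r : seq C) z : (forall x, x \in r -> nsq x < nsq z) ->
  (size r)%:R * nsq (\prod_(x <- r) ('X - x%:P)).[z] <=
  2 * Re (z * (\prod_(x <- r) ('X - x%:P))^`().[z] * ((\prod_(x <- r) ('X - x%:P)).[z])^*).
Proof.
elim: r => [|x r IH] H; first by rewrite big_nil mul0r derivC horner0 mulr0 mul0r mulr0.
have {}IH := IH (fun y yr => H y (mem_behead (s := x :: r) yr)).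
have hx := ltW (half_plane_shift (H x (mem_head _ _))).
rewrite big_cons logderiv_cons; move: IH; set P := \prod_(y <- r) _ => IH.
have -> : (size (x :: r))%:R = (size r)%:R + 1 :> R by rewrite natr1.
rewrite hornerM hornerXsubC nsqM mulrDl mul1r addrC.
apply: lerD; first by rewrite mulrC ler_wpM2l ?nsq_ge0.
by rewrite mulrCA ler_wpM2l ?nsq_ge0.
Qed.

Lemma logderiv_list_lt (r : seq C) z : (0 < size r)%N -> (forall x, x \in r -> nsq x < nsq z) ->
  (size r)%:R * nsq (\prod_(x <- r) ('X - x%:P)).[z] <
  2 * Re (z * (\prod_(x <- r) ('X - x%:P))^`().[z] * ((\prod_(x <- r) ('X - x%:P)).[z])^*).
Proof.
case: r => [//|x r] _ H.
have IH := logderiv_list_le (fun y yr => H y (mem_behead (s := x :: r) yr)).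
have hx := half_plane_shift (H x (mem_head _ _)).
have P0 : 0 < nsq (\prod_(y <- r) ('X - y%:P)).[z].
  rewrite nsq_gt0 -rootE root_prod_XsubC; apply/negP => zr.
  by have := H z (mem_behead (s := x :: r) zr); rewrite ltxx.
rewrite big_cons logderiv_cons; move: IH P0; set P := \prod_(y <- r) _ => IH P0.
have -> : (size (x :: r))%:R = (size r)%:R + 1 :> R by rewrite natr1.
rewrite hornerM hornerXsubC nsqM mulrDl mul1r addrC ltr_leD //.
  by rewrite mulrC ltr_pM2l.
by rewrite mulrCA ler_wpM2l ?nsq_ge0.
Qed.

Lemma halves0 f z : (weighted m.+1 (0 : R) f).[z] =
  (weighted m 0 f).[z] + z * (weighted m 0 (shiftc f)).[z].
Proof. by have := weighted_plus m 0 f z; rewrite mul0r mulr0 mul0r expi0 !mul1r. Qed.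

(** Here A_f = F - zF'/n and z D_f = zF'/n, so the inequality says
2 Re (zF'/F) > n.  The hypothesis on Om lets one proof cover the open and the closed
disc. *)
Lemma zeros_in_weighted f (Om : set C) :
  (forall z w, Om z -> ~ Om w -> nsq w < nsq z) ->
  zeros_in m.+1 (~` Om) (weighted m.+1 0 f) <->
  f`_m.+1 != 0 /\ forall z, Om z ->
     nsq (weighted m 0 f).[z] < nsq (z * (weighted m 0 (shiftc f)).[z]).
Proof.
move=> HOm; rewrite /zeros_in /=; split=> -[h1 h2]; split.
- by move: h1 => /eqP; rewrite size_weighted_full.
- move=> z Oz; set F := weighted m.+1 0 f in h1 h2.
  have F0 : F != 0 by rewrite -size_poly_eq0 h1.
  have [r E] := poly_factor F.
  have sr : size r = m.+1 by apply/eqP; rewrite -eqSS -(size_factor F0 E) h1.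
  have Hr x : x \in r -> nsq x < nsq z.
    move=> xr; apply: HOm => //; apply: h2.
    by rewrite E rootE hornerZ mulf_eq0 -[X in _ || X]rootE root_prod_XsubC xr orbT.
  have := logderiv_list_lt _ Hr; rewrite sr => /(_ isT).
  set P := \prod_(x <- r) _ in E *; move=> hP.
  have lc : 0 < nsq (lead_coef F) by rewrite nsq_gt0 lead_coef_eq0.
  have hF : m.+1%:R * nsq F.[z] < 2 * Re (z * F^`().[z] * (F.[z])^*).
    have -> : z * F^`().[z] * (F.[z])^* = ((nsq (lead_coef F))%:C)%C * (z * P^`().[z] * (P.[z])^*).
      rewrite -mul_conjE [in F^`()]E [in F.[z]]E derivZ !hornerZ rmorphM /=; ring.
    rewrite [in nsq F.[z]]E hornerZ nsqM Re_realM mulrCA [ltRHS]mulrCA.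
    by rewrite ltr_pM2l.
  have e1 := weighted0_deriv m f z; have e2 := halves0 f z; rewrite -/F in e1 e2.
  set A := (weighted m 0 f).[z] in e1 e2 *; set B := z * _ in e2 *.
  have eB : z * F^`().[z] = ((m.+1%:R : R)%:C)%C * B.
    rewrite rmorph_nat; have -> : z * F^`().[z] = m.+1%:R * F.[z] - m.+1%:R * A by rewrite e1; ring.
    by rewrite e2; ring.
  move: hF; rewrite eB -mulrA Re_realM mulrCA ltr_pM2l ?ltr0n // e2 rmorphD mulrDr Re_add.
  rewrite mul_conjE Re_real nsqD (Re_mulC B A) /= => h; lra.
- by apply/eqP; rewrite size_weighted_full.
- move=> z /eqP rz Oz; have := h2 z Oz; have := halves0 f z; rewrite rz => /esym/eqP.
  by rewrite addr_eq0 => /eqP ->; rewrite nsqN ltxx.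
Qed.

Lemma class_outer lam f (Om : set C) : 0 <= lam -> m.+1%:R * lam < 2 * pi ->
  (forall z w, Om z -> ~ Om w -> nsq w < nsq z) ->
  (if lam == 0 then zeros_in m.+1 (~` Om) else im_pos_on m.+1 lam Om) (weighted m.+1 lam f) <->
  f`_m.+1 != 0 /\ forall z, Om z ->
     nsq (weighted m lam f).[z] < nsq (z * (weighted m lam (shiftc f)).[z]).
Proof.
move=> l0 ml HOm; have [->|lp] := eqVneq lam 0; first exact: zeros_in_weighted.
by apply: im_pos_weighted => //; rewrite lt_neqAle eq_sym lp.
Qed.

Lemma classDbarP lam f : 0 <= lam -> m.+1%:R * lam < 2 * pi ->
  classDbar m.+1 lam (weighted m.+1 lam f) <-> f`_m.+1 != 0 /\
  (forall u, nsq u < 1 -> nsq (u * (weighted m lam (shiftc (star f))).[u]) < nsq (weighted m lam (star f)).[u]).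
Proof.
move=> l0 ml; have ml' := ml_le l0 ml.
have E : [set z : C | `|z| <= 1] = ~` [set z : C | 1 < `|z|].
  by apply/seteqP; split => z /=; rewrite norm_le1 norm_gt1 leNgt => /negP.
rewrite /classDbar E class_outer //; last first.
  move=> z w /=; rewrite !norm_gt1 => h1 /negP; rewrite -leNgt => h2.
  exact: le_lt_trans h1.
split=> -[fn H]; split => //.
  by apply/(outer_flip_open l0 ml' fn) => z z1; apply: H; rewrite /= norm_gt1.
by move=> z; rewrite /= norm_gt1; move: z; apply/(outer_flip_open l0 ml' fn).
Qed.

Lemma classD_open lam f : 0 <= lam -> m.+1%:R * lam < 2 * pi ->
  (if lam == 0 then zeros_in m.+1 [set z : C | `|z| < 1]
   else im_pos_on m.+1 lam [set z : C | 1 <= `|z|]) (weighted m.+1 lam f) <->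
  dominated m lam f.
Proof.
move=> l0 ml; have ml' := ml_le l0 ml.
have E : [set z : C | `|z| < 1] = ~` [set z : C | 1 <= `|z|].
  by apply/seteqP; split => z /=; rewrite norm_lt1 norm_ge1 ltNge => /negP.
rewrite E class_outer //; last first.
  move=> z w /=; rewrite !norm_ge1 => h1 /negP; rewrite -ltNge => h2.
  exact: lt_le_trans h1.
rewrite -(outer_dominated f l0 ml').
split=> -[fn H]; split => // z; first by move=> z1; apply: H; rewrite /= norm_ge1.
by rewrite /= norm_ge1; exact: H.
Qed.

Lemma angle_cos lam (x y : C) : 0 <= lam -> lam <= pi -> nsq x = 1 -> nsq y = 1 ->
  (lam < angle x y) = (Re (x * y^*) < cos lam).
Proof.
move=> l0 lpi x1 y1; rewrite /angle.
have : nsq (x * y^*) = 1 by rewrite nsqM nsq_conj x1 y1 mulr1.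
set r := Re _; rewrite /nsq -/r => h.
have r1 : -1 <= r <= 1.
  rewrite -ler_norml -(@ler_pXn2r _ 2) ?nnegrE // real_normK ?num_real // expr1n.
  by rewrite -h lerDl sqr_ge0.
rewrite -[in RHS](acosK (x := r)) ?in_itv //= ltr_cos ?in_itv //= ?l0 //.
by rewrite acos_ge0 // acos_lepi.
Qed.

Lemma strictT_scale lam g c : c != 0 -> strictT m lam g -> strictT m lam (c *: g).
Proof.
move=> c0 [h1 [eps h2] h3 h4]; split.
- exact: leq_trans (size_scale_leq _ _) h1.
- exists (c^* / c * eps); split.
    by rewrite !nsqM nsqV nsq_conj divff ?nsq_eq0 // (proj1 h2) mulr1.
  by move=> k km; rewrite !coefZ rmorphM /= (proj2 h2 k km) mulrACA divfK // mulrA.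
- by rewrite coefZ mulf_neq0.
- by move=> u u1; rewrite weighted_had hadZl hornerZ mulf_neq0 // -weighted_had h4.
Qed.

Lemma classTP lam f : 0 <= lam -> m.+1%:R * lam < 2 * pi -> (size f <= m.+2)%N ->
  classT m.+1 lam (weighted m.+1 lam f) <-> strictT m lam f.
Proof.
move=> l0 ml sf.
have lpi (i j : I) : i != j -> lam <= pi.
  move=> ij; have m2 : (2 <= m.+1)%N.
    rewrite ltnS lt0n; apply: contraNneq ij => m0; apply/eqP/val_inj => /=.
    by have := ltn_ord i; have := ltn_ord j; lia.
  have : 2 * lam < 2 * pi by apply: le_lt_trans ml; rewrite ler_wpM2r // ler_nat.
  lra.
split=> [[sF [zs [E zu zp]]]|sTf].
  set F := weighted m.+1 lam f in sF E.
  have F0 : F != 0 by rewrite -size_poly_eq0 sF.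
  have sr : size zs = m.+1 by apply/eqP; rewrite -eqSS -(size_factor F0 E) sF.
  pose z (i : I) := nth 0 zs i.
  have zn i : nsq (z i) = 1.
    by apply/eqP; rewrite -norm1_nsq zu // mem_nth // sr.
  have szp : strict_spaced lam z.
    split => // i j ij; have H (i' j' : I) : (i' < j')%N -> Re (z i' * (z j')^*) < cos lam.
      move=> h; rewrite -angle_cos //.
        by move/(pairwiseP 0): zp; apply; rewrite // inE sr.
      by apply: (lpi i' j'); rewrite neq_ltn h.
    move: ij; rewrite neq_ltn => /orP[]; first exact: H.
    by move=> h; rewrite Re_mulC; exact: H.
  have EF : F = lead_coef F *: prodX predT z.
    by rewrite {1}E; congr (_ *: _); rewrite /prodX (big_nth 0) sr big_mkord.
  rewrite -(pre_weighted l0 ml sf) -/F EF preZ; apply: strictT_scale; last exact: strict_spaced_strictT.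
  by rewrite lead_coef_eq0.
have [a [z [a0 zu E]]] := unit_zeros l0 ml (strictT_weakT sTf).
have sz := strictT_strict_spaced l0 ml sTf a0 zu E.
have fn : f`_m.+1 != 0.
  have [_ [eps [e1 se]] f0 _] := sTf; have := se 0%N isT; rewrite subn0 => h.
  by rewrite -(conjC_eq0 (f`_m.+1)) h mulf_neq0 // -nsq_gt0 e1.
split; first by apply/eqP; rewrite size_weighted_full.
exists [seq z i | i <- enum I].
have lcE : lead_coef (weighted m.+1 lam f) = a.
  rewrite E lead_coefZ; have := monic_prod_XsubC (enum I) predT z.
  rewrite (_ : \prod_(i <- enum I | _) _ = prodX predT z) => [/monicP ->|]; first by rewrite mulr1.
  by rewrite /prodX big_enum_cond; apply: eq_bigl.
split.
- rewrite lcE E; congr (_ *: _); rewrite big_map /prodX big_enum /=; exact: eq_bigl.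
- by move=> x /mapP[i _ ->]; apply/eqP; rewrite norm1_nsq zu.
- rewrite pairwise_map; have := enum_uniq I; rewrite uniq_pairwise.
  apply: sub_pairwise => i j ij /=.
  rewrite angle_cos //; first exact: (proj2 sz).
  exact: (lpi i j).
Qed.

Lemma classDP lam f : 0 <= lam -> m.+1%:R * lam < 2 * pi -> (size f <= m.+2)%N ->
  classD m.+1 lam (weighted m.+1 lam f) <-> dominated m lam f \/ strictT m lam f.
Proof.
move=> l0 ml sf; rewrite -(classD_open f l0 ml) -(classTP l0 ml sf) /classD.
by [].
Qed.

End ClassTranslation.

(** * Pencils of a polynomial and its n-inverse *)

Section Alternatives.
Variable R : realType.
Local Notation C := R[i].
Local Notation Re := (@complex.Re R).
Local Notation Im := (@complex.Im R).
Variable m : nat.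
Local Notation I := 'I_m.+1.
Local Notation star := (n_inverse m.+1).
Implicit Types (lam t s mu : R) (f g F G P Q A B q : {poly C}) (u v w c : C) (z : C) (k : nat).

Lemma disc_zero_poly P : (forall v, nsq v <= 1 -> P.[v] = 0) -> P = 0.
Proof.
move=> H; pose rs := [seq (k.+1%:R : C)^-1 | k <- iota 0 (size P)].
apply: (@roots_geq_poly_eq0 _ P rs).
- apply/allP => x /mapP[k _ ->]; apply/rootP/H.
  have -> : (k.+1%:R : C)^-1 = (((k.+1%:R : R)^-1)%:C)%C by rewrite fmorphV rmorph_nat.
  rewrite nsq_real expr_le1 // ?invr_ge0 // invf_le1 ?ltr0n //.
  by rewrite ler1n.
- rewrite map_inj_uniq ?iota_uniq // => i j /invr_inj/eqP.
  by rewrite eqr_nat eqSS => /eqP.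
- by rewrite size_map size_iota.
Qed.

(** The moduli of P and Q never agree, otherwise some P + c Q would vanish; along the
segment from 0 to u the sign of the difference cannot change. *)
Lemma ray P Q : (forall u c, nsq u <= 1 -> nsq c = 1 -> P.[u] + c * Q.[u] != 0) ->
  nsq Q.[0] < nsq P.[0] -> forall u, nsq u <= 1 -> nsq Q.[u] < nsq P.[u].
Proof.
move=> H H0 u u1.
pose g t := nsq P.[(t%:C)%C * u] - nsq Q.[(t%:C)%C * u].
have cid : continuous (fun t : R => t) by move=> t; exact: cvg_id.
have ct : ccont (fun t : R => (t%:C)%C * u) by apply: ccontM; [exact: ccont_real|exact: ccont_cst].
have cp q : ccont (fun t : R => q.[(t%:C)%C * u]).
  by apply: (@ccont_horner _ _ (fun=> q) _ (size q)) => //; exact: pcont_cst.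
rewrite -subr_gt0; have -> : nsq P.[u] - nsq Q.[u] = g 1 by rewrite /g rmorph1 mul1r.
apply: pos_no_zero.
- by move=> t; apply: cvgB; apply: continuous_nsq; exact: cp.
- by rewrite /g rmorph0 mul0r subr_gt0.
move=> t /andP[t0 t1]; rewrite /g subr_eq0; set x := _ * u; apply/eqP => e.
have x1 : nsq x <= 1.
  rewrite /x nsqM nsq_real; apply: le_trans u1.
  by rewrite ler_piMl ?nsq_ge0 // expr_le1.
have [Q0|Q0] := eqVneq Q.[x] 0.
  have := H x 1 x1 (nsq1 R); rewrite mul1r Q0 addr0 -nsq_eq0 e Q0.
  by rewrite nsq0 eqxx.
have c1 : nsq (- (P.[x] / Q.[x])) = 1.
  by rewrite nsqN nsqM nsqV e divff // nsq_eq0.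
by have := H x _ x1 c1; rewrite mulNr divfK // subrr eqxx.
Qed.

Lemma weighted_pencil N lam p q c u :
  (weighted N lam (p + c *: q)).[u] = (weighted N lam p).[u] + c * (weighted N lam q).[u].
Proof. by rewrite !weighted_had hadC hadD hadZ hornerD hornerZ !(hadC _ (Qpoly N lam)). Qed.

Lemma pencil_sinv f c : nsq c = 1 -> sinv m.+1 (star f + c *: f) c^*.
Proof.
move=> c1; split; first by rewrite nsq_conj.
move=> k km; rewrite !coefD !coefZ !coef_inv ltnS leq_subr ltnS km subKn //.
have cc : c^* * c = 1 by rewrite mulrC mul_conjE c1.
by rewrite rmorphD rmorphM /= conjCK mulrDr mulrA cc mul1r addrC.
Qed.

Lemma pencil_size f c : (size f <= m.+2)%N -> (size (star f + c *: f)%R <= m.+2)%N.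
Proof.
move=> sf; apply: leq_trans (size_polyD _ _) _; rewrite geq_max size_inv /=.
exact: leq_trans (size_scale_leq _ _) sf.
Qed.

Lemma pencil_neq0 (a b c : C) : nsq c = 1 -> nsq b < nsq a -> a + c * b != 0.
Proof.
move=> c1 ab; apply/eqP => e; move: ab; have -> : a = - (c * b).
  by apply/eqP; rewrite -addr_eq0 e.
by rewrite nsqN nsqM c1 mul1r ltxx.
Qed.

Lemma pencil_weakT lam f c : (size f <= m.+2)%N -> nsq c = 1 ->
  (forall u, nsq u < 1 -> nsq (weighted m lam f).[u] < nsq (weighted m lam (star f)).[u]) ->
  weakT m lam (star f + c *: f).
Proof.
move=> sf c1 H.
have z : zfree_open (weighted m lam (star f + c *: f)).
  by move=> u u1; rewrite weighted_pencil pencil_neq0 // H.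
split => //; [exact: pencil_size|by exists c^*; exact: pencil_sinv|].
by rewrite -(weighted_at0 m lam); apply: z; rewrite nsq0.
Qed.

Lemma pencil_strictT lam f c : (size f <= m.+2)%N -> nsq c = 1 -> dominated m lam f ->
  strictT m lam (star f + c *: f).
Proof.
move=> sf c1 H.
have z : zfree_closed (weighted m lam (star f + c *: f)).
  by move=> u u1; rewrite weighted_pencil pencil_neq0 // H.
split => //; [exact: pencil_size|by exists c^*; exact: pencil_sinv|].
by rewrite -(weighted_at0 m lam); apply: z; rewrite nsq0.
Qed.

(** The dilates r E(u) of A_f are dominated by A_f*(r u) on the circle, hence on
the disc.  Letting r tend to 1, the polynomials A_f* - c A_f with |c| <= 1 are limits of
polynomials without zeros: either they have none in the open disc, or one of them is zero.
In the second case the comparison at 0 gives |c| = 1, and f is self-inversive. *)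
Lemma open_alternative lam f : 0 <= lam -> m%:R * lam < 2 * pi -> (size f <= m.+2)%N ->
  f`_m.+1 != 0 ->
  (forall u, nsq u < 1 -> nsq (u * (weighted m lam (shiftc (star f))).[u]) < nsq (weighted m lam (star f)).[u]) ->
  weakT m lam f \/
  (nsq f`_0 < nsq f`_m.+1 /\
   forall u, nsq u < 1 -> nsq (weighted m lam f).[u] < nsq (weighted m lam (star f)).[u]).
Proof.
move=> l0 ml sf fn H.
set A := weighted m lam f in H *; set S := weighted m lam (star f) in H *.
set D := weighted m lam _ in H.
have zS : zfree_open S by move=> u u1; rewrite -nsq_gt0 (le_lt_trans _ (H u u1)) ?nsq_ge0.
(* E r is the n-inverse of the dilate of D by r, which agrees in modulus with that
   dilate on the circle. *)
pose E (r : R) : {poly C} := \poly_(k < m.+1) (((r ^+ (m - k))%:C)%C * A`_k).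
pose Sr (r : R) : {poly C} := S \Po ((r%:C)%C *: 'X).
have SrE r u : (Sr r).[u] = S.[(r%:C)%C * u] by rewrite /Sr horner_comp hornerZ hornerX.
have rr (r : R) u : 0 <= r -> r < 1 -> nsq u <= 1 -> nsq ((r%:C)%C * u) < 1.
  move=> r0 r1 u1; rewrite nsqM nsq_real; apply: le_lt_trans (_ : r ^+ 2 < 1).
    by rewrite ler_piMr ?sqr_ge0.
  by rewrite expr_lt1.
have dom (r : R) u : 0 <= r -> r < 1 -> nsq u <= 1 -> nsq ((r%:C)%C * (E r).[u]) < nsq (Sr r).[u].
  move=> r0 r1 u1; have zc : zfree_closed (Sr r).
    by move=> v v1; rewrite SrE zS // rr.
  have := @max_principle R ((r%:C)%C *: E r) (Sr r) zc _ u u1.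
  rewrite hornerZ; apply => v v1.
  have ED : E r = n_inverse m (D \Po ((r%:C)%C *: 'X)).
    apply/polyP => k; rewrite coef_inv coef_poly; case: ltnP => // km.
    rewrite coef_comp_scale /D -(inv_weighted_star f l0 ml) coef_inv ltnS leq_subr subKn //.
    rewrite rmorphM /= conjCK rmorphXn; congr (_ * _).
    by rewrite rmorphXn; congr (_ ^+ _); apply: complex_eq; rewrite ?Re_conjc ?Im_conjc /= ?oppr0.
  have sD : (size (D \Po ((r%:C)%C *: 'X))%R <= m.+1)%N.
    apply/leq_sizeP => k km; rewrite coef_comp_scale [D`_k]nth_default ?mulr0 //.
    exact: leq_trans (size_weighted _ _ _) km.
  rewrite hornerZ nsqM ED inv_unit // nsqM nsqX v1 expr1n mul1r nsq_conj horner_comp hornerZ hornerX -nsqM.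
  have := H ((r%:C)%C * v) (rr r v r0 r1 _); rewrite v1 => /(_ (lexx _)).
  by rewrite SrE -mulrA nsqM nsqM v1 mul1r -nsqM.
have f0n : nsq f`_0 <= nsq f`_m.+1.
  have cs : continuous (fun s : R => (1 - s) ^+ m.+1).
    have H1 : ccont (fun s : R => ((1 - s)%:C)%C ^+ m.+1 : C).
      apply: ccontX; apply: ccont_real => s.
      by apply: cvgB; [exact: cvg_cst|exact: cvg_id].
    by apply: cont_ext (continuous_Re H1) => s; rewrite -rmorphXn.
  have := @le_lim R (fun s => ((1 - s) ^+ m.+1) ^+ 2 * nsq f`_0) (fun=> nsq f`_m.+1) 0 1 ltr01.
  rewrite subr0 !expr1n mul1r; apply.
  - move=> s; apply: cvgM; last exact: cvg_cst.
    by apply: cvgM; exact: cs.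
  - by move=> s; exact: cvg_cst.
  move=> s s0 s1; rewrite add0r in s1.
  have := dom (1 - s) 0; rewrite SrE mulr0 !weighted_at0 star_coef0 nsq_conj.
  rewrite horner_coef0 coef_poly subn0 [A`_0]coef_poly Qcoef0 mul1r mulrA -rmorphM /= -exprS.
  rewrite nsq0 ler01 [nsq (_ * _)]nsqM nsq_real => h.
  by apply: ltW; apply: h => //; lra.
have [ex|nex] := pselect (exists2 u, nsq u < 1 & nsq S.[u] <= nsq A.[u]); last first.
  right; have op u : nsq u < 1 -> nsq A.[u] < nsq S.[u].
    by move=> u1; rewrite ltNge; apply/negP => h; apply: nex; exists u.
  split => //; have := op 0; rewrite nsq0 ltr01 => /(_ isT).
  by rewrite !weighted_at0 star_coef0 nsq_conj.
left; have [u u1 SA] := ex.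
have S0 : S.[u] != 0 by exact: zS.
have A0 : A.[u] != 0 by rewrite -nsq_gt0 (lt_le_trans _ SA) // nsq_gt0.
pose c := S.[u] / A.[u].
have c1 : nsq c <= 1 by rewrite nsqM nsqV ler_pdivrMr ?mul1r // nsq_gt0.
have EQ : S = c *: A.
  apply/eqP; rewrite -subr_eq0; apply/eqP/disc_zero_poly => v v1.
  pose P s := Sr (1 - s) - (c * ((1 - s)%:C)%C) *: E (1 - s).
  have P0 : P 0 = S - c *: A.
    rewrite /P subr0 mulr1; congr (_ - _ *: _); apply/polyP => k.
      by rewrite coef_comp_scale expr1n mul1r.
    rewrite coef_poly expr1n mul1r; case: ltnP => // km.
    by rewrite nth_default // (leq_trans (size_weighted _ _ _)).
  rewrite -P0; apply: (@hurwitz_eq0 R P m 0 1 u v) => //.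
  - move=> s; apply/leq_sizeP => k km; rewrite coefB coefZ coef_comp_scale [(E _)`_k]coef_poly ltnNge km mulr0 subr0.
    by rewrite [S`_k]nth_default ?mulr0 // (leq_trans (size_weighted _ _ _)).
  - move=> k; have cr : ccont (fun s : R => ((1 - s)%:C)%C : C).
      by apply: ccont_real => s; apply: cvgB; [exact: cvg_cst|exact: cvg_id].
    have H1 : ccont (fun s : R => ((1 - s)%:C)%C ^+ k * S`_k -
         (c * ((1 - s)%:C)%C) * (if (k < m.+1)%N then ((1 - s)%:C)%C ^+ (m - k) * A`_k else 0) : C).
      apply: ccontB; first by apply: ccontM; [exact: ccontX|exact: ccont_cst].
      apply: ccontM; first by apply: ccontM; [exact: ccont_cst|].
      case: (k < m.+1)%N; last exact: ccont_cst.
      by apply: ccontM; [exact: ccontX|exact: ccont_cst].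
    apply: ccont_ext H1 => s; rewrite coefB coefZ coef_comp_scale [(E _)`_k]coef_poly.
    by congr (_ - _ * _); case: ltnP => // _; rewrite rmorphXn.
  - move=> s s0 s1 x x1; rewrite add0r in s1.
    rewrite /P hornerD hornerN hornerZ subr_eq0; apply/eqP => e.
    have : nsq (((1 - s)%:C)%C * (E (1 - s)).[x]) < nsq (Sr (1 - s)).[x].
      by apply: dom; [lra|lra|exact: ltW].
    rewrite e -mulrA [ltRHS]nsqM.
    by rewrite ltNge ler_piMl ?nsq_ge0.
  - by rewrite P0 hornerD hornerN hornerZ /c divfK // subrr.
have cf k : (k <= m)%N -> (f`_(m.+1 - k))^* = c * f`_k.
  move=> km; have := congr1 (fun p : {poly C} => p`_k) EQ.
  rewrite coefZ !coef_poly ltnS km ltnS (leqW km) mulrCA.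
  exact/mulfI/Qcoef_neq0.
have h0 := cf 0%N isT; rewrite subn0 in h0.
have f00 : f`_0 != 0.
  by apply: contra fn => /eqP e; rewrite -conjC_eq0 h0 e mulr0.
have cc : nsq c = 1.
  apply/eqP; rewrite eq_le c1 /=.
  have := f0n; rewrite -(nsq_conj f`_m.+1) h0 nsqM -[leLHS]mul1r.
  by rewrite ler_pM2r // nsq_gt0.
split => //.
- exists c; split => // k; rewrite leq_eqVlt => /orP[/eqP ->|]; last exact: cf.
  rewrite subnn; have := congr1 Num.conj h0; rewrite conjCK rmorphM /= => ->.
  by rewrite mulrA mul_conjE cc mul1r.
- move=> v v1; have := zS v v1; rewrite EQ hornerZ mulf_eq0 negb_or.
  by case/andP.
Qed.

End Alternatives.

(** * Preservation by the deformed product *)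

Section Products.
Variable R : realType.
Local Notation C := R[i].
Local Notation Re := (@complex.Re R).
Local Notation Im := (@complex.Im R).
Variable m : nat.
Local Notation I := 'I_m.+1.
Local Notation star := (n_inverse m.+1).
Implicit Types (lam t s mu : R) (f g F G P Q A B q : {poly C}) (u v w c : C) (z : C) (k : nat).

Lemma hadDl N f g q : had N (f + g) q = had N f q + had N g q.
Proof. by rewrite hadC hadD !(hadC _ q). Qed.

Lemma star_had f g : star (had m.+2 f g) = had m.+2 (star f) (star g).
Proof.
apply/polyP => k; rewrite coef_inv !coef_had !coef_inv; case: ltnP => // km.
by rewrite ltnS leq_subr rmorphM.
Qed.

Lemma had_coef0 f g : (had m.+2 f g)`_0 = f`_0 * g`_0.
Proof. by rewrite coef_had. Qed.

Lemma product_weakT_strictT lam f g : 0 <= lam -> m.+1%:R * lam < 2 * pi ->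
  weakT m lam f -> strictT m lam g -> strictT m lam (had m.+2 f g).
Proof.
move=> l0 ml sf sg; have [_ [e e1] f0 _] := sf; have [_ [d d1] g0 _] := sg.
split.
- exact: size_had.
- exists (e * d); split; first by rewrite nsqM (proj1 e1) (proj1 d1) mulr1.
  move=> k km; rewrite !coef_had ltnS leq_subr ltnS km rmorphM /=.
  by rewrite (proj2 e1 k km) (proj2 d1 k km) mulrACA.
- by rewrite had_coef0 mulf_neq0.
- by apply: product_zfree.
Qed.

Lemma dominated_coef0 lam f : dominated m lam f -> nsq f`_0 < nsq f`_m.+1.
Proof.
move=> /(_ 0); rewrite nsq0 ler01 => /(_ isT).
by rewrite !weighted_at0 star_coef0 nsq_conj.
Qed.

Lemma product_weakT_dominated lam f g : 0 <= lam -> m.+1%:R * lam < 2 * pi -> (size g <= m.+2)%N ->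
  weakT m lam f -> dominated m lam g -> dominated m lam (had m.+2 f g).
Proof.
move=> l0 ml szg wf dg; have [sf [e e1] f0 _] := wf.
have E u : nsq (weighted m lam (star (had m.+2 f g))).[u] = nsq (weighted m lam (had m.+2 f (star g))).[u].
  rewrite star_had (sinv_inv e1 sf) hadZl weighted_had hadZl hornerZ nsqM (proj1 e1) mul1r.
  by rewrite weighted_had.
move=> u u1; rewrite E; apply: ray u u1.
- move=> u c u1 c1; rewrite -weighted_pencil -hadZ -hadD.
  by apply: (product_zfree l0 ml wf) => //; exact: pencil_strictT.
- rewrite !weighted_at0 !had_coef0 star_coef0 !nsqM nsq_conj ltr_pM2l ?nsq_gt0 //.
  exact: dominated_coef0 dg.
Qed.

Lemma product_open_strictT lam f g : 0 <= lam -> m.+1%:R * lam < 2 * pi -> (size f <= m.+2)%N ->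
  nsq f`_0 < nsq f`_m.+1 ->
  (forall u, nsq u < 1 -> nsq (weighted m lam f).[u] < nsq (weighted m lam (star f)).[u]) ->
  strictT m lam g -> dominated m lam (had m.+2 f g).
Proof.
move=> l0 ml szf f0n df sg; have [sz [e e1] g0 _] := sg.
have E u : nsq (weighted m lam (star (had m.+2 f g))).[u] = nsq (weighted m lam (had m.+2 (star f) g)).[u].
  rewrite star_had (sinv_inv e1 sz) hadZ weighted_had hadZl hornerZ nsqM (proj1 e1) mul1r.
  by rewrite weighted_had.
move=> u u1; rewrite E; apply: ray u u1.
- move=> u c u1 c1; rewrite -weighted_pencil -hadZl -hadDl.
  by apply: (product_zfree l0 ml _ sg) => //; exact: pencil_weakT.
- by rewrite !weighted_at0 !had_coef0 star_coef0 !nsqM nsq_conj ltr_pM2r ?nsq_gt0.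
Qed.

Lemma parallelogram (x y : C) : nsq (x + y) + nsq (x - y) = 2 * (nsq x + nsq y).
Proof. by rewrite !nsqD nsqN rmorphN mulrN Re_opp; ring. Qed.

(** Write a, b, c, d for the kernels of f* g*, f g*, f* g, f g.  For all
unimodular s and t the sum a + s b + t c + s t d has no zero, so |a + t c| > |b + t d|
and |a + s b| > |c + s d|.  Adding the squares for s, t = 1 and -1 gives |a| > |d|. *)
Lemma product_open_dominated lam f g : 0 <= lam -> m.+1%:R * lam < 2 * pi ->
  (size f <= m.+2)%N -> (size g <= m.+2)%N -> nsq f`_0 < nsq f`_m.+1 ->
  (forall u, nsq u < 1 -> nsq (weighted m lam f).[u] < nsq (weighted m lam (star f)).[u]) ->
  dominated m lam g -> dominated m lam (had m.+2 f g).
Proof.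
move=> l0 ml szf szg f0n df dg.
have gn := dominated_coef0 dg.
have torus c d u : nsq c = 1 -> nsq d = 1 -> nsq u <= 1 ->
    (weighted m lam (had m.+2 (star f + c *: f) (star g + d *: g))).[u] != 0.
  move=> c1 d1; apply: (product_zfree l0 ml); first exact: pencil_weakT.
  exact: pencil_strictT.
have H1 d u : nsq d = 1 -> nsq u <= 1 ->
    nsq (weighted m lam (had m.+2 f (star g + d *: g))).[u] <
    nsq (weighted m lam (had m.+2 (star f) (star g + d *: g))).[u].
  move=> d1; apply: ray => [v c v1 c1|].
    by rewrite -weighted_pencil -hadZl -hadDl; exact: torus.
  rewrite !weighted_at0 !had_coef0 !nsqM star_coef0 nsq_conj ltr_pM2r // nsq_gt0.
  by rewrite coefD coefZ star_coef0 pencil_neq0 // nsq_conj.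
have H2 c u : nsq c = 1 -> nsq u <= 1 ->
    nsq (weighted m lam (had m.+2 (star f + c *: f) g)).[u] <
    nsq (weighted m lam (had m.+2 (star f + c *: f) (star g))).[u].
  move=> c1; apply: ray => [v d v1 d1|].
    by rewrite -weighted_pencil -hadZ -hadD; exact: torus.
  rewrite !weighted_at0 !had_coef0 !nsqM star_coef0 nsq_conj ltr_pM2l // nsq_gt0.
  by rewrite coefD coefZ star_coef0 pencil_neq0 // nsq_conj.
move=> u u1; rewrite star_had.
have N1 : nsq (1 : C) = 1 := nsq1 R; have N2 : nsq (-1 : C) = 1 by rewrite nsqN.
have p1 := H1 1 u N1 u1; have p2 := H1 (-1) u N2 u1.
have q1 := H2 1 u N1 u1; have q2 := H2 (-1) u N2 u1.
rewrite !(hadD, hadZ) !weighted_pencil !mul1r in p1; rewrite !(hadD, hadZ) !weighted_pencil !mulN1r in p2.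
rewrite !(hadDl, hadZl) !weighted_pencil !mul1r in q1; rewrite !(hadDl, hadZl) !weighted_pencil !mulN1r in q2.
have := ltrD (ltrD p1 p2) (ltrD q1 q2); rewrite !parallelogram; lra.
Qed.

Lemma lambda_convE lam f g : 0 <= lam -> m.+1%:R * lam < 2 * pi ->
  lambda_conv m.+1 lam (weighted m.+1 lam f) (weighted m.+1 lam g) =
  weighted m.+1 lam (had m.+2 f g).
Proof.
move=> l0 ml; apply/polyP => k; rewrite !coef_poly; case: ltnP => // km.
have q0 : Qcoef m.+1 lam k != 0 by exact: Qcoef_neq0.
by move: q0; move: (Qcoef _ _ _) (f`_k) (g`_k) => q a b q0; field.
Qed.

Lemma Qpoly_horner_neq0 N lam u : nsq u < 1 -> (Qpoly N lam).[u] != 0.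
Proof.
move=> u1; rewrite /Qpoly horner_prod; apply/prodf_neq0 => j _.
rewrite hornerD hornerC hornerZ hornerX addrC -(opprK (1 : C)) subr_eq0.
apply/eqP => /(congr1 (@nsq R)); rewrite nsqM nsq_expi mul1r nsqN nsq1 => e.
by move: u1; rewrite e ltxx.
Qed.

(** The unit of the coefficientwise product; weighted n lam ones is Qpoly n lam. *)
Definition ones : {poly C} := \poly_(k < m.+2) 1.

Lemma ones_classDbar lam : 0 <= lam -> m.+1%:R * lam < 2 * pi ->
  classDbar m.+1 lam (weighted m.+1 lam ones).
Proof.
move=> l0 ml; apply/classDbarP => //; split; first by rewrite coef_poly ltnSn oner_eq0.
have E1 : weighted m lam (star ones) = Qpoly m lam.
  apply/polyP => k; rewrite coef_poly; case: ltnP => km; last first.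
    by rewrite nth_default // (leq_trans (size_Qpoly_leq _ _)).
  by rewrite coef_inv ltnW // coef_poly ltnS leq_subr rmorph1 mulr1.
have E2 : weighted m lam (shiftc (star ones)) = Qpoly m lam.
  apply/polyP => k; rewrite coef_poly; case: ltnP => km; last first.
    by rewrite nth_default // (leq_trans (size_Qpoly_leq _ _)).
  by rewrite coef_shiftc coef_inv ltnS km coef_poly ltnS leq_subr rmorph1 mulr1.
move=> u u1; rewrite E1 E2 nsqM gtr_pMl // nsq_gt0.
exact: Qpoly_horner_neq0.
Qed.

Lemma conv_ones lam G : 0 <= lam -> m.+1%:R * lam < 2 * pi -> (size G <= m.+2)%N ->
  lambda_conv m.+1 lam (weighted m.+1 lam ones) G = G.
Proof.
move=> l0 ml sG; apply/polyP => k; rewrite coef_poly; case: ltnP => km; last first.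
  by rewrite nth_default // (leq_trans sG).
have q0 : Qcoef m.+1 lam k != 0 by exact: Qcoef_neq0.
by rewrite !coef_poly km mulr1 divff // mulr1 mulrCA divff // mulr1.
Qed.

Lemma classDbar_size lam F : classDbar m.+1 lam F -> size F = m.+2.
Proof. by rewrite /classDbar; case: ifP => _ []. Qed.

(** Testing on the unit gives one implication; for the other, each factor is
self-inversive or dominated, which makes four cases. *)
Theorem conv_preserves lam G : 0 <= lam -> m.+1%:R * lam < 2 * pi -> size G = m.+2 ->
  (forall F, classDbar m.+1 lam F -> classD m.+1 lam (lambda_conv m.+1 lam F G)) <->
  classD m.+1 lam G.
Proof.
move=> l0 ml sG; have ml' := ml_le l0 ml; split=> [H|DG F DF].
  by have := H _ (ones_classDbar l0 ml); rewrite conv_ones // sG.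
have sF := classDbar_size DF.
have EF : weighted m.+1 lam (pre m lam F) = F by rewrite weighted_pre // sF.
have EG : weighted m.+1 lam (pre m lam G) = G by rewrite weighted_pre // sG.
rewrite -EF in DF; rewrite -EG in DG; rewrite -EF -EG lambda_convE //.
have sf : (size (pre m lam F) <= m.+2)%N by exact: size_poly.
have sg : (size (pre m lam G) <= m.+2)%N by exact: size_poly.
move: (pre m lam F) (pre m lam G) sf sg DF DG => f g sf sg {F G sG sF EF EG}.
move=> /(classDbarP f l0 ml)[fn Hf] /(classDP l0 ml sg) Hg.
apply/(classDP l0 ml (size_had _ _ _)).
have [wf|[f0n Of]] := open_alternative l0 ml' sf fn Hf.
  case: Hg => [dg|tg]; first by left; exact: product_weakT_dominated.
  right; exact: product_weakT_strictT.
case: Hg => [dg|tg]; left; first exact: product_open_dominated.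
exact: product_open_strictT.
Qed.

End Products.

(** * Passing to a larger spacing *)

Section Widening.
Variable R : realType.
Local Notation C := R[i].
Local Notation Re := (@complex.Re R).
Local Notation Im := (@complex.Im R).
Variable m : nat.
Local Notation I := 'I_m.+1.
Local Notation star := (n_inverse m.+1).
Implicit Types (lam t s mu : R) (f g F G P Q A B q : {poly C}) (u v w c : C) (z : C) (k : nat).

Lemma geometric_pre_extremal g b : (size g <= m.+2)%N -> g`_0 != 0 -> nsq b = 1 ->
  (forall k : nat, (k <= m)%N -> g`_k.+1 = b * g`_k) -> pre_extremal m.+1 g.
Proof.
move=> sg g0 b1 H; exists g`_0, b; split => //; first by apply/eqP; rewrite norm1_nsq b1.
apply/polyP => k; rewrite coef_poly; case: ltnP => km; first exact: (geometric_coef H).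
by rewrite nth_default // (leq_trans sg).
Qed.

Lemma pre_extremalZ g a : a != 0 -> pre_extremal m.+1 g -> pre_extremal m.+1 (a *: g).
Proof.
move=> a0 [c [b [c0 b1 ->]]]; exists (a * c), b; split => //; first exact: mulf_neq0.
by apply/polyP => k; rewrite coefZ !coef_poly; case: ifP; rewrite ?mulr0 ?mulrA.
Qed.

Lemma dominated_of_pencil mu f : nsq f`_0 < nsq f`_m.+1 ->
  (forall c, nsq c = 1 -> zfree_closed (weighted m mu (star f + c *: f))) -> dominated m mu f.
Proof.
move=> f0n H u u1; apply: ray u u1 => [u c u1 c1|].
  by rewrite -weighted_pencil; exact: H.
by rewrite !weighted_at0 star_coef0 nsq_conj.
Qed.

(** Every member of the pencil of f is self-inversive with kernel free of zeros in
the open disc, and not geometric by assumption. *)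
Theorem classD_wider lam mu f : 0 <= lam -> lam < mu -> m.+1%:R * mu < 2 * pi ->
  (size f <= m.+2)%N -> classDbar m.+1 lam (weighted m.+1 lam f) ->
  (forall c, `|c| = 1 -> ~ pre_extremal m.+1 (f + c *: star f)) ->
  classD m.+1 mu (weighted m.+1 mu f).
Proof.
move=> l0 lm mm sf Df npe.
have mu0 : 0 <= mu by apply: ltW; apply: le_lt_trans lm.
have ml : m.+1%:R * lam < 2 * pi by apply: lt_trans mm; rewrite ltr_pM2l ?ltr0n.
have ml' := ml_le l0 ml.
move: Df => /(classDbarP f l0 ml)[fn Hf]; apply/(classDP mu0 mm sf).
have [wf|[f0n Of]] := open_alternative l0 ml' sf fn Hf; [right|left].
  have [_ [e e1] f0 _] := wf.
  have [zf|[b b1 Hb]] := wider_zfree l0 ml wf lm (ltW mm).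
    by split => //; exists e.
  exfalso; apply: (npe e^*); first by apply/eqP; rewrite norm1_nsq nsq_conj (proj1 e1).
  have -> : f + e^* *: star f = (2 : C) *: f.
    rewrite (sinv_inv e1 sf) scalerA mulrC mul_conjE (proj1 e1) rmorph1 scale1r.
    by rewrite scaler_nat mulr2n.
  by apply: pre_extremalZ; [rewrite pnatr_eq0|exact: geometric_pre_extremal Hb].
apply: dominated_of_pencil => // c c1.
have wg := pencil_weakT sf c1 Of.
have [//|[b b1 Hb]] := wider_zfree l0 ml wg lm (ltW mm).
exfalso; apply: (npe c^*); first by apply/eqP; rewrite norm1_nsq nsq_conj c1.
have -> : f + c^* *: star f = c^* *: (star f + c *: f).
  by rewrite scalerDr scalerA mulrC mul_conjE c1 rmorph1 scale1r addrC.
have [sg _ g0 _] := wg.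
apply: pre_extremalZ; last exact: geometric_pre_extremal Hb.
by rewrite -nsq_eq0 nsq_conj c1 oner_eq0.
Qed.

End Widening.

(** * The extreme spacing *)

Section Extreme.
Variable R : realType.
Local Notation C := R[i].
Local Notation Re := (@complex.Re R).
Local Notation Im := (@complex.Im R).
Local Notation star m := (n_inverse m.+1).
Implicit Types (lam t s mu : R) (f g F G P Q A B q : {poly C}) (u v w c : C) (z : C) (m k : nat).

(** The kernel of a geometric progression is a rotation of Qpoly (m + 1) lam,
whose zeros are on the circle. *)
Lemma strictT_not_geometric m lam g b : 0 <= lam -> m.+2%:R * lam < 2 * pi -> strictT m.+1 lam g ->
  nsq b = 1 -> (forall k, (k <= m.+1)%N -> g`_k.+1 = b * g`_k) -> False.
Proof.
move=> l0 ml [sg _ g0 zg] b1 H.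
pose u := - expi (- ((2 * 1%:R - m.+1%:R - 1) * lam / 2)) / b.
have b0 : b != 0 by rewrite -nsq_gt0 b1.
have u1 : nsq u <= 1 by rewrite nsqM nsqV b1 nsqN nsq_expi invr1 mulr1.
have := zg u u1; apply/negP; rewrite negbK.
have -> : (weighted m.+1 lam g).[u] = g`_0 * (Qpoly m.+1 lam).[b * u].
  rewrite weighted_had hadE (horner_coef_wide _ (size_Qpoly_leq _ _)) mulr_sumr.
  apply: eq_bigr => k _; rewrite (geometric_coef H) ?exprMn; last by rewrite ltnW.
  ring.
rewrite mulf_eq0; apply/orP; right; rewrite /Qpoly horner_prod big_ord_recl mulf_eq0.
apply/orP; left; rewrite hornerD hornerC hornerZ hornerX /u.
by rewrite [b * _]mulrC divfK // mulrN expiNr subrr.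
Qed.

Lemma weighted_extreme m f : weighted m (2 * pi / m.+1%:R) f = take_poly m.+1 f.
Proof.
by apply/polyP => k; rewrite coef_poly coef_take_poly; case: ltnP => // km; rewrite Qcoef_extreme // mul1r.
Qed.

(** The pencil of f contains no geometric progression when n >= 2; for n = 1
the kernel is constant. *)
Lemma dominated_extreme m lam f : 0 <= lam -> m.+1%:R * lam < 2 * pi -> (size f <= m.+2)%N ->
  dominated m lam f -> dominated m (2 * pi / m.+1%:R) f.
Proof.
move=> l0 ml sf df; have f0n := dominated_coef0 df.
apply: dominated_of_pencil => // c c1.
have sg := pencil_strictT sf c1 df.
have lm : lam < 2 * pi / m.+1%:R by rewrite ltr_pdivlMr ?ltr0n // mulrC.
have mm : m.+1%:R * (2 * pi / m.+1%:R) <= 2 * pi :> R by rewrite mulrC divfK // pnatr_eq0.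
have [//|[b b1 Hb]] := wider_zfree l0 ml (strictT_weakT sg) lm mm.
case: m => [|m] in f sf df f0n ml c c1 sg lm mm b b1 Hb *.
  move=> u _; rewrite horner_poly big_ord1 expr0 mulr1 mulf_neq0 //; last by case: sg.
  by rewrite Qcoef0 oner_eq0.
by case: (strictT_not_geometric l0 ml sg b1 Hb).
Qed.

(** The strict inequality at mu holds on a compact set, so it persists for
nearby lam. *)
Lemma dominated_near m mu f : 0 < mu -> dominated m mu f ->
  exists lam, [/\ 0 <= lam, lam < mu & dominated m lam f].
Proof.
move=> mu0 df.
pose K := [set v : 'rV[R]_2 | forall i, (fun=> 0) i <= v 0 i <= (fun i => if i == ord0 then 1 else 2 * pi) i].
have cK : compact K by exact: box_compact.
pose pt (v : 'rV[R]_2) : C := ((v 0 ord0)%:C)%C * expi (v 0 ord_max).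
have cpt : ccont pt.
  by apply: ccontM; [apply: ccont_real|apply: ccont_expi]; exact: coord_continuous.
pose g (x : 'rV[R]_2 * R) : R :=
  nsq (weighted m x.2 (star m f)).[pt x.1] - nsq (weighted m x.2 f).[pt x.1].
have cw q : ccont (fun x : 'rV[R]_2 * R => (weighted m x.2 q).[pt x.1]).
  apply: (@ccont_horner _ _ _ _ m.+1) => [x| |].
  - exact: size_weighted.
  - move=> k; have H1 : ccont (fun x : 'rV[R]_2 * R => if (k < m.+1)%N then (Qpoly m x.2)`_k * q`_k else 0).
      case: (k < m.+1)%N; last exact: ccont_cst.
      apply: ccontM; last exact: ccont_cst.
      by apply: pcont_Qpoly => x; exact: cvg_snd.
    by apply: ccont_ext H1 => x; rewrite coef_poly.
  - by apply: (ccont_comp _ cpt) => x; exact: cvg_fst.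
have cg : continuous g.
  by move=> x; apply: cvgB; apply: continuous_nsq; exact: cw.
have ncov := proj1 (compact_near_coveringP K) cK _ (nbhs mu) (fun l (x : 'rV[R]_2) => 0 < g (x, l)).
have H (x : 'rV[R]_2) : K x -> \near x & mu, 0 < g (x, mu).
  move=> Kv; have gv : 0 < g (x, mu).
    rewrite subr_gt0; apply: df; rewrite nsq_polar.
    have := Kv ord0; rewrite /= => /andP[h1 h2].
    by rewrite expr_le1.
  have := @cvgr_gt _ _ _ _ g _ (cg (x, mu)) 0 gv.
  case=> -[D E] [/= nD nE] DE;
  by exists (D, E).
have /nbhs_ballP[e /= e0 He] := ncov (nbhs_filter mu) H.
pose d := Num.min e mu / 2.
have dm : 0 < Num.min e mu by rewrite lt_min e0.
have dle : Num.min e mu <= e by rewrite ge_min lexx.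
have dlm : Num.min e mu <= mu by rewrite ge_min lexx orbT.
exists (mu - d); split.
- rewrite subr_ge0 /d; lra.
- rewrite ltrBlDr ltrDl /d; lra.
move=> u /disc_polar[rho [t [rho1 t2 ->]]].
have bl : ball mu e (mu - d).
  rewrite /ball /= opprB addrC subrK ger0_norm /d; last lra.
  by rewrite ltr_pdivrMr //; lra.
have := He _ bl (\row_i if i == ord0 then rho else t).
rewrite /g /pt /= !mxE /= subr_gt0; apply.
by move=> i; rewrite /K /= !mxE; case: ifP.
Qed.

End Extreme.

Section Conclusion.
Variable R : realType.
Local Notation C := R[i].
Local Notation Re := (@complex.Re R).
Local Notation Im := (@complex.Im R).
Implicit Types (lam t s mu : R) (f g F G P Q A B q : {poly C}) (u v w c : C) (z : C) (m k : nat).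

(** Re w > 1/2 means |w - 1| < |w|. *)
Lemma Re_half (a b : C) : b - a != 0 -> (1 / 2 < Re (b / (b - a))) = (nsq a < nsq b).
Proof.
move=> d0; have dp : 0 < nsq (b - a) by rewrite nsq_gt0.
have -> : b / (b - a) = (((nsq (b - a))^-1)%:C)%C * (b * (b - a)^*).
  apply: (mulIf d0); rewrite divfK //.
  transitivity (((nsq (b - a))^-1%:C)%C * ((b - a) * (b - a)^*) * b); last by ring.
  by rewrite mul_conjE -rmorphM mulVf ?nsq_eq0 // rmorph1 mul1r.
rewrite Re_realM [ltRHS]mulrC ltr_pdivlMr // nsqD nsqN rmorphB rmorphN mulrBr mulrN mul_conjE.
rewrite Re_add !Re_opp Re_real; apply/idP/idP; lra.
Qed.

Lemma extreme_halves m f z : size f = m.+2 ->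
  (weighted m (2 * pi / m.+1%:R) f).[z] = f.[z] - f`_m.+1 * z ^+ m.+1 /\
  z * (weighted m (2 * pi / m.+1%:R) (shiftc f)).[z] = f.[z] - f`_0.
Proof.
move=> sf; rewrite !weighted_extreme (@horner_coef_wide _ m.+2 f z) ?sf //; split.
  rewrite big_ord_recr /= addrK (@horner_coef_wide _ m.+1 _ z) ?size_take_poly //.
  by apply: eq_bigr => k _; rewrite coef_take_poly ltn_ord.
rewrite big_ord_recl expr0 mulr1 addrAC subrr add0r.
rewrite (@horner_coef_wide _ m.+1 _ z) ?size_take_poly // mulr_sumr.
by apply: eq_bigr => k _; rewrite coef_take_poly ltn_ord coef_shiftc exprS mulrCA.
Qed.

Lemma extreme_criterion m f : size f = m.+2 -> nsq f`_0 < nsq f`_m.+1 ->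
  dominated m (2 * pi / m.+1%:R) f <->
  (forall z, 1 <= `|z| -> 1 / 2 < Re ((f.[z] - f`_0) / (f`_m.+1 * z ^+ m.+1 - f`_0))).
Proof.
move=> sf f0n; set mu := 2 * pi / _.
have mu0 : 0 <= mu by rewrite divr_ge0 // mulr_ge0 // pi_ge0.
have mp : m.+1%:R * mu = 2 * pi by rewrite mulrC divfK // pnatr_eq0.
have mm : m%:R * mu < 2 * pi.
  by rewrite -mp ltr_pM2r ?ltr_nat // divr_gt0 // mulr_gt0 // pi_gt0.
have fn : f`_m.+1 != 0 by rewrite -nsq_gt0 (le_lt_trans _ f0n) // nsq_ge0.
have pt z : 1 <= nsq z ->
   (1 / 2 < Re ((f.[z] - f`_0) / (f`_m.+1 * z ^+ m.+1 - f`_0))) =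
   (nsq (weighted m mu f).[z] < nsq (z * (weighted m mu (shiftc f)).[z])).
  move=> z1; have [-> ->] := extreme_halves z sf.
  have E : f`_m.+1 * z ^+ m.+1 - f`_0 = (f.[z] - f`_0) - (f.[z] - f`_m.+1 * z ^+ m.+1) by ring.
  rewrite [in LHS]E Re_half // -E subr_eq0; apply/eqP => e.
  move: f0n; rewrite -e nsqM nsqX ltNge ler_peMr ?nsq_ge0 //.
  exact: exprn_ege1.
rewrite -(outer_dominated f mu0 mm); split=> [[_ H] z|H].
  by rewrite norm_ge1 => z1; rewrite pt // H.
by split=> // z z1; rewrite -pt // H // norm_ge1.
Qed.

(** Domination at some lam < 2 pi/n and domination at 2 pi/n are equivalent.
The class PT is excluded by |f_0| < |f_n|. *)
Theorem half_plane_criterion m f : size f = m.+2 -> `|f`_0| < `|f`_m.+1| ->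
  (exists lam, [/\ 0 <= lam, lam < 2 * pi / m.+1%:R &
     (precoef m.+1 (classD m.+1) lam `\` precoef m.+1 (classT m.+1) lam) f]) <->
  (forall z, 1 <= `|z| -> 1 / 2 < Re ((f.[z] - f`_0) / (f`_m.+1 * z ^+ m.+1 - f`_0))).
Proof.
move=> sf; rewrite ltr_nsq => f0n; have sf' : (size f <= m.+2)%N by rewrite sf.
have ml lam : lam < 2 * pi / m.+1%:R -> m.+1%:R * lam < 2 * pi.
  by rewrite ltr_pdivlMr ?ltr0n // mulrC.
rewrite -extreme_criterion //; split=> [[lam [l0 /ml lm [[_ Df] nT]]]|df].
  apply: (dominated_extreme l0 lm sf').
  have [//|strictT] := proj1 (classDP l0 lm sf') Df.
  by case: nT; split => //; apply/classTP.
have mu0 : 0 < 2 * pi / m.+1%:R :> R by rewrite divr_gt0 // mulr_gt0 // pi_gt0.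
have [lam [l0 lm dl]] := dominated_near mu0 df; exists lam; split => //.
split; first by split => //; apply/classDP => //; [exact: ml|left].
move=> -[_ /(classTP l0 (ml _ lm) sf')[_ [e [e1 se]] _ _]].
have := se 0%N isT; rewrite subn0 => /(congr1 (@nsq R)).
by rewrite nsqM e1 nsq_conj mul1r => e2; rewrite e2 ltxx in f0n.
Qed.

End Conclusion.

Theorem theorem7 (R : realType) (n : nat) (hn : (0 < n)%N) (lambda : R)
    (hlambda0 : 0 <= lambda) (hlambda : lambda < 2 * pi / n%:R) :
  [/\ (forall G : {poly R[i]}, size G = n.+1 ->
        (forall F : {poly R[i]},
            classDbar n lambda F -> classD n lambda (lambda_conv n lambda F G))
        <-> classD n lambda G),
      (forall (mu : R) (f : {poly R[i]}),
        lambda < mu -> mu < 2 * pi / n%:R ->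
        precoef n (classDbar n) lambda f ->
        (forall zeta : R[i], `|zeta| = 1 ->
           ~ pre_extremal n (f + zeta *: n_inverse n f)) ->
        precoef n (classD n) mu f)
    & (forall f : {poly R[i]},
        size f = n.+1 -> `|f`_0| < `|f`_n| ->
        (exists lambda' : R,
           [/\ 0 <= lambda', lambda' < 2 * pi / n%:R
             & (precoef n (classD n) lambda' `\` precoef n (classT n) lambda') f])
        <-> (forall z : R[i], 1 <= `|z| ->
               1 / 2 < complex.Re ((f.[z] - f`_0) / (f`_n * z ^+ n - f`_0))))].
Proof.
case: n hn hlambda => [//|m] _.
have scaled (t : R) : t < 2 * pi / m.+1%:R -> m.+1%:R * t < 2 * pi.
  by rewrite ltr_pdivlMr ?ltr0n // mulrC.
move=> /scaled hl; split.
- by move=> G sG; exact: conv_preserves.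
- move=> mu f lm /scaled hmu [sf Df] npe; split => //.
  exact: (classD_wider hlambda0 lm hmu sf Df npe).
- by move=> f sf f0n; exact: half_plane_criterion.
Qed.
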